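(* For a real operator system $\mathcal{S}$ the following are equivalent: (a) $\mathcal{S}$ has the real WEP; (b) the complexification $\mathcal{S}_c$ has the complex WEP; (c) $\mathcal{S}\otimes_{\rm el}\mathcal{T}=\mathcal{S}\otimes_{\max}\mathcal{T}$ for all real operator systems $\mathcal{T}$; (d) $\mathcal{S}\otimes_{\rm el}\mathcal{T}=\mathcal{S}\otimes_{\max}\mathcal{T}$ for all finite dimensional real operator systems $\mathcal{T}$.
   Context: A real (resp. complex) operator system is a unital selfadjoint real (resp. complex) subspace of $B(H)$, $H$ a real (resp. complex) Hilbert space, with matrix cones $M_n(V)^+$. The complexification of a real operator system $V$ is the complex operator system $V_c=V+iV$ with $(x+iy)^*=x^*-iy^*$, the same unit, and $M_n(V_c)^+=\{x+iy:x=x^*,\,y=-y^*\in M_n(V),\ \begin{bmatrix} x & -y \\ y & x \end{bmatrix}\in M_{2n}(V)^+\}$. A ucp map is a linear unital completely positive map. $I(V)$ denotes the (real or complex) injective envelope of $V$: an injective operator system containing $V$ as a subsystem such that the only ucp map $I(V)\to I(V)$ which is the identity on $V$ is the identity. An operator system $\mathcal{S}$ has the (real or complex) WEP (weak expectation property) if the canonical inclusion $\mathcal{S}\to\mathcal{S}^{dd}$ into the bidual operator system extends to a ucp map $I(\mathcal{S})\to\mathcal{S}^{dd}$, everything taken over the respective field; the bidual has the structure for which, if $\mathcal{S}$ is a subsystem of a unital C$^*$-algebra $A$, then $\mathcal{S}^{dd}=\mathcal{S}^{**}\subseteq A^{**}$ is a subsystem. For real operator systems $V,W$ with units $e,f$: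 a selfadjoint $x$ is in $M_n(V\otimes_{\max}W)^+$ iff for every $\epsilon>0$ there are finitely many $A_i\in M_{n_i}(V)^+$, $B_i\in M_{m_i}(W)^+$ and a real scalar matrix $\alpha$ with $x+\epsilon I_n\otimes e\otimes f=\alpha^T{\rm diag}(A_1\otimes B_1,\dots,A_k\otimes B_k)\alpha$; and $V\otimes_{\rm el}W$ is $V\otimes W$ with the operator system structure inherited from the inclusion $V\otimes W\subseteq I(V)\otimes_{\max}W$. Equality of tensor products means equality of all the matrix cones on $V\otimes W$. *)

(* Defs.v *)
(* Operator systems over K, where either K = R is a [realType] and [conj] is the
   identity, or K = R[i] and [conj] is complex conjugation. *)
From HB Require Import structures.
From mathcomp Require Import all_boot all_order all_algebra sesquilinear.
From mathcomp Require Import all_classical all_reals all_analysis.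
From mathcomp Require Import complex mxtens.

Set Implicit Arguments.
Unset Strict Implicit.
Unset Printing Implicit Defensive.
Import Order.TTheory GRing.Theory Num.Theory.
Import numFieldNormedType.Exports.

Local Open Scope classical_set_scope.
Local Open Scope ring_scope.
Local Open Scope complex_scope.

(* [hdot] is linear in its first argument. *)
Record hilbert (K : numFieldType) (conj : K -> K) := Hilbert {
  hsort :> completeNormedModType K;
  hdot : {dot hsort for conj};
  hdotE : forall x : hsort, `|x| ^+ 2 = hdot x x
}.

(* [matord] and [matsys] are raw data: the cones and the unit satisfy no axiom
   before [is_opsys]. *)

Record matord (K : numFieldType) := MatOrd {
  mo_sort :> lmodType K;
  mo_cone : forall n, set 'M[mo_sort]_n
}.

Record matsys (K : numFieldType) (conj : K -> K) := MatSys {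
  ms_ord :> matord K;
  ms_star : ms_ord -> ms_ord;
  ms_unit : ms_ord;
  ms_starK : involutive ms_star;
  ms_star_lin : forall a u v,
    ms_star (a *: u + v) = conj a *: ms_star u + ms_star v
}.
Arguments mo_cone {K} V n : rename.
Arguments ms_star {K conj V} : rename.
Arguments ms_unit {K conj} V : rename.

Definition mxstar (K : numFieldType) (conj : K -> K) (V : matsys conj) n
  (A : 'M[V]_n) : 'M[V]_n := \matrix_(i, j) ms_star (A j i).

(* [T] is an inclusion of [V] in B(H) as a unital selfadjoint subspace, the
   cones of [V] being those of M_n(B(H)) = B(H^n). *)
Definition represents (K : numFieldType) (conj : K -> K) (V : matsys conj)
    (H : hilbert conj) (T : V -> {linear H -> H}) : Prop :=
  [/\ (forall v, continuous (T v))
      /\ (forall a u v h, T (a *: u + v) h = a *: T u h + T v h),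
      (forall v, (forall h, T v h = 0) -> v = 0),
      (forall v h k, hdot H (T v h) k = hdot H h (T (ms_star v) k)),
      (forall h, T (ms_unit V) h = h)
    & forall n (A : 'M[V]_n), mo_cone V n A <->
        mxstar A = A /\
        forall h : 'I_n -> H,
          0 <= \sum_i \sum_j hdot H (T (A i j) (h j)) (h i)].

Definition is_opsys (K : numFieldType) (conj : K -> K) (V : matsys conj) :=
  exists (H : hilbert conj) (T : V -> {linear H -> H}), represents T.

Record opsys (K : numFieldType) (conj : K -> K) := OpSys {
  os_sys :> matsys conj;
  os_repr : is_opsys os_sys
}.

Definition cp (K : numFieldType) (V W : matord K) (phi : V -> W) : Prop :=
  forall n (A : 'M[V]_n), mo_cone V n A -> mo_cone W n (map_mx phi A).

Definition ucp (K : numFieldType) (conj : K -> K) (V W : matsys conj)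
  (phi : {linear V -> W}) : Prop := cp phi /\ phi (ms_unit V) = ms_unit W.

(* The inclusions of [V] in [W] as a subsystem, up to complete order
   isomorphism. *)
Definition subsystem (K : numFieldType) (conj : K -> K) (V W : matsys conj)
    (j : {linear V -> W}) : Prop :=
  [/\ injective j, j (ms_unit V) = ms_unit W,
      (forall v, j (ms_star v) = ms_star (j v))
    & forall n (A : 'M[V]_n), mo_cone V n A <-> mo_cone W n (map_mx j A)].

Definition injective_opsys (K : numFieldType) (conj : K -> K)
    (I : opsys conj) : Prop :=
  forall (E F : opsys conj) (k : {linear E -> F}) (phi : {linear E -> I}),
    subsystem k -> ucp phi ->
    exists psi : {linear F -> I}, ucp psi /\ forall x, psi (k x) = phi x.

Definition injective_envelope (K : numFieldType) (conj : K -> K)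
    (V : matsys conj) (I : opsys conj) (j : {linear V -> I}) : Prop :=
  [/\ injective_opsys I, subsystem j
    & forall phi : {linear I -> I}, ucp phi ->
        (forall v, phi (j v) = j v) -> forall x, phi x = x].

(* M_n(K) = B(K^n) *)
Definition scalmx (K : numFieldType) (conj : K -> K) (n : nat) : matord K :=
  @MatOrd K 'M[K]_n (fun m (X : 'M['M[K]_n]_m) =>
    (forall i j, X i j = map_mx conj (X j i)^T) /\
    forall x : 'I_m -> 'cV[K]_n,
      0 <= \sum_i \sum_j (map_mx conj (x i)^T *m X i j *m x j) 0 0).

(* Bounded functionals on [V], where [nle v r] reads "the norm of v is at
   most r". *)
Section BoundedFunctionals.
Variables (K : numFieldType) (V : lmodType K) (nle : V -> K -> Prop).

Definition bounded_functional : {pred V -> K^o} := fun f : V -> K^o =>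
  `[< (forall a u v, f (a *: u + v) = a * f u + f v) /\
      exists M : K, forall v r, nle v r -> `|f v| <= M * r >].

Lemma bounded_functional_submod : submod_closed bounded_functional.
Proof.
split=> [|a f g /asboolP[fl [M fM]] /asboolP[gl [N gN]]]; apply/asboolP; split.
- by move=> a u v /=; rewrite mulr0 addr0.
- by exists 0 => v r _ /=; rewrite normr0 mul0r.
- move=> c u v; rewrite /= !scalrfctE !fctE /= fl gl /GRing.scale /=.
  by rewrite !mulrDr !mulrA (mulrC a c) addrACA.
exists (`|a| * M + N) => v r vr; rewrite fctE /= mulrDl.
rewrite (le_trans (ler_normD _ _))// lerD ?gN//.
by rewrite scalrfctE /GRing.scale /= normrM -mulrA ler_wpM2l// fM.
Qed.

HB.instance Definition _ :=
  GRing.isSubmodClosed.Build K (V -> K^o) bounded_functional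
    bounded_functional_submod.

Record bdual := BDual {
  bdual_fun :> V -> K^o;
  _ : bdual_fun \in bounded_functional
}.

HB.instance Definition _ := [isSub for bdual_fun].
HB.instance Definition _ := [Choice of bdual by <:].
HB.instance Definition _ := [SubChoice_isSubLmodule of bdual by <:].
End BoundedFunctionals.

(* The matrix ordered dual: M_n(V^d)^+ = CP(V, M_n). *)
Definition matdual (K : numFieldType) (conj : K -> K) (V : matord K)
    (nle : V -> K -> Prop) : matord K :=
  @MatOrd K (bdual nle) (fun n (f : 'M[bdual nle]_n) =>
    @cp K V (scalmx conj n) (fun v => \matrix_(k, l) (f k l : V -> K) v)).

(* The operator norm: in M_2(B(H)), [[r, v], [v^*, r]] >= 0 iff |v| <= r. *)
Definition norm_le (K : numFieldType) (conj : K -> K) (V : matsys conj)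
    (v : V) (r : K) : Prop :=
  0 <= r /\
  mo_cone V (1 + 1) (block_mx (const_mx (r *: ms_unit V)) (const_mx v)
                              (const_mx (ms_star v)) (const_mx (r *: ms_unit V))).

Definition opdual (K : numFieldType) (conj : K -> K) (V : matsys conj) :=
  matdual conj (@norm_le K conj V).

Definition dual_norm_le (K : numFieldType) (conj : K -> K) (V : matsys conj)
    (f : opdual V) (r : K) : Prop :=
  0 <= r /\ forall v s, norm_le v s -> `|(f : bdual _) v| <= r * s.

(* V^dd: its elements are those of the Banach space bidual V^**, and its cones
   are those of the dual of V^d; for V in a unital C*-algebra A these are the
   cones inherited from A^**. *)
Definition bidual (K : numFieldType) (conj : K -> K) (V : matsys conj) :=
  matdual conj (@dual_norm_le K conj V).

(* v and F represent the same functional on V^d. *)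
Definition is_eval (K : numFieldType) (conj : K -> K) (V : matsys conj)
    (v : V) (F : bidual V) : Prop :=
  forall f : opdual V, (F : bdual _) f = (f : bdual _) v.

(* The unit of V^dd is the evaluation at the unit of V. *)
Definition has_wep (K : numFieldType) (conj : K -> K) (S : matsys conj) : Prop :=
  exists (I : opsys conj) (j : {linear S -> I}),
    injective_envelope j /\
    exists phi : {linear I -> bidual S},
      [/\ cp phi, is_eval (ms_unit S) (phi (ms_unit I))
        & forall s, is_eval s (phi (j s))].

Definition finite_dimensional (K : numFieldType) (V : lmodType K) : Prop :=
  exists (n : nat) (b : 'I_n -> V),
    forall v, exists c : 'I_n -> K, v = \sum_i c i *: b i.

(* The algebraic tensor product, realized as the space of functionals on the
   bilinear forms spanned by the evaluations b |-> b v w. *)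
Section Tensor.
Variables (K : numFieldType) (V W : lmodType K).
Local Notation forms := {bilinear V -> W -> K^o}.

Definition tensor_span : {pred forms -> K^o} := fun t : forms -> K^o =>
  `[< exists s : seq (V * W), t = fun b => \sum_(p <- s) b p.1 p.2 >].

Lemma tensor_span_submod : submod_closed tensor_span.
Proof.
split=> [|a t u /asboolP[s ->] /asboolP[s' ->]]; apply/asboolP.
  by exists [::]; apply/funext => b; rewrite big_nil.
exists ([seq (a *: p.1, p.2) | p <- s] ++ s'); apply/funext => b.
rewrite big_cat big_map fctE /=; congr (_ + _).
rewrite scalrfctE scaler_sumr; apply: eq_bigr => p _ /=.
by rewrite linearZl_LR.
Qed.

HB.instance Definition _ :=
  GRing.isSubmodClosed.Build K (forms -> K^o) tensor_span tensor_span_submod.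

Record tensor := Tensor {
  tensor_fun :> forms -> K^o;
  _ : tensor_fun \in tensor_span
}.

HB.instance Definition _ := [isSub for tensor_fun].
HB.instance Definition _ := [Choice of tensor by <:].
HB.instance Definition _ := [SubChoice_isSubLmodule of tensor by <:].

Lemma pure_subproof (v : V) (w : W) :
  (fun b : forms => b v w) \in tensor_span.
Proof.
by apply/asboolP; exists [:: (v, w)]; apply/funext => b; rewrite big_seq1.
Qed.

Definition pure (v : V) (w : W) : tensor := Tensor (pure_subproof v w).
End Tensor.

Section TensorMap.
Variables (K : numFieldType) (V V' W W' : lmodType K).
Variables (j : {linear V -> V'}) (k : {linear W -> W'}).

Definition form_comp (b : {bilinear V' -> W' -> K^o}) (v : V) (w : W) : K^o :=
  b (j v) (k w).

Lemma form_comp_bilinear b : bilinear_for *:%R *:%R (form_comp b).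
Proof.
by split=> [w|v] a x y; rewrite /form_comp linearP ?linearPl ?linearPr.
Qed.

HB.instance Definition _ b := bilinear_isBilinear.Build K V W K^o *:%R *:%R
  (form_comp b) (form_comp_bilinear b).

Lemma tmap_subproof (t : tensor V W) :
  (fun b => t (form_comp b)) \in @tensor_span K V' W'.
Proof.
case: t => t /= /asboolP[s ->]; apply/asboolP.
exists [seq (j p.1, k p.2) | p <- s]; apply/funext => b.
by rewrite big_map.
Qed.

(* j (x) k *)
Definition tmap (t : tensor V W) : tensor V' W' := Tensor (tmap_subproof t).

Lemma tmap_pure v w : tmap (pure v w) = pure (j v) (k w).
Proof. exact: val_inj. Qed.
End TensorMap.

Section RealTensor.
Variable R : realType.
Local Notation conj := (@idfun R).

HB.instance Definition _ (V : matsys conj) :=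
  GRing.isLinear.Build R V V *:%R (@ms_star R conj V) (@ms_star_lin R conj V).

Definition tensor_mxstar (V W : matsys conj) n (x : 'M[tensor V W]_n) :
    'M[tensor V W]_n :=
  \matrix_(i, j) tmap (@ms_star R conj V) (@ms_star R conj W) (x j i).

Definition kron (V W : lmodType R) p q (A : 'M[V]_p) (B : 'M[W]_q) :
    'M[tensor V W]_(p * q) :=
  \matrix_(i, j) pure (A (mxtens_unindex i).1 (mxtens_unindex j).1)
                      (B (mxtens_unindex i).2 (mxtens_unindex j).2).

(* alpha^T X alpha *)
Definition compress (U : lmodType R) N n (alpha : 'M[R]_(N, n)) (X : 'M[U]_N) :
    'M[U]_n :=
  \matrix_(r, s) \sum_i \sum_j (alpha i r * alpha j s) *: X i j.

(* I_n (x) u *)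
Definition diag_const (U : lmodType R) n (u : U) : 'M[U]_n :=
  \matrix_(i, j) (if i == j then u else 0).

Definition max_cone (V W : matsys conj) n (x : 'M[tensor V W]_n) : Prop :=
  tensor_mxstar x = x /\
  forall eps : R, 0 < eps ->
    exists (k : nat) (p q : 'I_k -> nat)
           (A : forall i, 'M[V]_(p i)) (B : forall i, 'M[W]_(q i))
           (alpha : 'M[R]_(\sum_i (p i * q i)%N, n)),
      [/\ forall i, mo_cone V (p i) (A i),
          forall i, mo_cone W (q i) (B i)
        & x + diag_const n (eps *: pure (ms_unit V) (ms_unit W))
          = compress alpha (\mxdiag_i kron (A i) (B i))].

Definition el_cone (V W : matsys conj) n (x : 'M[tensor V W]_n) : Prop :=
  exists (I : opsys conj) (j : {linear V -> I}),
    injective_envelope j /\ max_cone (map_mx (tmap j (@idfun W)) x).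

Definition el_eq_max (V W : matsys conj) : Prop :=
  forall n (x : 'M[tensor V W]_n), el_cone x <-> max_cone x.
End RealTensor.

(* The pair (x, y) stands for x + iy. *)
Section Complexification.
Variable R : realType.

Section Space.
Variable V : lmodType R.

Definition cplx : Type := (V * V)%type.
HB.instance Definition _ := GRing.Zmodule.on cplx.

Definition cplx_scale (c : R[i]) (z : cplx) : cplx :=
  let: a +i* b := c in (a *: z.1 - b *: z.2, b *: z.1 + a *: z.2).

Fact cplx_scaleA a b z : cplx_scale a (cplx_scale b z) = cplx_scale (a * b) z.
Proof.
case: a b => [a1 a2] [b1 b2]; rewrite /cplx_scale /=; congr pair.
  by rewrite !(scalerBr, scalerDr, scalerBl, scalerDl, scalerA) !opprD addrACA.
rewrite !(scalerBr, scalerDr, scalerBl, scalerDl, scalerA) addrACA.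
by congr (_ + _); apply: addrC.
Qed.

Fact cplx_scale1 : left_id 1 cplx_scale.
Proof.
by case=> x y; rewrite /cplx_scale /= !scale1r !scale0r subr0 add0r.
Qed.

Fact cplx_scaleDr : right_distributive cplx_scale +%R.
Proof.
move=> [a1 a2] [x y] [x' y']; rewrite /cplx_scale /=; congr pair => /=.
  by rewrite !scalerDr opprD addrACA.
by rewrite !scalerDr addrACA.
Qed.

Fact cplx_scaleDl z : {morph cplx_scale^~ z : a b / a + b}.
Proof.
move=> [a1 a2] [b1 b2]; rewrite /cplx_scale /=; congr pair => /=.
  by rewrite !scalerDl opprD addrACA.
by rewrite !scalerDl addrACA.
Qed.

HB.instance Definition _ := GRing.Zmodule_isLmodule.Build R[i] cplx
  cplx_scaleA cplx_scale1 cplx_scaleDr cplx_scaleDl.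
End Space.

Variable V : matsys (@idfun R).

Definition cplx_star (z : cplx V) : cplx V := (ms_star z.1, - ms_star z.2).

Fact cplx_starK : involutive cplx_star.
Proof. by case=> x y; rewrite /cplx_star /= linearN /= !ms_starK opprK. Qed.

Fact cplx_star_lin a (u v : cplx V) :
  cplx_star (a *: u + v) = conjc a *: cplx_star u + cplx_star v.
Proof.
case: a u v => [a1 a2] [x y] [x' y']; rewrite /cplx_star.
congr pair; rewrite /= !linearD ?linearN !linearZ /=.
  by rewrite scalerN scaleNr opprK.
by rewrite scalerN scaleNr.
Qed.

Definition cplx_cone n (Z : 'M[cplx V]_n) : Prop :=
  let x : 'M[V]_n := map_mx fst Z in
  let y : 'M[V]_n := map_mx snd Z in
  [/\ x = mxstar x, y = - mxstar y & mo_cone V (n + n) (block_mx x (- y) y x)].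

Definition complexification : matsys (@conjc R) :=
  @MatSys R[i] (@conjc R) (@MatOrd R[i] (cplx V) cplx_cone)
    cplx_star (ms_unit V, 0) cplx_starK cplx_star_lin.
End Complexification.

Definition real_wep (R : realType) (S : matsys (@idfun R)) : Prop := has_wep S.
Definition complex_wep (R : realType) (S : matsys (@conjc R)) : Prop := has_wep S.

(* Main.v *)
(* (a) => (b): the complexification of I(S) is an injective envelope of S_c, so a
   weak expectation of S complexifies.  (b) => (a): by rigidity the injective
   envelope J of S_c carries a conjugate-linear complete order automorphism
   extending x + iy |-> x - iy; its fixed points form an injective envelope of S,
   and the real part of a complex weak expectation restricts to them.

   (a) => (c): by Hahn-Banach, positivity in S (x)_max T is tested by functionals
   on S (x) T that are nonnegative on the generating cone; such a functional is a
   completely positive map from T to S^d, and a weak expectation I(S) -> S^dd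
   extends it to I(S) (x) T.

   (d) => (a): an extension to I(S) (x) S^d, nonnegative on the generating cone, of
   the evaluation pairing of S with S^d is a weak expectation.  By the theorem of
   M. Riesz it exists once the pairing is nonnegative on the elements of S (x) S^d
   that are positive in I(S) (x) S^d.  Such an element involves finitely many
   functionals only.  Adjoining a positive functional that dominates them as order
   unit, they span a finite-dimensional subspace X of S^d which is an operator
   system (represented on an l^2-sum of finite-dimensional spaces, one for each
   positive matrix over S on which the order unit is definite), so
   S (x)_el X = S (x)_max X applies. *)

From HB Require Import structures.
Require Import Defs.
From mathcomp Require Import all_boot all_order all_algebra sesquilinear.
From mathcomp Require Import all_classical all_reals all_analysis.
From mathcomp Require Import complex mxtens ring lra.

Set Implicit Arguments.
Unset Strict Implicit.
Unset Printing Implicit Defensive.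
Import Order.TTheory GRing.Theory Num.Theory.
Import numFieldNormedType.Exports.

Local Open Scope classical_set_scope.
Local Open Scope ring_scope.
Local Open Scope complex_scope.

(** Over the reals the selfadjoint elements do not span: a skew element is no scalar multiple of a
    selfadjoint one, so nonnegativity on a cone of selfadjoint elements leaves a functional free on
    the skew part. The functionals on tensor products and on 2x2 matrices are therefore extended
    with respect to the cone of all [y] whose symmetrization [y + y^*] is positive. It contains each
    skew element together with its negative, which makes the functional star-invariant. For the same
    reason arbitrary elements are controlled through 2x2 matrices having them off the diagonal:
    [norm_le] has this form, completely positive maps respect adjoints because of it, and a
    functional [g] is dominated by a positive [d] in the sense that [[[d, g], [g^*, d]]] is positive
    over the dual. Such a [d] comes from extending a functional defined on matrices with scalar
    diagonal; its value at the unit, at most twice a bound of [g], makes the weak expectation built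
    from (d) bounded. An injective envelope of S always comes from the hypothesis of the implication
    at hand. *)

Definition mk_linear (K : numFieldType) (U V : lmodType K) (f : U -> V)
    (Hf : linear f) : {linear U -> V} :=
  HB.pack f (GRing.isLinear.Build K U V *:%R f Hf).

(* The two fields with conjugation, [R] with the identity and [R[i]] with
   [conjc], are treated together through what they share. *)
Record conj_field (K : numFieldType) (conj : K -> K) : Prop := ConjField {
  cjD : {morph conj : a b / a + b};
  cjM : {morph conj : a b / a * b};
  cjK : involutive conj;
  cj_norm : forall a, a * conj a = `|a| ^+ 2;
  cj_re : forall a, a + conj a <= `|a| *+ 2;
  cj_sqrt : exists s : K -> K, forall x, 0 <= x -> 0 <= s x /\ s x ^+ 2 = x
}.

(** * Inner products and Hilbert spaces *)

Record is_inner (K : numFieldType) (conj : K -> K) (P : lmodType K)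
    (d : P -> P -> K) : Prop := IsInner {
  hs_lin : forall a u v w, d (a *: u + v) w = a * d u w + d v w;
  hs_herm : forall u v, d u v = conj (d v u);
  hs_pos : forall u, u != 0 -> 0 < d u u
}.

(** Completeness is phrased with filters and squared distances, so that a space built by hand needs
    neither a norm nor a topology before [hilbert_of] supplies them. *)
Record is_hilbert (K : numFieldType) (conj : K -> K) (P : lmodType K)
    (d : P -> P -> K) : Prop := IsHilbert {
  hs_inner :> is_inner conj d;
  hs_complete : forall F : set_system P, ProperFilter F ->
    (forall e, 0 < e -> exists x, F [set y | d (x - y) (x - y) < e]) ->
    exists l, forall e, 0 < e -> F [set y | d (l - y) (l - y) < e]
}.

Section ConjField.
Variables (K : numFieldType) (conj : K -> K).
Hypothesis cjK_ : conj_field conj.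
Let cD := cjD cjK_.
Let cM := cjM cjK_.
Let cI := cjK cjK_.

Lemma cj0 : conj 0 = 0.
Proof. by apply: (addrI (conj 0)); rewrite -cD !addr0. Qed.
Lemma cjN a : conj (- a) = - conj a.
Proof. by apply: (addrI (conj a)); rewrite -cD !subrr cj0. Qed.
Lemma cj1 : conj 1 = 1.
Proof.
have h : conj 1 * conj 1 = conj 1 by rewrite -cM mulr1.
have n0 : conj 1 != 0.
  by apply/eqP => e; have := oner_neq0 K; rewrite -(cI 1) e cj0 eqxx.
exact: (mulfI n0 (etrans h (esym (mulr1 _)))).
Qed.
Lemma cj_sum I (r : seq I) (P : pred I) F :
  conj (\sum_(i <- r | P i) F i) = \sum_(i <- r | P i) conj (F i).
Proof. exact: (big_morph conj cD cj0). Qed.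
Lemma cj_ge0 a : 0 <= a -> conj a = a.
Proof.
move=> a0; have [->|n0] := eqVneq a 0; first exact: cj0.
apply: (mulfI n0).
by rewrite (cj_norm cjK_) ger0_norm.
Qed.
End ConjField.

Section Inner.
Variables (K : numFieldType) (conj : K -> K) (P : lmodType K).
Variable d : P -> P -> K.
Hypothesis cjK_ : conj_field conj.
Hypothesis dH : is_inner conj d.
Let dl := hs_lin dH.
Let dh := hs_herm dH.

Lemma d_Dl u v w : d (u + v) w = d u w + d v w.
Proof. by rewrite -{1}(scale1r u) dl mul1r. Qed.
Lemma d_0l w : d 0 w = 0.
Proof. by apply: (addrI (d 0 w)); rewrite -d_Dl !addr0. Qed.
Lemma d_Zl a u w : d (a *: u) w = a * d u w.
Proof. by rewrite -{1}(addr0 (a *: u)) dl d_0l addr0. Qed.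
Lemma d_Nl u w : d (- u) w = - d u w.
Proof. by rewrite -scaleN1r d_Zl mulN1r. Qed.
Lemma d_Dr w u v : d w (u + v) = d w u + d w v.
Proof. by rewrite dh d_Dl (cjD cjK_) -!dh. Qed.
Lemma d_Zr a w u : d w (a *: u) = conj a * d w u.
Proof. by rewrite dh d_Zl (cjM cjK_) -!dh. Qed.
Lemma d_0r w : d w 0 = 0.
Proof. by rewrite dh d_0l cj0. Qed.
Lemma d_Nr w u : d w (- u) = - d w u.
Proof. by rewrite dh d_Nl cjN // -dh. Qed.
Lemma d_suml w I (r : seq I) (Q : pred I) F :
  d (\sum_(i <- r | Q i) F i) w = \sum_(i <- r | Q i) d (F i) w.
Proof. exact: (big_morph (d ^~ w) (fun u v => d_Dl u v w) (d_0l w)). Qed.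
Lemma d_sumr w I (r : seq I) (Q : pred I) F :
  d w (\sum_(i <- r | Q i) F i) = \sum_(i <- r | Q i) d w (F i).
Proof. exact: (big_morph (d w) (d_Dr w) (d_0r w)). Qed.
Lemma d_ge0 u : 0 <= d u u.
Proof.
by have [->|/(hs_pos dH)/ltW//] := eqVneq u 0; rewrite d_0l.
Qed.
Lemma d_eq0 u : d u u = 0 -> u = 0.
Proof.
by move=> h; apply/eqP; apply: contraT => /(hs_pos dH); rewrite h ltxx.
Qed.

Lemma d_cauchy_schwarz u v : `|d u v| ^+ 2 <= d u u * d v v.
Proof.
have [->|v0] := eqVneq v 0; first by rewrite !d_0r normr0 expr0n mulr0.
have c0 := hs_pos dH v0.
(* This vector is [d v v] times the component of [u] orthogonal to [v]; the scaling avoids a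
   division. *)
have := d_ge0 (d v v *: u - d u v *: v).
rewrite d_Dl !d_Dr !d_Nl !d_Nr !d_Zl !d_Zr opprK.
rewrite (cj_ge0 cjK_ (ltW c0)) (dh v u) -(cj_norm cjK_).
set a := d u v; set b := d v v; set e := d u u.
rewrite (_ : _ + _ = b * (e * b - a * conj a)); last by ring.
by rewrite pmulr_rge0 // subr_ge0.
Qed.

End Inner.

Section Hilbert.
Variables (K : numFieldType) (conj : K -> K) (P : lmodType K).
Variable d : P -> P -> K.
Hypothesis cjK_ : conj_field conj.
Hypothesis dH : is_hilbert conj d.
Local Notation dh := (hs_herm dH).

(** [cj_sqrt] only asserts that square roots exist, so the root is selected by [xget]; by [hnormP]
    the default 0 is never reached. *)
Definition hnorm : P -> K := fun u => xget 0 [set r | 0 <= r /\ r ^+ 2 = d u u].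

Lemma hnormP u : 0 <= hnorm u /\ hnorm u ^+ 2 = d u u.
Proof.
rewrite /hnorm; case: xgetP => [x _ []//|/= h].
have [s hs] := cj_sqrt cjK_.
by case: (h (s (d u u))); exact: hs (d_ge0 dH u).
Qed.

Lemma hnorm_uniq u r : 0 <= r -> r ^+ 2 = d u u -> hnorm u = r.
Proof.
move=> r0 r2; have [n0 n2] := hnormP u.
by apply/eqP; rewrite -(eqrXn2 (n := 2)) // n2 r2.
Qed.

Lemma hnormD u v : hnorm (u + v) <= hnorm u + hnorm v.
Proof.
have [nu0 nu] := hnormP u; have [nv0 nv] := hnormP v.
have [n0 n] := hnormP (u + v).
rewrite -(ler_pXn2r (n := 2)) ?nnegrE ?addr_ge0 //.
rewrite n (d_Dl dH) !(d_Dr cjK_ dH) sqrrD nu nv (dh v u).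
rewrite -!addrA lerD2l [leLHS]addrA [leRHS]addrA lerD2r.
apply: (le_trans (cj_re cjK_ _)).
rewrite ler_wMn2r //.
rewrite -(ler_pXn2r (n := 2)) ?nnegrE ?mulr_ge0 //.
by rewrite exprMn nu nv (d_cauchy_schwarz cjK_ dH).
Qed.

Lemma hnormZ a u : hnorm (a *: u) = `|a| * hnorm u.
Proof.
have [n0 n] := hnormP u; apply: hnorm_uniq; first by rewrite mulr_ge0.
by rewrite exprMn n (d_Zl dH) (d_Zr cjK_ dH) mulrA (cj_norm cjK_).
Qed.

Lemma hnorm_eq0 u : hnorm u = 0 -> u = 0.
Proof.
by have [_ n] := hnormP u => h; apply: (d_eq0 dH); rewrite -n h expr0n.
Qed.

(** An alias of [P] indexed by the two proofs on which its normed structure depends. *)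
Definition hcarrier_of of conj_field conj & is_hilbert conj d : Type := P.
Local Notation hcarrier := (hcarrier_of cjK_ dH).
HB.instance Definition _ := GRing.Lmodule.on hcarrier.
HB.instance Definition _ := @Lmodule_isNormed.Build K hcarrier hnorm
  hnormD hnormZ hnorm_eq0.

Lemma hnorm_lt (u : hcarrier) e : 0 < e -> (`|u| < e) = (d u u < e ^+ 2).
Proof.
move=> e0; have [n0 <-] := hnormP u.
by rewrite ltr_pXn2r ?nnegrE // ltW.
Qed.

Fact hcarrier_complete (F : set_system hcarrier) :
  ProperFilter F -> cauchy F -> cvg F.
Proof.
move=> FF Fc.
have : forall e, 0 < e -> exists x, F [set y | d (x - y) (x - y) < e].
  move=> e e0; have [s hs] := cj_sqrt cjK_; have [s0 s2] := hs _ (ltW e0).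
  have sp : 0 < s e by rewrite lt_def s0 andbT -sqrf_eq0 s2 gt_eqF.
  have [x Fx] := (cauchyP F).1 Fc _ sp; exists x.
  apply: filterS Fx => y.
  by rewrite -ball_normE /= hnorm_lt // s2.
move=> /(hs_complete dH FF)[l hl]; apply/cvg_ex; exists l.
apply/cvgrPdist_lt => e e0; have := hl _ (exprn_gt0 2 e0).
by apply: filterS => y; rewrite /= hnorm_lt.
Qed.

HB.instance Definition _ :=
  Uniform_isComplete.Build hcarrier hcarrier_complete.

End Hilbert.

Section HilbertOf.
Variables (K : numFieldType) (conj : K -> K) (P : lmodType K).
Variable d : P -> P -> K.
Hypothesis cjK_ : conj_field conj.
Hypothesis dH : is_hilbert conj d.
Local Notation HP := (hcarrier_of cjK_ dH).

Fact hform_zl (u' : HP) : zmod_morphism ((d : HP -> HP -> K) ^~ u').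
Proof. by move=> u v; rewrite (d_Dl dH) (d_Nl dH). Qed.
Fact hform_zr (u : HP) : zmod_morphism ((d : HP -> HP -> K) u).
Proof. by move=> v w; rewrite (d_Dr cjK_ dH) (d_Nr cjK_ dH). Qed.
Fact hform_ll (u' : HP) : scalable_for *%R ((d : HP -> HP -> K) ^~ u').
Proof. by move=> a u; rewrite (d_Zl dH). Qed.
Fact hform_lr (u : HP) :
  scalable_for (conj \; *%R) ((d : HP -> HP -> K) u).
Proof. by move=> a v; rewrite (d_Zr cjK_ dH). Qed.
Fact hform_herm (u v : HP) :
  (d : HP -> HP -> K) u v = (-1) ^+ false * conj (d v u).
Proof. by rewrite expr0 mul1r (hs_herm dH). Qed.
Fact hform_pos (u : HP) : u != 0 -> 0 < (d : HP -> HP -> K) u u.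
Proof. exact: hs_pos dH u. Qed.

Definition hdot_of : {dot HP for conj} :=
  HB.pack (d : HP -> HP -> K)
    (@isBilinear.Build K HP HP K *%R (conj \; *%R) (d)
       hform_zl hform_zr hform_ll hform_lr)
    (@isHermitianSesquilinear.Build K HP false conj (d) hform_herm)
    (@isDotProduct.Build K HP (d) hform_pos).

Fact hdot_ofE (x : HP) : `|x| ^+ 2 = hdot_of x x.
Proof. exact: (hnormP cjK_ dH x).2. Qed.

Definition hilbert_of : hilbert conj := Hilbert hdot_ofE.

Lemma hilbert_of_continuous (f : {linear hilbert_of -> hilbert_of}) (M : K) :
  (forall h, d (f h) (f h) <= M * d h h) -> continuous f.
Proof.
move=> fM; apply: bounded_linear_continuous; apply/linear_boundedP.
have [s hs] := cj_sqrt cjK_.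
(* The sign of [M] follows from the hypothesis only if some vector is nonzero, so the zero space is
   treated apart. *)
have [h0|] := pselect (forall h : P, d h h = 0).
  exists 0; split=> // r r0 x.
  have [n0 n2] := hnormP cjK_ dH (f x).
  have : hnorm d (f x) = 0.
    by apply/eqP; rewrite -sqrf_eq0 n2 h0.
  by move=> e; rewrite [`|_|]e mulr_ge0 // ltW.
move=> /existsNP[h0 /eqP h0n].
have hp : 0 < d h0 h0 by rewrite lt_def h0n (d_ge0 dH).
have M0 : 0 <= M.
  rewrite -(pmulr_lge0 _ hp); apply: le_trans (fM h0); exact: d_ge0 dH _.
have [s0 s2] := hs _ M0.
exists (s M); split; first exact: ger0_real.
move=> r /ltW sr x.
have r0 : 0 <= r by exact: le_trans sr.
have [n0 n2] := hnormP cjK_ dH (f x).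
have [m0 m2] := hnormP cjK_ dH x.
rewrite -(ler_pXn2r (n := 2)) ?nnegrE ?mulr_ge0 //.
rewrite exprMn [X in X <= _]n2 [X in _ <= _ * X]m2.
apply: le_trans (fM x) _; rewrite ler_wpM2r ?(d_ge0 dH) //.
by rewrite -s2 ler_pXn2r ?nnegrE.
Qed.
End HilbertOf.

Section FromHilbert.
Variables (K : numFieldType) (conj : K -> K).
Hypothesis cjK_ : conj_field conj.
Variable H : hilbert conj.

Lemma hilbert_is_hilbert : is_hilbert conj (hdot H).
Proof.
split; first split.
- by move=> a u v w; rewrite linearDl linearZl_LR.
- by move=> u v; rewrite hermitian_subproof expr0 mul1r.
- by move=> u; exact: neq0_dnorm_gt0.
move=> F FF Fc.
have /cauchy_cvg/cvg_ex[l Fl] : cauchy F.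
  apply/cauchyP => e e0; have [x Fx] := Fc _ (exprn_gt0 2 e0).
  exists x; apply: filterS Fx => y; rewrite /= -hdotE.
  by rewrite -ball_normE /= ltr_pXn2r ?nnegrE // ltW.
exists l => e e0.
have [s hs] := cj_sqrt cjK_; have [s0 s2] := hs _ (ltW e0).
have sp : 0 < s e by rewrite lt_def s0 andbT -sqrf_eq0 s2 gt_eqF.
move/cvgrPdist_lt : Fl => /(_ _ sp); apply: filterS => y h.
by rewrite /= -hdotE -s2 ltr_pXn2r ?nnegrE.
Qed.

Lemma hilbert_bounded (f : {linear H -> H}) : continuous f ->
  exists M, 0 <= M /\ forall h, hdot H (f h) (f h) <= M * hdot H h h.
Proof.
move=> fc; have /linear_boundedP[M [Mr hM]] := continuous_linear_bounded 0 (fc 0).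
have M1 : M < `|M| + 1.
  by apply: le_lt_trans (real_ler_norm Mr) _; rewrite ltrDl.
exists ((`|M| + 1) ^+ 2); split; first by rewrite exprn_ge0 // addr_ge0.
move=> h; rewrite -!hdotE -exprMn ler_pXn2r ?nnegrE ?mulr_ge0 ?addr_ge0 //.
exact: hM.
Qed.
End FromHilbert.

Lemma conj_field_real (R : realType) : conj_field (@idfun R).
Proof.
split=> //.
- by move=> a; rewrite -expr2 real_normK // num_real.
- by move=> a; rewrite mulr2n lerD // ler_norm.
- exists Num.sqrt => x x0; split; first exact: sqrtr_ge0.
  exact: sqr_sqrtr.
Qed.

Lemma conj_field_complex (R : realType) : conj_field (@conjc R).
Proof.
split.
- by move=> a b; rewrite rmorphD.
- by move=> a b; rewrite rmorphM.
- exact: conjcK.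
- by move=> a; rewrite -normCK.
- move=> [a b]; rewrite mulr2n lecE /= subrr addr0 eqxx /=.
  by apply: lerD; apply: le_trans (ler_norm _) _;
    rewrite -sqrtr_sqr ler_wsqrtr // lerDl sqr_ge0.
- exists (fun x : R[i] => sqrtC x) => x x0; split; first by rewrite sqrtC_ge0.
  exact: sqrtCK.
Qed.

Lemma ge0_of_eps (K : numFieldType) (x c : K) : 0 <= c ->
  (forall e, 0 < e -> 0 <= x + e * c) -> 0 <= x.
Proof.
move=> c0 h.
(* The order of [K] is partial; [x] is real as a difference of nonnegative elements. *)
have xr : x \is Num.real.
  by rewrite -(addrK (1 * c) x) rpredB ?ger0_real ?h ?mul1r.
have [//|xn] := real_ge0P xr.
have c1 : 0 < c + 1 by rewrite ltr_wpDl.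
(* For this value of [e] the sum [x + e * c] is [x / (c + 1)], negative along with [x]. *)
have e0 : 0 < - x / (c + 1) by rewrite divr_gt0 // oppr_gt0.
have := h _ e0; rewrite -(pmulr_lge0 _ c1).
rewrite mulrDl mulrAC divfK ?gt_eqF //.
rewrite mulrDr mulr1 mulNr addrAC subrr add0r.
by move=> x0; rewrite (le_gtF x0) in xn.
Qed.

(** * Operator systems through their representations *)

Section Repr.
Variables (K : numFieldType) (conj : K -> K).
Hypothesis cj : conj_field conj.

Definition blk2 (U : Type) (a b c e : U) : 'M[U]_(1 + 1) :=
  block_mx (const_mx a) (const_mx b) (const_mx c) (const_mx e).

Lemma map_blk2 (U W : Type) (f : U -> W) a b c e :
  map_mx f (blk2 a b c e) = blk2 (f a) (f b) (f c) (f e).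
Proof. by rewrite /blk2 map_block_mx !map_const_mx. Qed.

Lemma blk2E (U : Type) (a b c e a' b' c' e' : U) :
  blk2 a b c e = blk2 a' b' c' e' -> [/\ a = a', b = b', c = c' & e = e'].
Proof.
move=> /eq_block_mx[] /matrixP/(_ 0 0) + /matrixP/(_ 0 0) +
  /matrixP/(_ 0 0) + /matrixP/(_ 0 0).
by rewrite !mxE.
Qed.

(** The congruence [al^* X al]. With [conj := idfun] it is convertible to [compress], so facts
    proved for it serve the real tensor products as well. *)
Definition ccompress (U : lmodType K) N n (al : 'M[K]_(N, n)) (X : 'M[U]_N) :
    'M[U]_n :=
  \matrix_(r, s) \sum_i \sum_j (conj (al i r) * al j s) *: X i j.

Definition dconst (U : lmodType K) n (u : U) : 'M[U]_n :=
  \matrix_(i, j) (if i == j then u else 0).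

Section QForm.
Variables (V : matsys conj) (P : lmodType K) (d : P -> P -> K) (T : V -> P -> P).

Definition qform n (A : 'M[V]_n) (h : 'I_n -> P) :=
  \sum_i \sum_j d (T (A i j) (h j)) (h i).

(** [represents] with everything unbundled: an inner product on a plain module, bare maps, and a
    bound on squared norms in place of continuity. [raw_repr_opsys] and [opsys_raw_repr] translate
    between the two forms. *)
Record raw_repr : Prop := RawRepr {
  rr_hilb : is_hilbert conj d;
  rr_linh : forall v a h k, T v (a *: h + k) = a *: T v h + T v k;
  rr_linv : forall a u v h, T (a *: u + v) h = a *: T u h + T v h;
  rr_bnd : forall v, exists M, 0 <= M /\ forall h, d (T v h) (T v h) <= M * d h h;
  rr_faith : forall v, (forall h, T v h = 0) -> v = 0;
  rr_star : forall v h k, d (T v h) k = d h (T (ms_star v) k);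
  rr_unit : forall h, T (ms_unit V) h = h;
  rr_cone : forall n (A : 'M[V]_n), mo_cone V n A <->
    mxstar A = A /\ forall h, 0 <= qform A h
}.

Section Linear.
Hypothesis rr : raw_repr.
Let dH := rr_hilb rr.
Lemma T_0v h : T 0 h = 0.
Proof.
apply: (addrI (1 *: T 0 h)); rewrite -(rr_linv rr).
by rewrite addr0 scaler0 scale1r addr0.
Qed.
Lemma T_0h v : T v 0 = 0.
Proof.
apply: (addrI (1 *: T v 0)); rewrite -(rr_linh rr).
by rewrite addr0 scaler0 scale1r addr0.
Qed.
Lemma T_Dv h : {morph T^~ h : u v / u + v}.
Proof. by move=> u v; rewrite -{1}[u]scale1r (rr_linv rr) scale1r. Qed.
Lemma T_Dh v : {morph T v : h k / h + k}.
Proof. by move=> h k; rewrite -{1}[h]scale1r (rr_linh rr) scale1r. Qed.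
Lemma T_Zv a v h : T (a *: v) h = a *: T v h.
Proof. by rewrite -[a *: v]addr0 (rr_linv rr) T_0v addr0. Qed.
Lemma T_Zh v a h : T v (a *: h) = a *: T v h.
Proof. by rewrite -[a *: h]addr0 (rr_linh rr) T_0h addr0. Qed.
Lemma T_sumv I (r : seq I) (Q : pred I) F h :
  T (\sum_(i <- r | Q i) F i) h = \sum_(i <- r | Q i) T (F i) h.
Proof. exact: (big_morph (T^~ h) (T_Dv h) (T_0v h)). Qed.
Lemma T_sumh v I (r : seq I) (Q : pred I) F :
  T v (\sum_(i <- r | Q i) F i) = \sum_(i <- r | Q i) T v (F i).
Proof. exact: (big_morph (T v) (T_Dh v) (T_0h v)). Qed.

Lemma qformD n (A B : 'M[V]_n) h : qform (A + B) h = qform A h + qform B h.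
Proof.
rewrite /qform -big_split; apply: eq_bigr => i _; rewrite -big_split.
by apply: eq_bigr => j _; rewrite mxE T_Dv (d_Dl dH).
Qed.

Lemma qform_ccompress N n (al : 'M[K]_(N, n)) (A : 'M[V]_N) h :
  qform (ccompress al A) h = qform A (fun j => \sum_s al j s *: h s).
Proof.
rewrite /qform.
transitivity (\sum_i \sum_j \sum_r \sum_s
    d (T (A i j) (al j s *: h s)) (al i r *: h r)).
  under eq_bigr do under eq_bigr do rewrite mxE T_sumv (d_suml dH).
  under eq_bigr do rewrite exchange_big /=.
  rewrite exchange_big; apply: eq_bigr => i _ /=.
  under eq_bigr => r _ do under eq_bigr => s _ do rewrite T_sumv (d_suml dH).
  under eq_bigr do rewrite exchange_big /=.
  rewrite exchange_big; apply: eq_bigr => j _ /=.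
  apply: eq_bigr => r _; apply: eq_bigr => s _.
  by rewrite T_Zv T_Zh !(d_Zl dH) (d_Zr cj dH) -mulrA mulrCA.
apply: eq_bigr => i _; apply: eq_bigr => j _.
rewrite T_sumh (d_suml dH) exchange_big; apply: eq_bigr => s _ /=.
by rewrite (d_sumr cj dH).
Qed.

Lemma qform_dconst n v h :
  qform (dconst n v) h = \sum_i d (T v (h i)) (h i).
Proof.
apply: eq_bigr => i _; rewrite (bigD1 i) //= mxE eqxx big1 ?addr0 // => j ji.
by rewrite mxE eq_sym (negPf ji) T_0v (d_0l dH).
Qed.

Lemma qform0 n h : qform (0 : 'M[V]_n) h = 0.
Proof.
rewrite /qform big1 // => i _; rewrite big1 // => j _.
by rewrite mxE T_0v (d_0l dH).
Qed.
End Linear.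

Lemma raw_repr_opsys : raw_repr -> is_opsys V.
Proof.
move=> rr; pose H := hilbert_of cj (rr_hilb rr).
have lt v : @GRing.linear_for K H H *:%R (T v).
  by move=> a h k; exact: rr_linh rr _ _ _ _.
exists H, (fun v => mk_linear (lt v)); split.
- split=> [v|a u v h]; last exact: rr_linv rr _ _ _ _.
  have [M [_ hM]] := rr_bnd rr v.
  by apply: (@hilbert_of_continuous _ _ _ _ cj (rr_hilb rr) _ M).
- exact: rr_faith rr.
- exact: rr_star rr.
- exact: rr_unit rr.
- exact: rr_cone rr.
Qed.
End QForm.

Lemma opsys_raw_repr (V : matsys conj) : is_opsys V ->
  exists (P : lmodType K) (d : P -> P -> K) (T : V -> P -> P), raw_repr d T.
Proof.
move=> [H [T [[Tc Tl] Tf Ts Tu TC]]].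
exists H, (hdot H), (fun v => T v : H -> H); split=> //.
- exact: hilbert_is_hilbert.
- by move=> v a h k; rewrite linearP.
- by move=> v; apply: hilbert_bounded.
Qed.

Section Facts.
Variables (V : matsys conj).
Hypothesis Vop : is_opsys V.

Lemma starD : {morph (@ms_star K conj V) : u v / u + v}.
Proof. by move=> u v; rewrite -[u]scale1r ms_star_lin cj1 // !scale1r. Qed.
Lemma star0 : @ms_star K conj V 0 = 0.
Proof. by apply: (addrI (ms_star 0)); rewrite -starD !addr0. Qed.
Lemma starZ a (u : V) : ms_star (a *: u) = conj a *: ms_star u.
Proof. by rewrite -[a *: u]addr0 ms_star_lin star0 addr0. Qed.
Lemma starN (u : V) : ms_star (- u) = - ms_star u.
Proof. by rewrite -scaleN1r starZ cjN // cj1 // scaleN1r. Qed.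
Lemma star_sum I (r : seq I) (Q : pred I) (F : I -> V) :
  ms_star (\sum_(i <- r | Q i) F i) = \sum_(i <- r | Q i) ms_star (F i).
Proof. exact: (big_morph _ starD star0). Qed.

Lemma cone_star n (A : 'M[V]_n) : mo_cone V n A -> mxstar A = A.
Proof. by have [P [d [T rr]]] := opsys_raw_repr Vop => /(rr_cone rr)[]. Qed.

Lemma cone_starE n (A : 'M[V]_n) i j :
  mo_cone V n A -> ms_star (A j i) = A i j.
Proof. by move=> /cone_star /matrixP/(_ i j); rewrite mxE. Qed.

(** The operator of [ms_star (ms_unit V)] is the adjoint of the identity, hence the identity;
    faithfulness concludes. *)
Lemma star_unit : ms_star (ms_unit V) = ms_unit V.
Proof.
have [P [d [T rr]]] := opsys_raw_repr Vop; have dH := rr_hilb rr.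
apply/eqP; rewrite -subr_eq0; apply/eqP; apply: (rr_faith rr) => h.
rewrite (T_Dv rr) -scaleN1r (T_Zv rr) (rr_unit rr) scaleN1r.
apply: (d_eq0 dH); set k := _ - h.
rewrite (d_Dr cj dH) (d_Nr cj dH) -(rr_star rr) (rr_unit rr).
by rewrite subrr.
Qed.

Lemma mxstarD n (A B : 'M[V]_n) : mxstar (A + B) = mxstar A + mxstar B.
Proof. by apply/matrixP => i j; rewrite !mxE starD. Qed.

Lemma mxstarN n (A : 'M[V]_n) : mxstar (- A) = - mxstar A.
Proof. by apply/matrixP => i j; rewrite !mxE starN. Qed.

Lemma mxstar_dconst n (v : V) : mxstar (dconst n v) = dconst n (ms_star v).
Proof.
by apply/matrixP => i j; rewrite !mxE eq_sym; case: eqP => // _; rewrite star0.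
Qed.

Lemma mxstar_ccompress N n (al : 'M[K]_(N, n)) (A : 'M[V]_N) :
  mxstar (ccompress al A) = ccompress al (mxstar A).
Proof.
apply/matrixP => r s; rewrite !mxE star_sum.
under eq_bigr do rewrite star_sum; rewrite exchange_big.
apply: eq_bigr => i _ ; apply: eq_bigr => j _.
by rewrite starZ (cjM cj) (cjK cj) mulrC mxE.
Qed.

Lemma cone0 n : mo_cone V n 0.
Proof.
have [P [d [T rr]]] := opsys_raw_repr Vop; apply/(rr_cone rr).
split=> [|h]; first by apply/matrixP => i j; rewrite !mxE star0.
by rewrite (qform0 rr).
Qed.

Lemma coneD n (A B : 'M[V]_n) :
  mo_cone V n A -> mo_cone V n B -> mo_cone V n (A + B).
Proof.
have [P [d [T rr]]] := opsys_raw_repr Vop.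
move=> /(rr_cone rr)[As Ap] /(rr_cone rr)[Bs Bp]; apply/(rr_cone rr).
by split=> [|h]; rewrite ?mxstarD ?As ?Bs // (qformD rr) addr_ge0.
Qed.

Lemma cone_ccompress N n (al : 'M[K]_(N, n)) (A : 'M[V]_N) :
  mo_cone V N A -> mo_cone V n (ccompress al A).
Proof.
have [P [d [T rr]]] := opsys_raw_repr Vop.
move=> /(rr_cone rr)[As Ap]; apply/(rr_cone rr).
by split=> [|h]; rewrite ?mxstar_ccompress ?As // (qform_ccompress rr).
Qed.

Lemma qform_conj (P : lmodType K) d (T : V -> P -> P) n (A : 'M[V]_n) h :
  (forall u v, d u v = conj (d v u)) ->
  (forall v h k, d (T v h) k = d h (T (ms_star v) k)) ->
  mxstar A = A -> conj (qform d T A h) = qform d T A h.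
Proof.
move=> dh ds As.
rewrite /qform (cj_sum cj); under eq_bigr do rewrite (cj_sum cj).
rewrite exchange_big; apply: eq_bigr => i _; apply: eq_bigr => j _ /=.
rewrite -dh ds.
by move/matrixP/(_ j i): As; rewrite mxE => ->.
Qed.

Lemma qform2 (P : lmodType K) d (T : V -> P -> P) a b c e (h : 'I_(1 + 1) -> P) :
  qform d T (blk2 a b c e) h =
  d (T a (h (lshift 1 ord0))) (h (lshift 1 ord0))
  + d (T b (h (rshift 1 ord0))) (h (lshift 1 ord0))
  + (d (T c (h (lshift 1 ord0))) (h (rshift 1 ord0))
  + d (T e (h (rshift 1 ord0))) (h (rshift 1 ord0))).
Proof.
rewrite /qform big_split_ord /= !big_ord1 !big_split_ord /= !big_ord1.
by rewrite block_mxEul block_mxEur block_mxEdl block_mxEdr !mxE.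
Qed.

Lemma mxstar_blk2 (a b c e : V) :
  mxstar (blk2 a b c e) = blk2 (ms_star a) (ms_star c) (ms_star b) (ms_star e).
Proof.
apply/matrixP => i j; rewrite mxE -(@splitK 1 1 i) -(@splitK 1 1 j).
case: (fintype.split i) => i'; case: (fintype.split j) => j' /=;
by rewrite ?(block_mxEul, block_mxEur, block_mxEdl, block_mxEdr) !mxE.
Qed.

(** Every element, selfadjoint or not, sits off the diagonal of a positive 2x2 matrix with scalar
    diagonal. Statements about cones thereby reach all elements. *)
Lemma exists_norm_le (v : V) : exists r, norm_le v r.
Proof.
have [P [d [T rr]]] := opsys_raw_repr Vop; have dH := rr_hilb rr.
have [M [M0 hM]] := rr_bnd rr v.
have [s hs] := cj_sqrt cj; have [r0 r2] := hs _ M0.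
exists (s M); split=> //; apply/(rr_cone rr); split.
  rewrite -/(blk2 _ _ _ _) mxstar_blk2 ms_starK starZ star_unit.
  by rewrite (cj_ge0 cj).
move=> h; rewrite -/(blk2 _ _ _ _) qform2; set h0 := h _; set h1 := h _.
rewrite !(T_Zv rr) !(rr_unit rr) !(d_Zl dH) (rr_star rr (ms_star v)) ms_starK.
rewrite (hs_herm dH h0 (T v h1)); set x := d (T v h1) h0.
have [n0 n2] := hnormP cj dH h0; have [m0 m2] := hnormP cj dH h1.
set n := hnorm d h0 in n0 n2 *; set m := hnorm d h1 in m0 m2 *.
have xle : `|x| <= s M * n * m.
  rewrite -(ler_pXn2r (n := 2)) ?nnegrE ?mulr_ge0 //.
  apply: le_trans (d_cauchy_schwarz cj dH _ _) _.
  rewrite !exprMn r2 n2 m2 mulrAC ler_wpM2r //; exact: d_ge0 dH _.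
(* The two off-diagonal terms add up to at least [- 2 |x|], where [|x| <= s M * n * m]; what remains
   is the square [s M * (n - m) ^+ 2]. *)
have := cj_re cj (- x); rewrite normrN (cjN cj) -opprD lerNl => h'.
rewrite addrA -(addrA _ x) addrAC; apply: le_trans _ (lerD (lexx _) h').
rewrite subr_ge0.
apply: (@le_trans _ _ (s M * n * m *+ 2)); first by rewrite lerMn2r.
rewrite -n2 -m2 -mulrDr -subr_ge0.
rewrite (_ : _ - _ = s M * (n - m) ^+ 2); last by ring.
rewrite mulr_ge0 // real_exprn_even_ge0 //.
by rewrite rpredB // ger0_real.
Qed.

Lemma norm_le_wk (v : V) r r' : norm_le v r -> r <= r' -> norm_le v r'.
Proof.
have [P [d [T rr]]] := opsys_raw_repr Vop; have dH := rr_hilb rr.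
move=> [r0 /(rr_cone rr)[hs hp]] rr'; have r'0 := le_trans r0 rr'.
split=> //; apply/(rr_cone rr); split.
  rewrite -/(blk2 _ _ _ _) mxstar_blk2 ms_starK starZ star_unit.
  by rewrite (cj_ge0 cj).
move=> h; apply: (le_trans (hp h)); rewrite -!/(blk2 _ _ _ _) !qform2.
rewrite !(T_Zv rr) !(rr_unit rr) !(d_Zl dH).
by apply: lerD; [rewrite lerD2r|rewrite lerD2l]; rewrite ler_wpM2r // (d_ge0 dH).
Qed.

Lemma norm_le_Z (v : V) r a : norm_le v r -> 0 <= a -> norm_le (a *: v) (a * r).
Proof.
have [P [d [T rr]]] := opsys_raw_repr Vop; have dH := rr_hilb rr.
move=> [r0 /(rr_cone rr)[hs hp]] a0; have ar0 := mulr_ge0 a0 r0.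
split=> //; apply/(rr_cone rr); split.
  rewrite -/(blk2 _ _ _ _) mxstar_blk2 ms_starK !starZ star_unit.
  by rewrite !(cj_ge0 cj).
move=> h; have := mulr_ge0 a0 (hp h); rewrite -!/(blk2 _ _ _ _) !qform2.
rewrite starZ (cj_ge0 cj a0) !(T_Zv rr) !(rr_unit rr) !(d_Zl dH).
by rewrite !mulrDr !mulrA.
Qed.

Lemma norm_leN (v : V) r : norm_le v r -> norm_le (- v) r.
Proof.
have [P [d [T rr]]] := opsys_raw_repr Vop; have dH := rr_hilb rr.
move=> [r0 /(rr_cone rr)[hs hp]]; split=> //; apply/(rr_cone rr); split.
  rewrite -/(blk2 _ _ _ _) mxstar_blk2 !starN ms_starK starZ star_unit.
  by rewrite (cj_ge0 cj).
move=> h; rewrite -/(blk2 _ _ _ _) qform2; set h0 := h _; set h1 := h _.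
have := hp (fun i : 'I_(1 + 1) => if i == lshift 1 ord0 then h0 else - h1).
rewrite -/(blk2 _ _ _ _) qform2 /= starN.
have tN w k : T (- w) k = - T w k by rewrite -scaleN1r (T_Zv rr) scaleN1r.
have tNh w k : T w (- k) = - T w k by rewrite -scaleN1r (T_Zh rr) scaleN1r.
by rewrite !(tN, tNh) !(d_Nl dH) !(d_Nr cj dH) ?opprK.
Qed.

Lemma norm_le_eq0 (v : V) : (forall e, 0 < e -> norm_le v e) -> v = 0.
Proof.
have [P [d [T rr]]] := opsys_raw_repr Vop; have dH := rr_hilb rr.
move=> hv; apply: (rr_faith rr) => k; apply: (d_eq0 dH).
set x := d _ _.
have x0 : 0 <= x by exact: d_ge0 dH _.
suff : 0 <= - (x *+ 2).
  by rewrite oppr_ge0 => h; apply/eqP; rewrite eq_le x0 andbT -(pmulrn_lle0 _ (n:=2)).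
apply: (@ge0_of_eps _ _ (d (T v k) (T v k) + d k k)).
  by rewrite addr_ge0 ?(d_ge0 dH).
move=> e e0; have [_ /(rr_cone rr)[_ hp]] := hv _ e0.
(* At the vector [(- T v k, k)] the form equals [e (|T v k|^2 + |k|^2) - 2 |T v k|^2]. *)
have := hp (fun i : 'I_(1 + 1) => if i == lshift 1 ord0 then - T v k else k).
rewrite -/(blk2 _ _ _ _) qform2 /=.
rewrite !(T_Zv rr) !(rr_unit rr) (rr_star rr (ms_star v)) ms_starK.
rewrite !(d_Zl dH) !(d_Nl dH) !(d_Nr cj dH) -/x opprK.
by congr (0 <= _); ring.
Qed.

End Facts.

Section CP.
Variables (V W : matsys conj).
Hypotheses (Vop : is_opsys V) (Wop : is_opsys W).
Variable f : V -> W.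
Hypothesis fcp : cp f.

(** The image of a positive 2x2 matrix with [v] and its adjoint off the diagonal is selfadjoint; the
    claim is read off its corners. *)
Lemma cp_star v : f (ms_star v) = ms_star (f v).
Proof.
have [r [_ h]] := exists_norm_le Vop v.
have /(cone_star Wop) := fcp h.
by rewrite -/(blk2 _ _ _ _) map_blk2 mxstar_blk2 => /(@blk2E W)[_ _ <- _].
Qed.

Lemma cp_norm_le v r : (forall r, f (r *: ms_unit V) = r *: ms_unit W) ->
  norm_le v r -> norm_le (f v) r.
Proof.
move=> f1 [r0 h]; split=> //; have := fcp h.
by rewrite -/(blk2 _ _ _ _) map_blk2 f1 cp_star.
Qed.
End CP.
End Repr.

Section Subsystem.
Variables (K : numFieldType) (conj : K -> K).
Hypothesis cj : conj_field conj.

Lemma subsystem_opsys (V W : matsys conj) (k : {linear V -> W}) :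
  subsystem k -> is_opsys W -> is_opsys V.
Proof.
move=> [kinj k1 ks kc] /(opsys_raw_repr cj)[P [d [T rr]]].
apply: (@raw_repr_opsys _ _ cj _ P d (fun v => T (k v))); split.
- exact: rr_hilb rr.
- by move=> v; exact: rr_linh rr _.
- by move=> a u v h; rewrite linearP (rr_linv rr).
- by move=> v; exact: rr_bnd rr _.
- by move=> v /(rr_faith rr) kv; apply: kinj; rewrite kv linear0.
- by move=> v h h'; rewrite (rr_star rr) ks.
- by move=> h; rewrite k1 (rr_unit rr).
move=> n A; rewrite kc (rr_cone rr).
have -> : (mxstar (map_mx k A) = map_mx k A) <-> (mxstar A = A).
  split=> /matrixP e; apply/matrixP => i j; have := e i j; rewrite !mxE.
    by rewrite -ks => /kinj.
  by move=> <-; rewrite ks.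
have qE x : qform d T (map_mx k A) x = qform d (fun v => T (k v)) A x.
  by rewrite /qform; under eq_bigr do under eq_bigr do rewrite mxE.
by split=> -[e h]; split=> // x; have := h x; rewrite qE.
Qed.

Section Compress.
Variable (U : lmodType K).

Definition zmx n (c : K) (A : 'M[U]_n) : 'M[U]_n := map_mx (fun v => c *: v) A.

Lemma sum_scalar n (c : K) (i : 'I_n) (F : 'I_n -> K -> U) :
  (forall j, F j 0 = 0) ->
  \sum_j F j ((c%:M : 'M[K]_n) j i) = F i c.
Proof.
move=> F0; rewrite (bigD1 i) //= mxE eqxx mulr1n big1 ?addr0 // => j /negPf ji.
by rewrite mxE ji mulr0n.
Qed.

Lemma sum_scalar2 n (a b : K) (r s : 'I_n) (A : 'M[U]_n) :
  \sum_i \sum_j (conj ((a%:M : 'M[K]_n) i r) * (b%:M : 'M[K]_n) j s) *: A i j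
  = (conj a * b) *: A r s.
Proof.
under eq_bigr => i _.
  rewrite (@sum_scalar _ b s (fun j c => (conj (a%:M i r) * c) *: A i j)) => [|j].
    over.
  by rewrite mulr0 scale0r.
rewrite (@sum_scalar _ a r (fun i c => (conj c * b) *: A i s)) // => j.
by rewrite (cj0 cj) mul0r scale0r.
Qed.

Lemma ccompress_row n (a b : K) (A : 'M[U]_n) :
  ccompress conj (row_mx a%:M b%:M) A =
  block_mx (zmx (conj a * a) A) (zmx (conj a * b) A)
           (zmx (conj b * a) A) (zmx (conj b * b) A).
Proof.
apply/matrixP => i j; rewrite -(@splitK n n i) -(@splitK n n j).
case: (fintype.split i) => i'; case: (fintype.split j) => j' /=;
rewrite ?(block_mxEul, block_mxEur, block_mxEdl, block_mxEdr) !mxE;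
by under eq_bigr do under eq_bigr do rewrite ?(row_mxEl, row_mxEr);
  rewrite sum_scalar2.
Qed.

Lemma ccompress_col n (a b : K) (A B C D : 'M[U]_n) :
  ccompress conj (col_mx a%:M b%:M) (block_mx A B C D) =
  zmx (conj a * a) A + zmx (conj a * b) B
  + (zmx (conj b * a) C + zmx (conj b * b) D).
Proof.
apply/matrixP => r s; rewrite !mxE big_split_ord /=; congr (_ + _).
  under eq_bigr do rewrite big_split_ord /=.
  rewrite big_split /=; congr (_ + _);
  by under eq_bigr do under eq_bigr do
    rewrite ?(block_mxEul, block_mxEur) ?(col_mxEu, col_mxEd); rewrite sum_scalar2.
under eq_bigr do rewrite big_split_ord /=.
rewrite big_split /=; congr (_ + _);
by under eq_bigr do under eq_bigr do
    rewrite ?(block_mxEdl, block_mxEdr) ?(col_mxEu, col_mxEd); rewrite sum_scalar2.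
Qed.
End Compress.
End Subsystem.

(** * Restriction of scalars from complex to real *)

Section Realify.
Variable R : realType.

Definition rl (U : lmodType R[i]) : Type := U.
Section RL.
Variable U : lmodType R[i].
HB.instance Definition _ := GRing.Zmodule.on (rl U).
Definition rl_scale (a : R) (v : rl U) : rl U := (a%:C *: (v : U)).
Fact rl_scaleA a b v : rl_scale a (rl_scale b v) = rl_scale (a * b) v.
Proof. by rewrite /rl_scale scalerA rmorphM. Qed.
Fact rl_scale1 : left_id 1 rl_scale.
Proof. by move=> v; rewrite /rl_scale scale1r. Qed.
Fact rl_scaleDr : right_distributive rl_scale +%R.
Proof. by move=> a u v; rewrite /rl_scale scalerDr. Qed.
Fact rl_scaleDl v : {morph rl_scale^~ v : a b / a + b}.
Proof. by move=> a b; rewrite /rl_scale rmorphD scalerDl. Qed.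
HB.instance Definition _ := GRing.Zmodule_isLmodule.Build R (rl U)
  rl_scaleA rl_scale1 rl_scaleDr rl_scaleDl.

Lemma rl_scaleE (a : R) (v : rl U) : a *: v = (a%:C *: (v : U)).
Proof. by []. Qed.
End RL.

Variable W : matsys (@conjc R).

Fact rl_star_lin (a : R) (u v : rl W) :
  (ms_star (a *: u + v : W) : rl W) =
  idfun a *: (ms_star (u : W) : rl W) + (ms_star (v : W) : rl W).
Proof. by rewrite !rl_scaleE ms_star_lin conjc_real. Qed.

Definition realification : matsys (@idfun R) :=
  @MatSys R idfun (@MatOrd R (rl W) (fun n (A : 'M[rl W]_n) => mo_cone W n A))
    (@ms_star _ _ W) (ms_unit W) (@ms_starK _ _ W) rl_star_lin.

Lemma complex_ltE (x : R[i]) (e : R) : 0 <= x -> (x < e%:C) = (complex.Re x < e).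
Proof. by case: x => a b; rewrite lecE ltcE /= => /andP[/eqP -> _]; rewrite eqxx. Qed.

Lemma conjc_Im (x : R[i]) : conjc x = x -> complex.Im x = 0.
Proof. by case: x => a b /= [] /eqP; rewrite -subr_eq0 -opprD oppr_eq0 -mulr2n mulrn_eq0 => /eqP. Qed.

Lemma complex_gt0 (x : R[i]) : 0 < x -> x = (complex.Re x)%:C /\ 0 < complex.Re x.
Proof. by case: x => a b; rewrite ltcE /= => /andP[/eqP ->]. Qed.

Lemma complex_ge0 (x : R[i]) : 0 <= x -> x = (complex.Re x)%:C /\ 0 <= complex.Re x.
Proof. by case: x => a b; rewrite lecE /= => /andP[/eqP ->]. Qed.

Let cjC := conj_field_complex R.

(** Vectors and operators stay, and the inner product is replaced by its real part. The cones do not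
    change, since the form of a selfadjoint matrix is already real. *)
Lemma realification_opsys : is_opsys W -> is_opsys realification.
Proof.
move=> /(opsys_raw_repr cjC)[P [d [T rr]]]; have dH := rr_hilb rr.
pose dR (u v : rl P) : R := complex.Re (d u v).
have dHR : is_hilbert idfun dR.
  split; first split.
  - by move=> a u v w; rewrite /dR rl_scaleE (hs_lin dH); case: (d u w) (d v w) => ? ? [? ?] /=;
      rewrite mul0r subr0.
  - by move=> u v; rewrite /dR (hs_herm dH); case: (d v u).
  - by move=> u /(hs_pos dH)/complex_gt0[].
  - move=> F FF Fc.
    have [|l hl] := hs_complete dH FF.
      move=> e /complex_gt0[-> /Fc[x Fx]]; exists x.
      by apply: filterS Fx => y; rewrite /= complex_ltE // (d_ge0 dH).
    exists l => e e0; have := hl e%:C; rewrite ltcR => /(_ e0).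
    by apply: filterS => y; rewrite /= complex_ltE // (d_ge0 dH).
apply: (@raw_repr_opsys _ _ (conj_field_real R) realification (rl P) dR T); split=> //.
- by move=> v a h k; rewrite rl_scaleE (rr_linh rr).
- by move=> a u v h; rewrite rl_scaleE (rr_linv rr).
- move=> v; have [M [/complex_ge0[-> M0] hM]] := rr_bnd rr v.
  exists (complex.Re M); split=> // h; have := hM h; rewrite /dR.
  have /complex_ge0[-> _] := d_ge0 dH h.
  have /complex_ge0[-> _] := d_ge0 dH (T v h).
  by rewrite -rmorphM lecR.
- exact: rr_faith rr.
- by move=> v h k; rewrite /dR (rr_star rr).
- exact: rr_unit rr.
move=> n A; apply: (iff_trans (rr_cone rr (A : 'M[W]_n))).
split=> -[As h]; split=> //.
  move=> x; have /complex_ge0[_] := h x; rewrite /qform.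
  by rewrite raddf_sum; under eq_bigr do rewrite raddf_sum.
move=> x; have := h x.
have := qform_conj cjC x (hs_herm dH) (rr_star rr) As.
set q := qform d T A x => /conjc_Im qc; rewrite lecE qc.
rewrite eqxx /=; congr (_ <= _); rewrite /q /qform raddf_sum; apply: eq_bigr => i _.
by rewrite raddf_sum.
Qed.
End Realify.

(** * Complexification *)

Section Blocks.
Variables (K : numFieldType) (conj : K -> K).
Hypothesis cj : conj_field conj.
Variable V : matsys conj.

Lemma mxstar_block n m (A : 'M[V]_n) B C (D : 'M[V]_m) :
  mxstar (block_mx A B C D) =
  block_mx (mxstar A) (\matrix_(i, j) ms_star (C j i))
           (\matrix_(i, j) ms_star (B j i)) (mxstar D).
Proof.
apply/matrixP => i j; rewrite mxE -(@splitK n m i) -(@splitK n m j).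
case: (fintype.split i) => i'; case: (fintype.split j) => j' /=;
by rewrite ?(block_mxEul, block_mxEur, block_mxEdl, block_mxEdr) !mxE.
Qed.

Lemma qform_block (P : lmodType K) d (T : V -> P -> P) n m (A : 'M[V]_n) B C
    (D : 'M[V]_m) (h : 'I_(n + m) -> P) :
  qform d T (block_mx A B C D) h =
  \sum_i (\sum_j d (T (A i j) (h (lshift m j))) (h (lshift m i))
        + \sum_j d (T (B i j) (h (rshift n j))) (h (lshift m i)))
  + \sum_i (\sum_j d (T (C i j) (h (lshift m j))) (h (rshift n i))
        + \sum_j d (T (D i j) (h (rshift n j))) (h (rshift n i))).
Proof.
rewrite /qform big_split_ord /=; congr (_ + _); apply: eq_bigr => i _;
rewrite big_split_ord /=; congr (_ + _); apply: eq_bigr => j _;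
by rewrite ?(block_mxEul, block_mxEur, block_mxEdl, block_mxEdr).
Qed.
End Blocks.

Section Complexify.
Variable R : realType.
Variable V : matsys (@idfun R).
Let cjR := conj_field_real R.
Let cjC := conj_field_complex R.

Lemma cplx_scaleE (U : lmodType R) (a b : R) (x y : U) :
  (a +i* b) *: ((x, y) : cplx U) = (a *: x - b *: y, b *: x + a *: y) :> cplx U.
Proof. by []. Qed.

(** The complexified Hilbert space represents it. By [key], the real part of the form of [x + iy] at
    [h + ik] is the form of [[[x, -y], [y, x]]] at [(h, k)], which is the origin of the block matrix
    in the definition of the cones. *)
Lemma complexification_opsys : is_opsys V -> is_opsys (complexification V).
Proof.
move=> /(opsys_raw_repr cjR)[P [d [T rr]]]; have dH := rr_hilb rr.
pose dC (u v : cplx P) : R[i] :=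
  (d u.1 v.1 + d u.2 v.2) +i* (d u.2 v.1 - d u.1 v.2).
pose TC (w : cplx V) (h : cplx P) : cplx P :=
  (T w.1 h.1 - T w.2 h.2, T w.1 h.2 + T w.2 h.1).
have dS u v : d u v = d v u by rewrite (hs_herm dH).
have dE := (d_Dl dH, d_Dr cjR dH, d_Nl dH, d_Nr cjR dH, d_Zl dH, d_Zr cjR dH).
have tE := (T_Dv rr, T_Dh rr, T_Zv rr, T_Zh rr).
have tN v h : T (- v) h = - T v h by rewrite -scaleN1r (T_Zv rr) scaleN1r.
have tNh v h : T v (- h) = - T v h by rewrite -scaleN1r (T_Zh rr) scaleN1r.
have d0 := d_ge0 dH.
(* Vector identities are tested against all inner products, which reduces them to scalar identities
   for [ring]. *)
have dext u v : (forall w, d u w = d v w) -> u = v.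
  move=> h; apply/eqP; rewrite -subr_eq0; apply/eqP; apply: (d_eq0 dH).
  by rewrite dE (d_Nl dH) h subrr.
have dCuu u : dC u u = (d u.1 u.1 + d u.2 u.2)%:C.
  by rewrite /dC (dS u.2) subrr.
have dCH : is_hilbert (@conjc R) dC.
  split; first split.
  - move=> [a b] [u1 u2] [v1 v2] [w1 w2].
    rewrite cplx_scaleE /dC /= !dE; apply/eqP; rewrite eq_complex /=.
    by apply/andP; split; apply/eqP => /=; ring.
  - move=> [u1 u2] [v1 v2]; rewrite /dC /= (dS v1 u1) (dS v2 u2) (dS v1) (dS v2).
    by rewrite opprB.
  - move=> [u1 u2] h; rewrite /dC /= (dS u2) subrr ltcR.
    have [e|h1] := eqVneq u1 0; last by rewrite ltr_pwDl ?(hs_pos dH).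
    have [e2|h2] := eqVneq u2 0; last by rewrite ltr_wpDl ?(hs_pos dH).
    by rewrite e e2 eqxx in h.
  - move=> F FF Fc.
    have F1 : ProperFilter (fst @ F) by exact: fmap_proper_filter.
    have F2 : ProperFilter (snd @ F) by exact: fmap_proper_filter.
    have dCE u e : (dC u u < e%:C) = (d u.1 u.1 + d u.2 u.2 < e).
      by rewrite dCuu ltcR.
    have [|l1 hl1] := hs_complete dH F1.
      move=> e e0; have [|x Fx] := Fc e%:C; first by rewrite ltcR.
      exists x.1; rewrite /fmap /=; apply: filterS Fx => y h.
      have : dC (x - y) (x - y) < e%:C by []; rewrite dCE.
      by apply: le_lt_trans; rewrite lerDl.
    have [|l2 hl2] := hs_complete dH F2.
      move=> e e0; have [|x Fx] := Fc e%:C; first by rewrite ltcR.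
      exists x.2; rewrite /fmap /=; apply: filterS Fx => y h.
      have : dC (x - y) (x - y) < e%:C by []; rewrite dCE.
      by apply: le_lt_trans; rewrite lerDr.
    exists (l1, l2) => e /complex_gt0[-> e0]; set r := complex.Re e in e0 *.
    have r0 : 0 < r / 2 by rewrite divr_gt0.
    have H1 : F [set y | d (l1 - y.1) (l1 - y.1) < r / 2] by exact: hl1.
    have H2 : F [set y | d (l2 - y.2) (l2 - y.2) < r / 2] by exact: hl2.
    apply: filterS (filterI H1 H2) => y [/= y1 y2].
    suff : dC ((l1, l2) - y) ((l1, l2) - y) < r%:C by [].
    by rewrite dCE /= [r]splitr ltrD.
have dCs (v : complexification V) h k :
    dC (TC v h) k = dC h (TC (ms_star v) k).
  case: v h k => [v1 v2] [h1 h2] [k1 k2].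
  rewrite /dC /TC /= !(dE, tE, tN) !(rr_star rr).
  by apply/eqP; rewrite eq_complex /=; apply/andP; split; apply/eqP => /=; ring.
apply: (@raw_repr_opsys _ _ cjC (complexification V) (cplx P) dC TC); split=> //.
- move=> [v1 v2] [a b] [h1 h2] [k1 k2].
  rewrite !cplx_scaleE /TC /= !(tE, tN, tNh).
  by congr pair => /=; apply: dext => w; rewrite !dE; ring.
- move=> [a b] [u1 u2] [v1 v2] [h1 h2].
  rewrite !cplx_scaleE /TC /= !(tE, tN, tNh).
  by congr pair => /=; apply: dext => w; rewrite !dE; ring.
- move=> [v1 v2]; have [M1 [M10 h1]] := rr_bnd rr v1.
  have [M2 [M20 h2]] := rr_bnd rr v2.
  (* The constant comes from [|a + b|^2 <= 2 |a|^2 + 2 |b|^2] in both components; [s1] and [s2]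
     below are the squares that this inequality discards. *)
  exists (2 * (M1 + M2))%:C; split; first by rewrite lecR mulr_ge0 ?addr_ge0.
  move=> [x y]; rewrite !dCuu /TC /= -rmorphM lecR.
  have b1 := h1 x; have b2 := h1 y; have b3 := h2 x; have b4 := h2 y.
  have s1 := d0 (T v1 x + T v2 y); have s2 := d0 (T v1 y - T v2 x).
  rewrite !dE in s1 s2 *.
  rewrite (dS (T v2 y) (T v1 x)) (dS (T v2 x) (T v1 y)) in s1 s2 *.
  lra.
- move=> [v1 v2] h; congr pair; apply: (rr_faith rr) => x.
    by have [+ _] := h (x, 0); rewrite /TC /= (T_0h rr) subr0.
  by have [_ +] := h (x, 0); rewrite /TC /= (T_0h rr) add0r.
- by move=> [h1 h2]; rewrite /TC /= !(rr_unit rr) !(T_0v rr) subr0 addr0.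
move=> n Z; set x := map_mx fst Z; set y := map_mx snd Z.
have key (hh : 'I_(n + n) -> P) :
    complex.Re (qform (dC : cplx P -> cplx P -> R[i]) (TC : complexification V -> cplx P -> cplx P) Z (fun i => (hh (lshift n i), hh (rshift n i)))) =
    qform d T (block_mx x (- y) y x) hh.
  rewrite qform_block /qform raddf_sum -big_split; apply: eq_bigr => i _ /=.
  rewrite raddf_sum -!big_split; apply: eq_bigr => j _ /=.
  by rewrite !mxE !(dE, tN) /=; ring.
have starP : (x = mxstar x /\ y = - mxstar y) <-> mxstar Z = Z :> 'M[complexification V]_n.
  split=> [[/matrixP xs /matrixP ys]|/matrixP Zs].
    apply/matrixP => i j; have := xs i j; have := ys i j.
    rewrite !mxE /= /cplx_star => e2 e1.
    by rewrite [RHS]surjective_pairing e1 e2.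
  split; apply/matrixP => i j; have := Zs i j; rewrite !mxE /= /cplx_star => <- //=.
have -> : mo_cone (complexification V) n Z <->
    (x = mxstar x /\ y = - mxstar y) /\ mo_cone V (n + n) (block_mx x (- y) y x).
  by rewrite /= /cplx_cone; split=> [[]|[[]]].
rewrite starP (rr_cone rr).
split=> [[Zs [_ hp]]|[Zs hp]]; split=> //.
  move=> h; pose hh (s : 'I_(n + n)) :=
    match fintype.split s with inl i => (h i).1 | inr i => (h i).2 end.
  have := key hh; have -> : (fun i => (hh (lshift n i), hh (rshift n i))) = h.
    apply/funext => i; rewrite /hh.
    by rewrite (unsplitK (inl i)) (unsplitK (inr i)) -surjective_pairing.
  have /conjc_Im qi := qform_conj cjC h (hs_herm dCH) dCs Zs.
  by rewrite lecE => ->; rewrite hp qi eqxx.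
split=> [|hh]; last by rewrite -key; have := hp (fun i => (hh (lshift n i), hh (rshift n i))); rewrite lecE => /andP[].
have [/matrixP xs /matrixP ys] := starP.2 Zs.
rewrite mxstar_block; congr block_mx; apply/matrixP => i j; have := xs i j; have := ys i j; rewrite !mxE => e1 e2.
- by rewrite -e2.
- by rewrite e1 opprK.
- by rewrite e1 (starN cjR).
- by rewrite -e2.
Qed.
End Complexify.

Section ConeTools.
Variables (K : numFieldType) (conj : K -> K).
Hypothesis cj : conj_field conj.
Variable V : matsys conj.
Hypothesis Vop : is_opsys V.

Lemma zmx1 n (A : 'M[V]_n) : zmx 1 A = A.
Proof. by apply/matrixP => i j; rewrite mxE scale1r. Qed.
Lemma zmx0 n (A : 'M[V]_n) : zmx 0 A = 0.
Proof. by apply/matrixP => i j; rewrite !mxE scale0r. Qed.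

Lemma cone_ul n (A B C D : 'M[V]_n) :
  mo_cone V (n + n) (block_mx A B C D) -> mo_cone V n A.
Proof.
move=> /(cone_ccompress cj Vop (col_mx 1%:M 0%:M)).
rewrite (ccompress_col cj) (cj0 cj) (cj1 cj) !mul0r !mulr0 mulr1 zmx1 !zmx0.
by rewrite !addr0.
Qed.

Lemma cone_diag n (A B : 'M[V]_n) :
  mo_cone V n A -> mo_cone V n B -> mo_cone V (n + n) (block_mx A 0 0 B).
Proof.
move=> /(cone_ccompress cj Vop (row_mx 1%:M 0%:M)) hA.
move=> /(cone_ccompress cj Vop (row_mx 0%:M 1%:M)) /(coneD cj Vop hA).
rewrite !(ccompress_row cj) (cj0 cj) (cj1 cj) !mul0r !mulr0 mulr1 !zmx1 !zmx0.
by rewrite add_block_mx !addr0 !add0r.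
Qed.
End ConeTools.

(** * Complex-linear maps from real-linear ones *)

Section Promote.
Variable R : realType.
Local Notation C := R[i].
Let cjC := conj_field_complex R.
Definition iC : C := 0 +i* 1.

Lemma iCsq : iC * iC = -1.
Proof. by apply/eqP; rewrite eq_complex /= !(mul0r, mulr0, mulr1, subr0, sub0r, addr0, oppr0) !eqxx. Qed.
Lemma iCconj : conjc iC = - iC.
Proof. by apply/eqP; rewrite eq_complex /= oppr0 !eqxx. Qed.
Lemma iCE (a b : R) : a +i* b = a%:C + b%:C * iC.
Proof. by apply/eqP; rewrite eq_complex /= !(mul0r, mulr0, mulr1, subr0, addr0, add0r) !eqxx. Qed.

Lemma linear_iC (U V : lmodType C) (f : U -> V) :
  {morph f : u v / u + v} -> (forall (r : R) u, f (r%:C *: u) = r%:C *: f u) ->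
  (forall u, f (iC *: u) = iC *: f u) -> linear f.
Proof.
move=> fD fr fi [a b] u v; rewrite fD iCE !scalerDl fD fr.
by rewrite -!scalerA fr fi.
Qed.

Lemma linear_rl (U V : lmodType C) (f : {linear U -> V}) :
  linear (f : rl U -> rl V).
Proof. by move=> a u v; rewrite !rl_scaleE linearP. Qed.

(** Compression by the column [(1, -i)] divided by the square root of 2: the diagonal blocks
    contribute [X / 2] each, the other two [iY / 2] each. *)
Lemma cone_iC (G : matsys (@conjc R)) n (X Y : 'M[G]_n) : is_opsys G ->
  mo_cone G (n + n) (block_mx X (- Y) Y X) -> mo_cone G n (X + zmx iC Y).
Proof.
move=> Gop.
have [s hs] := cj_sqrt cjC.
have h2 : (0 : C) <= 2^-1 by rewrite invr_ge0.
have [a0 a2] := hs _ h2; have ac := cj_ge0 cjC a0; set a := s _ in a0 a2 ac.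
move=> /(cone_ccompress cjC Gop (col_mx a%:M (- iC * a)%:M)).
congr (mo_cone G n); rewrite (ccompress_col cjC).
apply/matrixP => r t; rewrite !mxE.
have -> : conjc a = a by [].
have -> : conjc (- iC * a) = iC * a.
  by rewrite (cjM cjC) (cjN cjC) iCconj opprK; congr (_ * _).
have e1 : a * a = 2^-1 by rewrite -expr2.
have e2 : a * (- iC * a) = - (2^-1 * iC) by rewrite mulrCA e1; ring.
have e3 : iC * a * a = 2^-1 * iC by rewrite -mulrA e1 mulrC.
have e4 : iC * a * (- iC * a) = 2^-1.
  by rewrite mulrACA e1 mulrN iCsq opprK mul1r.
rewrite e1 e2 e3 e4 scaleNr scalerN opprK.
rewrite [X in _ + X]addrC addrACA -!scalerDl -mulrDl.
have -> : (2^-1 + 2^-1 : C) = 1 by rewrite [RHS]splitr !mul1r.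
by rewrite mul1r scale1r.
Qed.

Lemma cone_zmx (K : numFieldType) (conj : K -> K) (V : matsys conj) n
    (A : 'M[V]_n) c : conj_field conj -> is_opsys V -> 0 <= c ->
  mo_cone V n A -> mo_cone V n (zmx c A).
Proof.
move=> cj Vop c0; have [s hs] := cj_sqrt cj; have [a0 a2] := hs _ c0.
move=> /(cone_ccompress cj Vop (row_mx (s c)%:M 0%:M)).
rewrite (ccompress_row cj) => /(cone_ul cj Vop).
by rewrite (cj_ge0 cj a0) -expr2 a2.
Qed.

Section Rho.
Variables (F G : matsys (@conjc R)).
Hypotheses (Fop : is_opsys F) (Gop : is_opsys G).
Variable rho : {linear realification F -> realification G}.

(** Twice the complex-linear part of [rho]. If [rho] is the real part of a complex-linear map, this
    recovers the map, as in the passage from real to complex functionals. *)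
Definition rhoC (a : F) : G := (rho a : G) - iC *: (rho (iC *: a : F) : G).

Lemma rhoZ (r : R) (a : F) : (rho (r%:C *: a : F) : G) = r%:C *: (rho a : G).
Proof. exact: (linearZ_LR rho r a). Qed.

Lemma rhoC_linear : linear rhoC.
Proof.
apply: linear_iC => [u v|r u|u]; rewrite /rhoC.
- rewrite scalerDr !(linearD rho) scalerDr opprD.
  by rewrite addrACA.
- rewrite rhoZ scalerA mulrC -scalerA rhoZ scalerA mulrC -scalerA.
  by rewrite scalerBr.
- rewrite scalerA iCsq scaleN1r linearN scalerN opprK.
  by rewrite scalerBr scalerA iCsq scaleN1r opprK addrC.
Qed.

(** [A] compressed by the row [(1, i)] is [[[A, iA], [-iA, A]]]. Its image under [rho] is [[[X, -Y],
    [Y, X]]] with [X = rho A] and [Y = - rho (iA)], to which [cone_iC] applies. *)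
Lemma rhoC_cp : cp rho -> @cp _ F G rhoC.
Proof.
move=> rcp n A /(cone_ccompress cjC Fop (row_mx 1%:M iC%:M)).
rewrite (ccompress_row cjC) => /rcp; rewrite map_block_mx => h.
have -> : map_mx rhoC A = map_mx rho (A : 'M[realification F]_n) +
    zmx iC (map_mx (fun a : F => - (rho (iC *: a : F) : G)) A).
  by apply/matrixP => r t; rewrite !mxE scalerN.
apply: cone_iC => //; refine (eq_ind _ (mo_cone G (n + n)) h _ _).
congr block_mx; apply/matrixP => r t; rewrite !mxE ?(cj1 cjC) ?iCconj ?mulr1 ?mul1r ?scale1r //.
- by rewrite opprK.
- by rewrite scaleNr; exact: (raddfN rho).
- by rewrite mulNr iCsq opprK scale1r.
Qed.
End Rho.
End Promote.

(** * Complexified maps and injectivity *)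

Section CplxMap.
Variable R : realType.
Local Notation C := R[i].
Let cjR := conj_field_real R.
Local Notation msR := (matsys (@idfun R)).

Definition cmap (V W : lmodType R) (f : V -> W) (z : cplx V) : cplx W :=
  (f z.1, f z.2).

Lemma cmap_linear (V W : lmodType R) (f : {linear V -> W}) : linear (cmap f).
Proof.
move=> [a b] [x y] [x' y']; rewrite !cplx_scaleE /cmap /=.
by rewrite !linearD linearN !linearZ.
Qed.

Lemma map_mxstar (V W : msR) (f : V -> W) n (A : 'M[V]_n) :
  (forall v, f (ms_star v) = ms_star (f v)) ->
  map_mx f (mxstar A) = mxstar (map_mx f A).
Proof. by move=> fs; apply/matrixP => i j; rewrite !mxE fs. Qed.

Lemma map_mx_inj_ (V W : Type) (f : V -> W) m n :
  injective f -> injective (@map_mx _ _ f m n).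
Proof.
by move=> fi A B /matrixP e; apply/matrixP => i j; have := e i j; rewrite !mxE => /fi.
Qed.

Lemma map_fst_cmap (V W : lmodType R) (f : {linear V -> W}) n (Z : 'M[cplx V]_n) :
  map_mx fst (map_mx (cmap f) Z) = map_mx f (map_mx fst Z) /\
  map_mx snd (map_mx (cmap f) Z) = map_mx f (map_mx snd Z).
Proof. by split; apply/matrixP => i j; rewrite !mxE. Qed.

Lemma cmap_subsystem (V W : msR) (f : {linear V -> W}) :
  subsystem f ->
  subsystem (mk_linear (cmap_linear f) :
               {linear complexification V -> complexification W}).
Proof.
move=> [fi f1 fs fc]; split.
- by move=> [x y] [x' y'] [/fi-> /fi->].
- by rewrite /= /cmap /= f1 linear0.
- by move=> [x y]; rewrite /= /cmap /cplx_star /= linearN !fs.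
move=> n Z; rewrite /= /cplx_cone; have [-> ->] := map_fst_cmap f Z.
set x := map_mx fst Z; set y := map_mx snd Z.
rewrite -!map_mxstar // -(map_mxN f y) -(map_mxN f (mxstar y)).
rewrite (_ : block_mx (map_mx f x) _ _ _ = map_mx f (block_mx x (- y) y x));
last by rewrite map_block_mx.
split=> -[xs ys h]; split.
- by rewrite -xs.
- by rewrite -ys.
- exact/fc.
- exact: (map_mx_inj_ fi xs).
- exact: (map_mx_inj_ fi ys).
- exact/fc.
Qed.

Lemma cplx_real_cone (V : msR) n (A : 'M[V]_n) : is_opsys V ->
  mo_cone (complexification V) n (map_mx (fun v => (v, 0)) A) <-> mo_cone V n A.
Proof.
move=> Vop; rewrite /= /cplx_cone.
have -> : map_mx fst (map_mx (fun v : V => (v, 0 : V)) A) = A.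
  by apply/matrixP => i j; rewrite !mxE.
have -> : map_mx snd (map_mx (fun v : V => (v, 0 : V)) A) = 0.
  by apply/matrixP => i j; rewrite !mxE.
split=> [[_ _ /(cone_ul cjR Vop)]//|h]; split.
- by rewrite (cone_star cjR Vop h).
- by apply/matrixP => i j; rewrite !mxE (star0 cjR) oppr0.
- by rewrite oppr0; apply: cone_diag.
Qed.

Lemma cplx_cone_fst (V : msR) n (Z : 'M[cplx V]_n) : is_opsys V ->
  mo_cone (complexification V) n Z -> mo_cone V n (map_mx fst Z).
Proof. by move=> Vop [_ _ /(cone_ul cjR Vop)]. Qed.

Lemma subsystem_rl (E F : matsys (@conjc R)) (k : {linear E -> F}) :
  subsystem k ->
  subsystem (mk_linear (linear_rl k) : {linear realification E -> realification F}).
Proof. by move=> [ki k1 ks kc]; split. Qed.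

Definition IC (I : opsys (@idfun R)) : opsys (@conjc R) :=
  OpSys (complexification_opsys (os_repr I)).
Definition IR (I : opsys (@conjc R)) : opsys (@idfun R) :=
  OpSys (realification_opsys (os_repr I)).

Lemma fst_rl_linear (V : msR) (E : matsys (@conjc R))
    (phi : {linear E -> complexification V}) :
  linear (fun x : realification E => (phi x).1).
Proof. by move=> a u v; rewrite rl_scaleE linearP /= scale0r subr0. Qed.

Lemma rlcplxE (V : lmodType R) (a : R) (x y : V) :
  a *: ((x, y) : rl (cplx V)) = ((a *: x, a *: y) : rl (cplx V)).
Proof.
rewrite rl_scaleE cplx_scaleE !scale0r subr0.
by congr pair; rewrite /= add0r.
Qed.

Lemma pair_rl_linear (V : msR) (E : matsys (@conjc R))
    (psi : {linear realification E -> V}) :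
  linear (fun x : realification E => ((psi x, 0) : realification (complexification V))).
Proof.
move=> a u v; rewrite linearP rlcplxE scaler0.
by congr pair; rewrite /= addr0.
Qed.

(** The real part of [phi] extends because [I] is injective, and [rhoC] turns the extension into a
    complex-linear map having it as real part. *)
Lemma IC_injective (I : opsys (@idfun R)) :
  injective_opsys I -> injective_opsys (IC I).
Proof.
move=> Iinj E F k phi ks [phicp phi1].
have [|psi [[psicp psi1] psik]] := Iinj (IR E) (IR F) _
  (mk_linear (fst_rl_linear phi)) (subsystem_rl ks).
  split=> [n A hA|]; last by rewrite /= phi1.
  have := cplx_cone_fst (os_repr I) (phicp n A hA); congr (mo_cone I n).
  by apply/matrixP => i j; rewrite !mxE.
have [_ k1 _ _] := ks.
have psikE x : psi (k x) = (phi x).1 by exact: psik.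
pose rho := mk_linear (pair_rl_linear psi).
have rcp : @cp _ (realification F) (realification (complexification I)) rho.
  move=> n A /psicp /(cplx_real_cone _ (os_repr I)).
  by rewrite -map_mx_comp.
pose Psi : {linear F -> IC I} := mk_linear (rhoC_linear rho).
have PsiE x : Psi x = (psi x, - psi (iC R *: x : F)) :> cplx I.
  rewrite /= /rhoC /= cplx_scaleE !scale0r !scaler0 scale1r !addr0 subr0.
  by congr pair; rewrite /= ?subr0 ?sub0r.
exists Psi; split; last first.
  move=> x; rewrite PsiE -linearZ !psikE linearZ /=.
  case: (phi x) => u v /=.
  by rewrite scale0r scale1r sub0r opprK.
split; first exact: (rhoC_cp (os_repr F) (os_repr (IC I)) rcp).
rewrite PsiE -k1 -linearZ !psikE linearZ phi1 /=.
by rewrite scale0r scaler0 subr0 oppr0.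
Qed.
End CplxMap.

Section MxSub.
Variables (K : numFieldType) (conj : K -> K).
Hypothesis cj : conj_field conj.
Variable V : matsys conj.
Hypothesis Vop : is_opsys V.

Lemma ccompress_mxsub (U : lmodType K) N n (f : 'I_n -> 'I_N) (A : 'M[U]_N) :
  ccompress conj (\matrix_(i, r) (i == f r)%:R) A = mxsub f f A.
Proof.
apply/matrixP => r s; rewrite !mxE (bigD1 (f r)) //= [X in _ + X]big1 ?addr0.
  rewrite (bigD1 (f s)) //= big1 ?addr0 => [|j /negPf h].
    by rewrite !mxE !eqxx (cj1 cj) mul1r scale1r.
  by rewrite !mxE h mulr0 scale0r.
by move=> i /negPf h; apply: big1 => j _; rewrite !mxE h (cj0 cj) mul0r scale0r.
Qed.

Lemma cone_mxsub N n (f : 'I_n -> 'I_N) (A : 'M[V]_N) :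
  mo_cone V N A -> mo_cone V n (mxsub f f A).
Proof. by move=> h; rewrite -ccompress_mxsub; apply: cone_ccompress. Qed.

Lemma matrix2P (U : Type) (A : 'M[U]_(1 + 1)) a b c d :
  A (lshift 1 ord0) (lshift 1 ord0) = a -> A (lshift 1 ord0) (rshift 1 ord0) = b ->
  A (rshift 1 ord0) (lshift 1 ord0) = c -> A (rshift 1 ord0) (rshift 1 ord0) = d ->
  A = blk2 a b c d.
Proof.
move=> ha hb hc hd; apply/matrixP => i j.
rewrite -(@splitK 1 1 i) -(@splitK 1 1 j).
case: (fintype.split i) => i'; case: (fintype.split j) => j' /=;
by rewrite !ord1 ?(block_mxEul, block_mxEur, block_mxEdl, block_mxEdr) !mxE.
Qed.

Lemma cone_pick N (A : 'M[V]_N) a b : mo_cone V N A ->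
  mo_cone V (1 + 1) (blk2 (A a a) (A a b) (A b a) (A b b)).
Proof.
move=> /(cone_mxsub (fun i : 'I_(1 + 1) => if i == lshift 1 ord0 then a else b)).
by congr (mo_cone V _); apply: matrix2P; rewrite mxE.
Qed.
End MxSub.

(** * Norms in the complexification and rigidity *)

Section CplxNorm.
Variable R : realType.
Local Notation C := R[i].
Let cjR := conj_field_real R.
Let cjC := conj_field_complex R.
Local Notation msR := (matsys (@idfun R)).

(** In the 4x4 real matrix of the 2x2 complex one, rows 1 and 2 show [x] off the diagonal, and rows
    3 and 2 show [y]. *)
Lemma cplx_norm_le (V : msR) (x y : V) (c : C) : is_opsys V ->
  norm_le ((x, y) : complexification V) c ->
  norm_le x (complex.Re c) /\ norm_le y (complex.Re c).
Proof.
move=> Vop [/complex_ge0[-> r0]]; rewrite -/(blk2 _ _ _ _) /=.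
set r := complex.Re c in r0 *; move=> -[_ _].
rewrite !map_blk2 /= !scaler0 subr0 addr0.
set X := blk2 _ _ _ _; set Y := blk2 _ _ _ _ => hB.
split; split=> //.
  have := cone_pick cjR Vop (lshift (1 + 1) (lshift 1 ord0))
    (lshift (1 + 1) (rshift 1 ord0)) hB.
  rewrite !block_mxEul /X /blk2 !(block_mxEul, block_mxEur, block_mxEdl, block_mxEdr) !mxE.
  by [].
have := cone_pick cjR Vop (rshift (1 + 1) (lshift 1 ord0))
    (lshift (1 + 1) (rshift 1 ord0)) hB.
rewrite block_mxEul block_mxEur block_mxEdl block_mxEdr [(- Y) _ _]mxE.
rewrite /X /Y /blk2 !(block_mxEul, block_mxEur, block_mxEdl, block_mxEdr) !mxE.
by rewrite opprK.
Qed.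

Lemma norm_le_cplx (V : msR) (x : V) (r : R) : is_opsys V ->
  norm_le x r -> norm_le ((x, 0) : complexification V) r%:C.
Proof.
move=> Vop [r0 /(cplx_real_cone _ Vop) h]; split; first by rewrite lecR.
move: h; rewrite -!/(blk2 _ _ _ _) map_blk2.
congr (mo_cone _ _ (blk2 _ _ _ _)); rewrite ?cplx_scaleE.
- by congr pair; rewrite /= ?scaler0 ?scale0r ?subr0 ?addr0.
- by rewrite /= /cplx_star /= (star0 cjR) oppr0.
- by congr pair; rewrite /= ?scaler0 ?scale0r ?subr0 ?addr0.
Qed.

(** Rigidity of [I] makes the real part of every iterate of [phi] the identity on [I], so
    [phi^n (x, 0) = (x, n th x)] with [th x] the imaginary part of [phi (x, 0)]. The iterates are
    contractive, so [n th x] stays bounded by the norm of [x], and [th] vanishes. *)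
Lemma IC_rigid (V : msR) (I : opsys (@idfun R)) (j : {linear V -> I}) :
  injective_envelope j ->
  forall phi : {linear IC I -> IC I}, ucp phi ->
    (forall z, phi (cmap j z) = cmap j z) -> forall z, phi z = z.
Proof.
move=> [Iinj [_ j1 _ _] Irig] phi phiu phij.
have Iop := os_repr I.
(* Stated for a function with linearity as a hypothesis, in order to apply to the iterates of
   [phi]. *)
have real_part (psi : IC I -> IC I) : linear psi -> cp psi ->
    psi (ms_unit (IC I)) = ms_unit (IC I) ->
    (forall z, psi (cmap j z) = cmap j z) -> forall x, (psi (x, 0)).1 = x.
  move=> pl pcp p1 pj.
  have rl_ : linear (fun x : I => (psi (x, 0)).1).
    move=> a u v; have := pl a%:C (u, 0) (v, 0).
    rewrite !cplx_scaleE.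
    have -> : (a *: u - 0 *: 0, 0 *: u + a *: 0) + (v, 0) = (a *: u + v, 0) :> cplx I.
      by congr pair; rewrite /= ?scaler0 ?scale0r ?subr0 ?addr0.
    move=> ->; rewrite /= scale0r subr0.
    by [].
  apply: (Irig (mk_linear rl_)).
    split; last by rewrite /= p1.
    move=> n A /(cplx_real_cone _ Iop) /pcp /(cplx_cone_fst Iop).
    by rewrite -!map_mx_comp.
  move=> v /=.
  have := pj (v, 0); rewrite /cmap /= linear0 => ->.
  by [].
pose th x := (phi (x, 0)).2.
have phi1 := phiu.2.
have itl n : linear (iter n phi : IC I -> IC I).
  by elim: n => [//|n IH] a u v; rewrite !iterS IH linearP.
have itcp n : cp (iter n phi : IC I -> IC I).
  elim: n => [|n IH] m A hA; first by rewrite map_mx_id.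
  by have := phiu.1 _ _ (IH _ _ hA); rewrite -map_mx_comp.
have it1 n : iter n phi (ms_unit (IC I)) = ms_unit (IC I).
  by elim: n => // n IH; rewrite iterS IH.
have itj n z : iter n phi (cmap j z) = cmap j z.
  by elim: n => // n IH; rewrite iterS IH.
have it_re n := real_part _ (itl n) (itcp n) (it1 n) (itj n).
have it_im n x : (iter n phi (x, 0)).2 = n%:R *: th x.
  elim: n x => [|n IH] x; first by rewrite scale0r.
  rewrite iterSr.
  have -> : phi (x, 0) = (x, 0) + iC R *: ((th x, 0) : cplx I).
    rewrite [LHS]surjective_pairing (it_re 1%N x) -/(th x).
    by congr pair; rewrite /= ?scaler0 ?scale0r ?scale1r ?subr0 ?addr0 ?add0r.
  rewrite addrC itl /= it_re IH.
  by rewrite IH scale0r scale1r addr0 -natr1 scalerDl scale1r addrC.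
have th0 x : th x = 0.
  have [r hr] := exists_norm_le cjR Iop x.
  apply: (norm_le_eq0 cjR Iop) => e e0.
  have [n hn] : exists n : nat, r <= n.+1%:R * e.
    exists (Num.truncn (r / e)); rewrite -ler_pdivrMr //.
    by apply: ltW; rewrite truncnS_gt.
  have h := cp_norm_le cjC (os_repr (IC I)) (os_repr (IC I)) (itcp n.+1) _ (norm_le_cplx Iop hr).
  have {}h : norm_le (iter n.+1 phi (x, 0) : IC I) r%:C.
    apply: h => c.
    have it0 : iter n.+1 phi 0 = 0 by elim: (n.+1) => // m IH; rewrite iterS IH linear0.
    by have := itl n.+1 c (ms_unit (IC I)) 0; rewrite it0 !addr0 it1.
  move: h; rewrite [iter _ _ _]surjective_pairing => /(cplx_norm_le Iop)[_].
  rewrite it_im => h.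
  have n0 : 0 <= (n.+1%:R : R)^-1 by rewrite invr_ge0.
  have := norm_le_Z cjR Iop h n0; rewrite scalerA mulVf // scale1r => {}h.
  apply: norm_le_wk h _ => //.
  by rewrite mulrC ler_pdivrMr // mulrC.
move=> [x y].
have -> : (x, y) = iC R *: ((y, 0) : cplx I) + (x, 0).
  by congr pair; rewrite /= ?scaler0 ?scale0r ?scale1r ?subr0 ?addr0 ?add0r.
have phix u : phi (u, 0) = (u, 0).
  by rewrite [LHS]surjective_pairing (it_re 1%N u) -/(th u) th0.
by rewrite linearP !phix.
Qed.

Lemma IC_envelope (V : msR) (I : opsys (@idfun R)) (j : {linear V -> I}) :
  injective_envelope j ->
  injective_envelope (mk_linear (cmap_linear j) :
    {linear complexification V -> IC I}).
Proof.
move=> je; have [ji js _] := je; split.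
- exact: IC_injective.
- exact: cmap_subsystem.
- exact: IC_rigid je.
Qed.
End CplxNorm.

(** * Duals and the complexification of a weak expectation *)

Section Arrays.
Variables (K : numFieldType) (conj : K -> K).

(** Positivity of the [mn] by [mn] matrix with rows [(a, k)] and columns [(b, l)]. The indices stay
    separate because, when a matrix over a space is paired with one over its dual, both levels play
    the same role. *)
Definition arr_psd m n (g : 'I_m -> 'I_m -> 'I_n -> 'I_n -> K) : Prop :=
  (forall a b k l, g a b k l = conj (g b a l k)) /\
  forall x : 'I_m -> 'I_n -> K,
    0 <= \sum_a \sum_b \sum_k \sum_l conj (x a k) * g a b k l * x b l.

Lemma scalmx_psd m n (X : 'M['M[K]_n]_m) :
  mo_cone (scalmx conj n) m X <-> arr_psd (fun a b k l => X a b k l).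
Proof.
have qE (x : 'I_m -> 'cV[K]_n) :
    \sum_i \sum_j (map_mx conj (x i)^T *m X i j *m x j) 0 0 =
    \sum_a \sum_b \sum_k \sum_l conj (x a k 0) * X a b k l * x b l 0.
  apply: eq_bigr => a _; apply: eq_bigr => b _; rewrite !mxE.
  rewrite exchange_big; apply: eq_bigr => l _ /=.
  by rewrite !mxE mulr_suml; apply: eq_bigr => k _; rewrite !mxE.
split=> -[h1 h2]; split.
- by move=> a b k l; rewrite h1 !mxE.
- move=> x; have := h2 (fun a => \col_k x a k); rewrite qE.
  congr (0 <= _); do 4![apply: eq_bigr => ? _]; by rewrite !mxE.
- by move=> i j; apply/matrixP => k l; rewrite !mxE h1.
- by move=> x; rewrite qE; exact: h2.
Qed.

Lemma opdual_coneP (V : matsys conj) m (F : 'M[opdual V]_m) :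
  mo_cone (opdual V) m F <-> forall p (A : 'M[V]_p), mo_cone V p A ->
    arr_psd (fun a b k l => (F k l : bdual _) (A a b)).
Proof.
split=> h p A /h.
  move=> /scalmx_psd [h1 h2]; split=> [a b k l|x].
    by have := h1 a b k l; rewrite !mxE.
  by have := h2 x; congr (0 <= _); do 4![apply: eq_bigr => ? _]; rewrite !mxE.
move=> [h1 h2]; apply/scalmx_psd; split=> [a b k l|x].
  by have := h1 a b k l; rewrite !mxE.
by have := h2 x; congr (0 <= _); do 4![apply: eq_bigr => ? _]; rewrite !mxE.
Qed.

Lemma bidual_coneP (V : matsys conj) n (P : 'M[bidual V]_n) :
  mo_cone (bidual V) n P <-> forall m (F : 'M[opdual V]_m),
    mo_cone (opdual V) m F ->
    arr_psd (fun i j k l => (P k l : bdual _) (F i j)).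
Proof.
split=> h p A /h.
  move=> /scalmx_psd [h1 h2]; split=> [a b k l|x].
    by have := h1 a b k l; rewrite !mxE.
  by have := h2 x; congr (0 <= _); do 4![apply: eq_bigr => ? _]; rewrite !mxE.
move=> [h1 h2]; apply/scalmx_psd; split=> [a b k l|x].
  by have := h1 a b k l; rewrite !mxE.
by have := h2 x; congr (0 <= _); do 4![apply: eq_bigr => ? _]; rewrite !mxE.
Qed.

Lemma bdual_lin (V : lmodType K) (nle : V -> K -> Prop) (f : bdual nle) a u v :
  f (a *: u + v) = a * f u + f v.
Proof. by case: f => f /= /asboolP[]. Qed.
Lemma bdual_bnd (V : lmodType K) (nle : V -> K -> Prop) (f : bdual nle) :
  exists M : K, forall v r, nle v r -> `|f v| <= M * r.
Proof. by case: f => f /= /asboolP[]. Qed.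
Lemma bdualD (V : lmodType K) (nle : V -> K -> Prop) (f : bdual nle) u v :
  f (u + v) = f u + f v.
Proof. by rewrite -[u]scale1r bdual_lin mul1r scale1r. Qed.
Lemma bdual0 (V : lmodType K) (nle : V -> K -> Prop) (f : bdual nle) : f 0 = 0.
Proof. by apply: (addrI (f 0)); rewrite -bdualD !addr0. Qed.
Lemma bdualZ (V : lmodType K) (nle : V -> K -> Prop) (f : bdual nle) a u :
  f (a *: u) = a * f u.
Proof. by rewrite -[a *: u]addr0 bdual_lin bdual0 addr0. Qed.
Lemma bdualN (V : lmodType K) (nle : V -> K -> Prop) (f : bdual nle) u :
  f (- u) = - f u.
Proof. by rewrite -scaleN1r bdualZ mulN1r. Qed.
Lemma bdual_addE (V : lmodType K) (nle : V -> K -> Prop) (f g : bdual nle) u :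
  (f + g) u = f u + g u.
Proof. by []. Qed.
Lemma bdual_oppE (V : lmodType K) (nle : V -> K -> Prop) (f : bdual nle) u :
  (- f) u = - f u.
Proof. by []. Qed.
Lemma bdual_scaleE (V : lmodType K) (nle : V -> K -> Prop) a (f : bdual nle) u :
  (a *: f) u = a * f u.
Proof. by []. Qed.
Lemma opdual_addE (V : matsys conj) (F G : opdual V) (f : V) :
  ((F + G : opdual V) : bdual _) f = (F : bdual _) f + (G : bdual _) f.
Proof. by []. Qed.
Lemma bdualP (V : lmodType K) (nle : V -> K -> Prop) (f g : bdual nle) :
  (forall u, f u = g u) -> f = g.
Proof. by move=> h; apply: val_inj; apply/funext. Qed.

Fact mk_bdual_subproof (V : lmodType K) (nle : V -> K -> Prop) (f : V -> K^o) :
  (forall a u v, f (a *: u + v) = a * f u + f v) ->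
  (exists M : K, forall v r, nle v r -> `|f v| <= M * r) ->
  f \in bounded_functional nle.
Proof. by move=> h1 h2; apply/asboolP. Qed.

Definition mk_bdual (V : lmodType K) (nle : V -> K -> Prop) (f : V -> K^o)
    (h1 : forall a u v, f (a *: u + v) = a * f u + f v)
    (h2 : exists M : K, forall v r, nle v r -> `|f v| <= M * r) : bdual nle :=
  BDual (mk_bdual_subproof h1 h2).
End Arrays.

Section ComplexArrays.
Variable R : realType.
Local Notation C := R[i].
Local Notation msR := (matsys (@idfun R)).
Let cjC := conj_field_complex R.

(** The form of [G] at a real vector is the real part of the form of [g] at the complex vector whose
    real and imaginary parts are its two halves. *)
Lemma arr_real_of_complex m n (g : 'I_m -> 'I_m -> 'I_n -> 'I_n -> C)
    (G : 'I_m -> 'I_m -> 'I_(n + n) -> 'I_(n + n) -> R) :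
  (forall a b k l, [/\ G a b (lshift n k) (lshift n l) = complex.Re (g a b k l),
     G a b (lshift n k) (rshift n l) = - complex.Im (g a b k l),
     G a b (rshift n k) (lshift n l) = complex.Im (g a b k l) &
     G a b (rshift n k) (rshift n l) = complex.Re (g a b k l)]) ->
  arr_psd (@conjc R) g -> arr_psd (@idfun R) G.
Proof.
move=> GE [h1 h2]; split=> [a b k l|x].
  rewrite -(@splitK n n k) -(@splitK n n l) /=.
  case: (fintype.split k) => k'; case: (fintype.split l) => l' /=;
  have [e1 e2 e3 e4] := GE a b k' l'; have [f1 f2 f3 f4] := GE b a l' k';
  rewrite ?e1 ?e2 ?e3 ?e4 ?f1 ?f2 ?f3 ?f4 h1; case: (g b a l' k') => u v //=.
  by rewrite opprK.
have /complex_ge0[_] := h2 (fun a k => x a (lshift n k) +i* x a (rshift n k)).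
congr (0 <= _); rewrite raddf_sum; apply: eq_bigr => a _.
rewrite raddf_sum; apply: eq_bigr => b _; rewrite big_split_ord /= raddf_sum.
rewrite -big_split; apply: eq_bigr => k _ /=.
rewrite raddf_sum !big_split_ord /= -!big_split /=; apply: eq_bigr => l _.
have [-> -> -> ->] := GE a b k l; case: (g a b k l) => u v /=.
ring.
Qed.

(** The two doubled index sets carry commuting rotations [J1] and [J2] with square -1, and [G] is
    [p + q J1 + r J2 + s J1 J2]. Where [J1] and [J2] agree and play the part of i, this is
    [(p - s) + i (q + r)]. *)
Lemma arr_complex_of_real m n (p q r s : 'I_m -> 'I_m -> 'I_n -> 'I_n -> R)
    (G : 'I_(m + m) -> 'I_(m + m) -> 'I_(n + n) -> 'I_(n + n) -> R) :
  (forall i j k l,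
     let L := @lshift m m in let D := @rshift m m in
     let L' := @lshift n n in let D' := @rshift n n in
     [/\ [/\ G (L i) (L j) (L' k) (L' l) = p i j k l,
              G (L i) (D j) (L' k) (L' l) = - q i j k l,
              G (D i) (L j) (L' k) (L' l) = q i j k l &
              G (D i) (D j) (L' k) (L' l) = p i j k l],
         [/\ G (L i) (L j) (L' k) (D' l) = - r i j k l,
              G (L i) (D j) (L' k) (D' l) = s i j k l,
              G (D i) (L j) (L' k) (D' l) = - s i j k l &
              G (D i) (D j) (L' k) (D' l) = - r i j k l],
         [/\ G (L i) (L j) (D' k) (L' l) = r i j k l,
              G (L i) (D j) (D' k) (L' l) = - s i j k l,
              G (D i) (L j) (D' k) (L' l) = s i j k l &
              G (D i) (D j) (D' k) (L' l) = r i j k l] &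
         [/\ G (L i) (L j) (D' k) (D' l) = p i j k l,
              G (L i) (D j) (D' k) (D' l) = - q i j k l,
              G (D i) (L j) (D' k) (D' l) = q i j k l &
              G (D i) (D j) (D' k) (D' l) = p i j k l]]) ->
  arr_psd (@idfun R) G ->
  arr_psd (@conjc R)
    (fun i j k l => (p i j k l - s i j k l) +i* (q i j k l + r i j k l)).
Proof.
move=> GE [h1 h2].
have sym i j k l : [/\ p i j k l = p j i l k, q i j k l = - q j i l k,
    r i j k l = - r j i l k & s i j k l = s j i l k].
  have [[a1 a2 a3 a4] [b1 b2 b3 b4] [c1 c2 c3 c4] _] := GE i j k l.
  have [[a1' a2' a3' a4'] [b1' b2' b3' b4'] [c1' c2' c3' c4'] _] := GE j i l k.
  split.
  - by rewrite -a1 h1 /= a1'.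
  - by rewrite -a3 h1 /= a2'.
  - by rewrite -c1 h1 /= b1'.
  - by rewrite -c3 h1 /= b2'.
split=> [i j k l|x].
  have [-> -> -> ->] := sym i j k l; apply/eqP; rewrite eq_complex /= eqxx /=.
  by rewrite opprD.
set Q := \sum_a _.
have Qc : conjc Q = Q.
  have cs := @cj_sum C (@conjc R) cjC.
  have -> : conjc Q = \sum_a \sum_b \sum_k \sum_l
      conjc (conjc (x a k) * ((p a b k l - s a b k l) +i* (q a b k l + r a b k l)) * x b l).
    rewrite /Q cs; apply: eq_bigr => a _; rewrite cs; apply: eq_bigr => b _.
    by rewrite cs; apply: eq_bigr => k _; rewrite cs.
  rewrite exchange_big; apply: eq_bigr => i _; apply: eq_bigr => j _.
  rewrite exchange_big; apply: eq_bigr => k _; apply: eq_bigr => l _.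
  have [-> -> -> ->] := sym i j k l.
  case: (x i k) (x j l) => u v [u' v'].
  by apply/eqP; rewrite eq_complex /=; apply/andP; split; apply/eqP; ring.
rewrite lecE (conjc_Im Qc) eqxx /=.
(* For [x = u + iv] the four quadrants receive [u, v, v, -u]: these are the vectors on which both
   rotations agree. The form of [G] there is twice that of the complex array. *)
pose y (i : 'I_(m + m)) (k : 'I_(n + n)) : R :=
  match fintype.split i, fintype.split k with
  | inl i, inl k => complex.Re (x i k)
  | inl i, inr k => complex.Im (x i k)
  | inr i, inl k => complex.Im (x i k)
  | inr i, inr k => - complex.Re (x i k)
  end.
have yll i k : y (lshift m i) (lshift n k) = complex.Re (x i k).
  by rewrite /y (unsplitK (inl i)) (unsplitK (inl k)).
have ylr i k : y (lshift m i) (rshift n k) = complex.Im (x i k).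
  by rewrite /y (unsplitK (inl i)) (unsplitK (inr k)).
have yrl i k : y (rshift m i) (lshift n k) = complex.Im (x i k).
  by rewrite /y (unsplitK (inr i)) (unsplitK (inl k)).
have yrr i k : y (rshift m i) (rshift n k) = - complex.Re (x i k).
  by rewrite /y (unsplitK (inr i)) (unsplitK (inr k)).
have := h2 y; have -> : \sum_a \sum_b \sum_k \sum_l
    idfun (y a k) * G a b k l * y b l = complex.Re Q *+ 2.
  rewrite /Q raddf_sum big_split_ord /= -big_split /= -sumrMnl; apply: eq_bigr => i _.
  rewrite raddf_sum /= !big_split_ord /= -!big_split /= -sumrMnl; apply: eq_bigr => j _ /=.
  rewrite raddf_sum !big_split_ord /= -!big_split /= -sumrMnl; apply: eq_bigr => k _ /=.
  rewrite raddf_sum !big_split_ord /= -!big_split /= -sumrMnl; apply: eq_bigr => l _ /=.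
  rewrite !yll !ylr !yrl !yrr.
  have [[-> -> -> ->] [-> -> -> ->] [-> -> -> ->] [-> -> -> ->]] := GE i j k l.
  case: (x i k) (x j l) => u v [u' v'] /=.
  ring.
by rewrite pmulrn_lge0.
Qed.
End ComplexArrays.

Section WepUp.
Variable R : realType.
Local Notation C := R[i].
Local Notation msR := (matsys (@idfun R)).
Variable S : opsys (@idfun R).
Let Sop := os_repr S.
Local Notation Sc := (complexification S).

Lemma cReD (x y : C) : complex.Re (x + y) = complex.Re x + complex.Re y.
Proof. by case: x y => ? ? []. Qed.
Lemma cImD (x y : C) : complex.Im (x + y) = complex.Im x + complex.Im y.
Proof. by case: x y => ? ? []. Qed.
Lemma cReM (x y : C) :
  complex.Re (x * y) = complex.Re x * complex.Re y - complex.Im x * complex.Im y.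
Proof. by case: x y => ? ? []. Qed.
Lemma cImM (x y : C) :
  complex.Im (x * y) = complex.Re x * complex.Im y + complex.Im x * complex.Re y.
Proof. by case: x y => ? ? []. Qed.

Lemma normc_Re (x : C) (r : R) : `|x| <= r%:C -> `|complex.Re x| <= r.
Proof.
case: x => a b; rewrite lecR; apply: le_trans.
by rewrite -sqrtr_sqr ler_wsqrtr // lerDl sqr_ge0.
Qed.
Lemma normc_Im (x : C) (r : R) : `|x| <= r%:C -> `|complex.Im x| <= r.
Proof.
case: x => a b; rewrite lecR; apply: le_trans.
by rewrite -sqrtr_sqr ler_wsqrtr // lerDr sqr_ge0.
Qed.
Lemma emb_Zr (r : R) (v : S) : ((r *: v, 0) : Sc) = r%:C *: ((v, 0) : Sc).
Proof. by congr pair; rewrite /= ?scaler0 ?scale0r ?subr0 ?addr0. Qed.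

Lemma fre_lin (f : opdual Sc) (a : R) (u v : S) :
  complex.Re ((f : bdual _) (a *: u + v, 0)) =
  a * complex.Re ((f : bdual _) (u, 0)) + complex.Re ((f : bdual _) (v, 0)).
Proof.
have -> : ((a *: u + v, 0) : Sc) = a%:C *: ((u, 0) : Sc) + ((v, 0) : Sc).
  by rewrite -emb_Zr; congr pair; rewrite /= addr0.
by rewrite bdual_lin cReD cReM /= mul0r subr0.
Qed.
Lemma fim_lin (f : opdual Sc) (a : R) (u v : S) :
  complex.Im ((f : bdual _) (a *: u + v, 0)) =
  a * complex.Im ((f : bdual _) (u, 0)) + complex.Im ((f : bdual _) (v, 0)).
Proof.
have -> : ((a *: u + v, 0) : Sc) = a%:C *: ((u, 0) : Sc) + ((v, 0) : Sc).
  by rewrite -emb_Zr; congr pair; rewrite /= addr0.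
by rewrite bdual_lin cImD cImM /= mul0r addr0.
Qed.

Lemma bnd_real (x M : C) (r : R) : `|x| <= M * r%:C -> `|x| <= (complex.Re M * r)%:C.
Proof.
have /complex_ge0[-> _] := normr_ge0 x.
by case: M => a b; rewrite lecE /= !mulr0 subr0 => /andP[_]; rewrite lecR.
Qed.

Lemma fre_bnd (f : opdual Sc) : exists M : R, forall v r, norm_le (v : S) r ->
  `|complex.Re ((f : bdual _) (v, 0))| <= M * r.
Proof.
have [M hM] := bdual_bnd f; exists (complex.Re M) => v r /(norm_le_cplx Sop) /hM.
by move=> /bnd_real /normc_Re.
Qed.
Lemma fim_bnd (f : opdual Sc) : exists M : R, forall v r, norm_le (v : S) r ->
  `|complex.Im ((f : bdual _) (v, 0))| <= M * r.
Proof.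
have [M hM] := bdual_bnd f; exists (complex.Re M) => v r /(norm_le_cplx Sop) /hM.
by move=> /bnd_real /normc_Im.
Qed.

Definition fre (f : opdual Sc) : opdual S := mk_bdual (fre_lin f) (fre_bnd f).
Definition fim (f : opdual Sc) : opdual S := mk_bdual (fim_lin f) (fim_bnd f).

Lemma freE a (f g : opdual Sc) :
  fre (a *: f + g) = complex.Re a *: fre f - complex.Im a *: fim f + fre g.
Proof.
apply: bdualP => u; rewrite !(bdual_addE, bdual_oppE, bdual_scaleE) /=.
by rewrite cReD cReM.
Qed.
Lemma fimE a (f g : opdual Sc) :
  fim (a *: f + g) = complex.Re a *: fim f + complex.Im a *: fre f + fim g.
Proof.
apply: bdualP => u; rewrite !(bdual_addE, bdual_oppE, bdual_scaleE) /=.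
by rewrite cImD cImM.
Qed.

Lemma dual_norm_fre (f : opdual Sc) (r : C) : dual_norm_le f r ->
  dual_norm_le (fre f) (complex.Re r) /\ dual_norm_le (fim f) (complex.Re r).
Proof.
move=> [/complex_ge0[-> r0] h]; split; split=> // v s /(norm_le_cplx Sop) /h.
  by rewrite -rmorphM => /normc_Re.
by rewrite -rmorphM => /normc_Im.
Qed.

Variable I : opsys (@idfun R).
Variable phi : {linear I -> bidual S}.

(** The product of [phi z.1 + i phi z.2] with [fre f + i fim f], expanded. *)
Definition phiC_fun (z : cplx I) (f : opdual Sc) : C :=
  ((phi z.1 : bdual _) (fre f) - (phi z.2 : bdual _) (fim f)) +i*
  ((phi z.1 : bdual _) (fim f) + (phi z.2 : bdual _) (fre f)).

Lemma phiC_lin z a f g :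
  phiC_fun z (a *: f + g) = a * phiC_fun z f + phiC_fun z g.
Proof.
rewrite /phiC_fun freE fimE !(bdualD, bdualN, bdualZ).
case: a => a b /=.
by apply/eqP; rewrite eq_complex /=; apply/andP; split; apply/eqP => /=; ring.
Qed.

Lemma normc_le_sum (x : C) (r : R) :
  `|complex.Re x| + `|complex.Im x| <= r -> `|x| <= r%:C.
Proof.
case: x => a b /= h; rewrite lecR; apply: le_trans h.
rewrite -(ler_pXn2r (n := 2)) ?nnegrE ?addr_ge0 ?sqrtr_ge0 //.
rewrite sqr_sqrtr ?addr_ge0 ?sqr_ge0 // sqrrD !real_normK ?num_real //.
by rewrite -addrA lerD2l lerDr mulrn_wge0 // mulr_ge0.
Qed.

Lemma phiC_bnd z : exists M : C, forall f r, dual_norm_le (f : opdual Sc) r ->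
  `|phiC_fun z f| <= M * r.
Proof.
have [M1 h1] := bdual_bnd (phi z.1); have [M2 h2] := bdual_bnd (phi z.2).
exists (2 * (M1 + M2))%:C => f r fr; have [f1 f2] := dual_norm_fre fr.
have [/complex_ge0[-> _] _] := fr; rewrite -rmorphM.
apply: normc_le_sum.
have := h1 _ _ f1; have := h1 _ _ f2; have := h2 _ _ f1; have := h2 _ _ f2.
rewrite /phiC_fun /=.
set a := (phi z.1 : bdual _) (fre f); set b := (phi z.1 : bdual _) (fim f).
set c := (phi z.2 : bdual _) (fre f); set d := (phi z.2 : bdual _) (fim f).
have := ler_normB a d; have := ler_normD b c.
set s := complex.Re r; lra.
Qed.

Definition phiC_ (z : complexification I) : bidual Sc :=
  mk_bdual (phiC_lin z) (phiC_bnd z).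

Lemma phiC_linear : linear phiC_.
Proof.
move=> [a b] [x y] [x' y']; apply: bdualP => f.
rewrite bdual_addE bdual_scaleE /= /phiC_fun /=.
have pD u v g : (phi (u + v) : bdual _) g = (phi u : bdual _) g + (phi v : bdual _) g.
  by rewrite linearD.
have pN u g : (phi (- u) : bdual _) g = - (phi u : bdual _) g by rewrite linearN.
have pZ c u g : (phi (c *: u) : bdual _) g = c * (phi u : bdual _) g.
  by rewrite linearZ.
rewrite !(pD, pN, pZ).
by apply/eqP; rewrite eq_complex /=; apply/andP; split; apply/eqP => /=; ring.
Qed.

Lemma phiC_cp : cp phi -> @cp _ (complexification I) (bidual Sc) phiC_.
Proof.
move=> pcp n Z [_ _ /pcp hZ]; apply/bidual_coneP => m F hF.
set X := map_mx fst Z in hZ; set Y := map_mx snd Z in hZ.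
(* The real block form of [F]. Pairing it with the real block form of [Z] gives exactly the array
   that [arr_complex_of_real] takes apart. *)
pose FF : 'M[opdual S]_(m + m) :=
  block_mx (map_mx fre F) (- map_mx fim F) (map_mx fim F) (map_mx fre F).
have hFF : mo_cone (opdual S) (m + m) FF.
  apply/opdual_coneP => p A /(cplx_real_cone _ Sop).
  move/opdual_coneP : hF => /[apply].
  apply: arr_real_of_complex => a b k l; rewrite /FF.
  by rewrite block_mxEul block_mxEur block_mxEdl block_mxEdr !mxE.
have phiN u g : (phi (- u) : bdual _) g = - (phi u : bdual _) g by rewrite linearN.
have := (bidual_coneP _).1 hZ _ _ hFF.
move=> /(arr_complex_of_real (p := fun i j k l => (phi (X k l) : bdual _) (fre (F i j)))
  (q := fun i j k l => (phi (X k l) : bdual _) (fim (F i j)))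
  (r := fun i j k l => (phi (Y k l) : bdual _) (fre (F i j)))
  (s := fun i j k l => (phi (Y k l) : bdual _) (fim (F i j)))).
have e (g : 'I_m -> 'I_m -> 'I_n -> 'I_n -> C) g' : (forall i j k l, g i j k l = g' i j k l) ->
    arr_psd (@conjc R) g -> arr_psd (@conjc R) g'.
  move=> gg [h1 h2]; split=> [a b k l|x]; first by rewrite -!gg h1.
  by have := h2 x; congr (0 <= _); do 4![apply: eq_bigr => ? _]; rewrite gg.
move=> h; apply: e (h _); first by move=> i j k l; rewrite !mxE.
move=> i j k l; rewrite map_block_mx /FF.
rewrite !(block_mxEul, block_mxEur, block_mxEdl, block_mxEdr) !mxE.
by rewrite !phiN !bdualN !opprK.
Qed.

Lemma phiC_eval s v : is_eval s (phi v) -> forall s' v', is_eval s' (phi v') ->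
  is_eval ((s, s') : Sc) (phiC_ (v, v')).
Proof.
move=> h s' v' h' f; rewrite /= /phiC_fun /= !h !h' /=.
have -> : ((s, s') : Sc) = iC R *: ((s', 0) : Sc) + (s, 0).
  by congr pair; rewrite /= ?scaler0 ?scale0r ?scale1r ?subr0 ?addr0 ?add0r.
rewrite bdual_lin; case: (_ (s, 0)) (_ (s', 0)) => a b [c d] /=.
by apply/eqP; rewrite eq_complex /=; apply/andP; split; apply/eqP => /=; ring.
Qed.
End WepUp.

Lemma real_wep_complexification (R : realType) (S : opsys (@idfun R)) :
  real_wep S -> complex_wep (complexification S).
Proof.
move=> [I [j [je [phi [pcp p1 pj]]]]].
exists (IC I), (mk_linear (cmap_linear j)); split; first exact: IC_envelope.
exists (mk_linear (phiC_linear phi)); split.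
- exact: phiC_cp.
- apply: phiC_eval => //.
  by move=> f; rewrite linear0 bdual0.
- by move=> [x y]; apply: phiC_eval.
Qed.

(** * The real part of a complex injective envelope *)

Section SubSpace.
Variables (K : numFieldType) (V : lmodType K).

(** The closure proof is an argument so that the submodule structure can be inferred from the
    predicate itself. *)
Definition subspace_pred (P : V -> Prop)
    (_ : submod_closed (fun v => `[< P v >])) : {pred V} := fun v => `[< P v >].

Variables (P : V -> Prop) (Pc : submod_closed (fun v => `[< P v >])).

Fact subspace_pred_closed : submod_closed (subspace_pred Pc).
Proof. exact: Pc. Qed.

HB.instance Definition _ :=
  GRing.isSubmodClosed.Build K V (subspace_pred Pc) subspace_pred_closed.

Record subsp := SubSp {
  subsp_val :> V;
  _ : subsp_val \in subspace_pred Pc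
}.

HB.instance Definition _ := [isSub for subsp_val].
HB.instance Definition _ := [Choice of subsp by <:].
HB.instance Definition _ := [SubChoice_isSubLmodule of subsp by <:].

Lemma subspP (v : subsp) : P v.
Proof. by case: v => v /= /asboolP. Qed.
Fact mk_subsp_subproof v : P v -> v \in subspace_pred Pc.
Proof. by move=> h; apply/asboolP. Qed.
Definition mk_subsp v (h : P v) : subsp := SubSp (mk_subsp_subproof h).
Lemma subsp_inj (u v : subsp) : (u : V) = v -> u = v.
Proof. exact: val_inj. Qed.
Lemma subsp_val_linear : linear (subsp_val : subsp -> V).
Proof. by []. Qed.
End SubSpace.

Section SubSystem.
Variables (K : numFieldType) (conj : K -> K) (V : matsys conj).
Variables (P : V -> Prop) (Pc : submod_closed (fun v => `[< P v >])).
Local Notation subsp := (subsp Pc).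
Hypothesis Pstar : forall v, P v -> P (ms_star v).
Variables (u : V) (Pu : P u).

Definition subsp_star (v : subsp) : subsp := mk_subsp Pc (Pstar (subspP v)).
Fact subsp_starK : involutive subsp_star.
Proof. by move=> v; apply: subsp_inj; rewrite /= ms_starK. Qed.
Fact subsp_star_lin a v w :
  subsp_star (a *: v + w) = conj a *: subsp_star v + subsp_star w.
Proof. by apply: subsp_inj; rewrite /= ms_star_lin. Qed.

Definition subsys : matsys conj :=
  @MatSys K conj (@MatOrd K subsp (fun n (A : 'M[subsp]_n) =>
      mo_cone V n (map_mx (@subsp_val _ _ _ _) A)))
    subsp_star (mk_subsp Pc Pu) subsp_starK subsp_star_lin.

Definition subsys_val : {linear subsys -> V} := mk_linear (@subsp_val_linear _ _ _ Pc).
End SubSystem.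

Section Down.
Variable R : realType.
Local Notation C := R[i].
Local Notation msR := (matsys (@idfun R)).

Lemma mxsub_swap (U : Type) n (A B D E : 'M[U]_n) :
  mxsub (fun s : 'I_(n + n) => match fintype.split s with
     inl i => rshift n i | inr i => lshift n i end)
    (fun s : 'I_(n + n) => match fintype.split s with
     inl i => rshift n i | inr i => lshift n i end) (block_mx A B D E)
  = block_mx E D B A.
Proof.
apply/matrixP => i j; rewrite mxE -(@splitK n n i) -(@splitK n n j).
case: (fintype.split i) => i'; case: (fintype.split j) => j';
by rewrite /unsplit ?(unsplitK (inl _)) ?(unsplitK (inr _))
   ?(block_mxEul, block_mxEur, block_mxEdl, block_mxEdr).
Qed.

Section Ext.
Variables (J : opsys (@conjc R)).
Let Jop := os_repr J.

Lemma extc_linear (E : msR) (psi : {linear E -> realification J}) :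
  linear (fun z : complexification E => (psi z.1 : J) + iC R *: (psi z.2 : J)).
Proof.
have pD u v : (psi (u + v) : J) = (psi u : J) + psi v by rewrite linearD.
have pN u : (psi (- u) : J) = - (psi u : J) by rewrite linearN.
have pZ (r : R) u : (psi (r *: u) : J) = r%:C *: (psi u : J) by rewrite linearZ_LR.
apply: linear_iC => [u v|r u|u].
- by rewrite !pD scalerDr addrACA.
- case: u => u v /=; rewrite !scale0r subr0 add0r !pZ scalerDr !scalerA.
  by rewrite (mulrC (iC R)).
- case: u => u v /=; rewrite !scale0r !scale1r sub0r addr0 pN scalerDr scalerA.
  by rewrite iCsq scaleN1r addrC.
Qed.

Lemma extc_cp (E : msR) (psi : {linear E -> realification J}) : cp psi ->
  @cp _ (complexification E) J (fun z => (psi z.1 : J) + iC R *: (psi z.2 : J)).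
Proof.
move=> pcp n Z [_ _ /pcp]; rewrite map_block_mx => h.
have -> : map_mx (fun z => (psi z.1 : J) + iC R *: (psi z.2 : J)) Z =
    (map_mx (fun z => psi z.1) Z : 'M[J]_n)
    + zmx (iC R) (map_mx (fun z => psi z.2) Z : 'M[J]_n).
  by apply/matrixP => r t; rewrite !mxE.
apply: cone_iC => //; refine (eq_ind _ (mo_cone J (n + n)) h _ _).
by congr block_mx; apply/matrixP => r t; rewrite !mxE ?linearN.
Qed.

(** A real-linear ucp map into [J] extends complex-linearly to the complexification of its domain;
    injectivity of [J] applies there, and the result is restricted to the real elements of [F]. *)
Lemma IR_injective : injective_opsys J -> injective_opsys (IR J).
Proof.
move=> Jinj E F k psi ks [pcp p1].
have [|Psi [[Pcp P1] Pk]] := Jinj (IC E) (IC F) _ (mk_linear (extc_linear psi))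
   (cmap_subsystem ks).
  split; first exact: extc_cp.
  by rewrite /= p1 linear0 scaler0 addr0.
have PsiRl : linear (fun v : F => (Psi (v, 0) : realification J)).
  move=> a u v; rewrite rl_scaleE -linearP; congr (Psi _).
  by congr pair; rewrite /= ?scaler0 ?scale0r ?subr0 ?addr0.
exists (mk_linear PsiRl); split; [split|].
- move=> n A /(cplx_real_cone _ (os_repr F)) /Pcp.
  by rewrite -map_mx_comp.
- exact: P1.
- move=> x /=; have := Pk (x, 0); rewrite /= /cmap /= linear0 => ->.
  by rewrite linear0 scaler0 addr0.
Qed.
End Ext.
End Down.

Section Anti.
Variable R : realType.
Local Notation C := R[i].
Local Notation msR := (matsys (@idfun R)).
Let cjC := conj_field_complex R.
Variables (J : matsys (@conjc R)).
Hypothesis Jop : is_opsys J.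
Variable th0 : {linear realification J -> realification J}.
Local Notation i := (iC R).

(* The conjugate-linear part of the real-linear map [th0]. *)
Definition anti (a : J) : J :=
  (2^-1 : C) *: ((th0 a : J) + i *: (th0 (i *: a : J) : J)).

Lemma th0D u v : (th0 (u + v) : J) = (th0 u : J) + th0 v.
Proof. exact: (linearD th0). Qed.
Lemma th0N u : (th0 (- u) : J) = - (th0 u : J).
Proof. exact: (raddfN th0). Qed.
Lemma th0Z (r : R) (u : J) : (th0 (r%:C *: u : J) : J) = r%:C *: (th0 u : J).
Proof. exact: (linearZ_LR th0 r u). Qed.

Lemma antiD u v : anti (u + v) = anti u + anti v.
Proof. by rewrite /anti (scalerDr i u) !th0D (scalerDr i (_ : J)) addrACA scalerDr. Qed.
Lemma antiZ (r : R) u : anti (r%:C *: u) = r%:C *: anti u.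
Proof.
rewrite /anti scalerA mulrC -scalerA !th0Z !scalerA.
by rewrite (mulrC i) -!scalerA -scalerDr !scalerA mulrC.
Qed.
Lemma anti_i u : anti (i *: u) = - (i *: anti u).
Proof.
rewrite /anti scalerA iCsq scaleN1r th0N scalerN [i *: (_ *: _)]scalerA mulrC -scalerA -[RHS]scalerN.
congr (_ *: _); rewrite scalerDr scalerA iCsq scaleN1r opprD opprK.
by rewrite addrC.
Qed.
Lemma anti_rl_linear : linear (anti : realification J -> realification J).
Proof. by move=> a u v; rewrite rl_scaleE antiD antiZ. Qed.

(** As for [rhoC_cp], with the row [(1, -i)] in place of [(1, i)]. *)
Lemma anti_cp : cp th0 -> @cp _ J J anti.
Proof.
move=> tcp n A /(cone_ccompress cjC Jop (row_mx 1%:M (- i)%:M)).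
rewrite (ccompress_row cjC) => /tcp; rewrite map_block_mx => h.
have -> : map_mx anti A = zmx (2^-1 : C) ((map_mx th0 (A : 'M[realification J]_n) : 'M[J]_n) +
    zmx i (map_mx (fun a : J => (th0 (i *: a : J) : J)) A)).
  by apply/matrixP => r t; rewrite !mxE.
apply: (cone_zmx cjC Jop); first by rewrite invr_ge0.
apply: cone_iC => //; refine (eq_ind _ (mo_cone J (n + n)) h _ _).
have ci : conjc (- i) = i by rewrite (cjN cjC) iCconj opprK.
congr block_mx; apply/matrixP => r t;
  rewrite !mxE ?(cj1 cjC) ?ci ?mulr1 ?mul1r ?scale1r //.
- by rewrite scaleNr th0N.
- by rewrite mulrN iCsq opprK scale1r.
Qed.
End Anti.

Section Down.
Variable R : realType.
Local Notation C := R[i].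
Local Notation msR := (matsys (@idfun R)).
Let cjR := conj_field_real R.
Variables (S : opsys (@idfun R)) (J : opsys (@conjc R)).
Let Sop := os_repr S.
Let Jop := os_repr J.
Variable k : {linear complexification S -> J}.
Hypothesis je : injective_envelope k.
Local Notation i := (iC R).
Let ke : subsystem k. Proof. by case: je. Qed.
Let k1 : k (ms_unit S, 0) = ms_unit J. Proof. by case: ke. Qed.

Definition kbar (z : realification (complexification S)) : realification J :=
  k (z.1, - z.2).

Lemma kbar_linear : linear kbar.
Proof.
move=> a [x y] [x' y']; rewrite rlcplxE rl_scaleE -linearP; congr (k _).
congr pair; rewrite /= ?scale0r ?subr0 ?add0r //.
by rewrite opprD scalerN.
Qed.

Lemma kbar_cp : cp (mk_linear kbar_linear).
Proof.
move=> n Z [xs ys h]; have [_ _ _ kc] := ke.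
have := (kc n (map_mx (fun z : complexification S => (z.1, - z.2)) Z)).1.
rewrite -map_mx_comp; apply; split.
- have -> : map_mx fst (map_mx (fun z : complexification S => (z.1, - z.2)) Z) = map_mx fst Z.
    by apply/matrixP => r t; rewrite !mxE.
  by [].
- have -> : map_mx snd (map_mx (fun z : complexification S => (z.1, - z.2)) Z) = - map_mx snd Z.
    by apply/matrixP => r t; rewrite !mxE.
  by rewrite (mxstarN cjR) -ys.
have -> : map_mx fst (map_mx (fun z : complexification S => (z.1, - z.2)) Z) = map_mx fst Z.
  by apply/matrixP => r t; rewrite !mxE.
have -> : map_mx snd (map_mx (fun z : complexification S => (z.1, - z.2)) Z) = - map_mx snd Z.
  by apply/matrixP => r t; rewrite !mxE.
by rewrite opprK -mxsub_swap; apply: (cone_mxsub cjR (os_repr S)).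
Qed.

(** Injectivity of the realification extends [kbar] to a merely real-linear map, and its
    conjugate-linear part still extends [kbar]. The square of this part is complex-linear and fixes
    the range of [k], so rigidity makes it the identity. *)
Lemma exists_conj : exists th : {linear realification J -> realification J},
  [/\ @cp _ J J th, th (ms_unit J) = ms_unit J,
    forall u, (th (i *: u : J) : J) = - (i *: (th u : J)),
    forall x y, th (k (x, y)) = k (x, - y) & forall u, th (th u) = u].
Proof.
have [Jinj _ Jrig] := je.
have [|th0 [[tcp _] t0k]] := @IR_injective R J Jinj (IR (IC S)) (IR J) _
   (mk_linear kbar_linear) (subsystem_rl ke).
  by split; [exact: kbar_cp | rewrite /= /kbar /= oppr0].
have {}t0k x y : (th0 (k (x, y)) : J) = k (x, - y) by exact: t0k (x, y).
pose th := mk_linear (anti_rl_linear th0).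
have thi u : (th (i *: u : J) : J) = - (i *: (th u : J)) by exact: anti_i.
have thk x y : th (k (x, y)) = k (x, - y).
  rewrite /= /anti t0k -linearZ.
  have -> : i *: ((x, y) : complexification S) = (- y, x).
    by congr pair; rewrite /= ?scale0r ?scale1r ?sub0r ?addr0.
  rewrite t0k -linearZ -linearD -linearZ; congr (k _).
  have -> : ((x, - y) : complexification S) + i *: ((- y, - x) : complexification S)
     = 2 *: ((x, - y) : complexification S).
    rewrite scaler_nat mulr2n; congr (_ + _).
    by congr pair; rewrite /= ?scale0r ?scale1r ?sub0r ?addr0 ?opprK.
  by rewrite scalerA mulVf ?scale1r // pnatr_eq0.
have th1 : th (ms_unit J) = ms_unit J.
  by rewrite -[X in th X]k1 thk oppr0 k1.
have thcp : @cp _ J J th by exact: anti_cp.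
exists th; split=> // u.
have th2l : linear (fun u : J => (th (th u) : J)).
  apply: linear_iC => [a b|r a|a].
  - by rewrite !linearD.
  - by rewrite /= !antiZ.
  - have -> : (th (iC R *: a : J) : J) = - (i *: (th a : J)) by exact: thi.
    have -> : (th (- (i *: (th a : J)) : J) : J) = - (th (i *: (th a : J) : J) : J).
      exact: (raddfN th).
    have -> : (th (i *: (th a : J) : J) : J) = - (i *: (th (th a) : J)) by exact: thi.
    by rewrite opprK.
apply: (Jrig (mk_linear th2l)).
  split; last by suff : th (th (ms_unit J)) = ms_unit J by []; rewrite !th1.
  by move=> n A /thcp /thcp; rewrite -map_mx_comp.
move=> [x y]; suff : th (th (k (x, y))) = k (x, y) by [].
by rewrite !thk opprK.
Qed.
End Down.

Lemma subsys_subsystem (K : numFieldType) (conj : K -> K) (V : matsys conj)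
    (P : V -> Prop) (Pc : submod_closed (fun v => `[< P v >]))
    (Ps : forall v, P v -> P (ms_star v)) (Pu : P (ms_unit V)) :
  subsystem (subsys_val Pc Ps Pu).
Proof. by split=> //; exact: subsp_inj. Qed.

Section RealPart.
Variable R : realType.
Local Notation C := R[i].
Let cjR := conj_field_real R.
Variables (S : opsys (@idfun R)) (J : opsys (@conjc R)).
Variable k : {linear complexification S -> J}.
Hypothesis je : injective_envelope k.
Let Sop := os_repr S.
Let Jop := os_repr J.
Let JRop := realification_opsys Jop.
Local Notation JR := (realification J).
Local Notation i := (iC R).
Variable th : {linear JR -> JR}.
Hypotheses (thcp : @cp _ J J th) (th1 : th (ms_unit J) = ms_unit J)
  (thi : forall u, (th (i *: u : J) : J) = - (i *: (th u : J)))
  (thk : forall x y, th (k (x, y)) = k (x, - y))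
  (thK : forall u, th (th u) = u).

Definition is_real (u : JR) : Prop := th u = u.

Lemma is_real_submod : submod_closed (fun v => `[< is_real v >]).
Proof.
split=> [|a u v /asboolP hu /asboolP hv]; apply/asboolP; rewrite /is_real.
  exact: linear0.
by rewrite linearP hu hv.
Qed.

Lemma is_real_star u : is_real u -> is_real (ms_star u).
Proof. by move=> hu; rewrite /is_real (cp_star cjR JRop JRop thcp) hu. Qed.

Definition Rsys := subsys is_real_submod is_real_star th1.
Let incl : {linear Rsys -> JR} := subsys_val is_real_submod is_real_star th1.
Let incl_sub : subsystem incl. Proof. exact: subsys_subsystem. Qed.

Definition Ropsys : opsys (@idfun R) := OpSys (subsystem_opsys cjR incl_sub JRop).

Definition re_val (u : JR) : JR := 2^-1 *: (u + th u).
Lemma re_real u : is_real (re_val u).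
Proof. by rewrite /is_real /re_val linearZ_LR linearD thK addrC. Qed.
Lemma re_valK u : is_real u -> re_val u = u.
Proof.
move=> hu; rewrite /re_val hu.
have -> : u + u = (2 : R) *: u by rewrite scaler_nat mulr2n.
by rewrite scalerA mulVf ?scale1r // pnatr_eq0.
Qed.
Definition re (u : JR) : Ropsys := mk_subsp is_real_submod (re_real u).

Lemma re_linear : linear re.
Proof.
move=> a u v; apply: subsp_inj; rewrite /= /re_val linearP.
by rewrite addrACA -scalerDr [LHS]scalerDr !scalerA mulrC.
Qed.

Lemma re_cp : cp re.
Proof.
move=> n A hA.
have -> : mo_cone Ropsys n (map_mx re A) =
   mo_cone JR n (zmx (2^-1 : R) ((A : 'M[JR]_n) + map_mx th A)).
  by congr (mo_cone JR n); apply/matrixP => r t; rewrite !mxE.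
apply: (cone_zmx cjR JRop); first by rewrite invr_ge0.
by apply: (coneD cjR JRop) => //; exact: thcp.
Qed.

Lemma re_incl (u : Ropsys) : re (incl u) = u.
Proof. by apply: subsp_inj; rewrite /= re_valK //; exact: subspP. Qed.

(** [re] is a ucp retraction onto it from the realification of [J], which is injective. *)
Lemma Ropsys_injective : injective_opsys Ropsys.
Proof.
have [Jinj _ _] := je.
move=> E F kk phi ks [pcp p1].
have [|psi [[scp s1] sk]] := @IR_injective R J Jinj E F kk
    (mk_linear (fun a u v => linearP (incl \o phi) a u v)) ks.
  by split=> [n A /pcp|/=]; [rewrite [X in X -> _]/= -map_mx_comp | rewrite p1].
have rl : linear (fun x => re (psi x)) by move=> a u v; rewrite linearP re_linear.
exists (mk_linear rl); split; [split|].
- by move=> n A /scp /re_cp; rewrite -map_mx_comp.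
- by rewrite /= s1; apply: subsp_inj; exact: re_valK.
- by move=> x /=; rewrite sk /= re_incl.
Qed.

Lemma k_real s : is_real (k (s, 0)).
Proof. by rewrite /is_real thk oppr0. Qed.

Definition jR (s : S) : Ropsys := mk_subsp is_real_submod (k_real s).

Lemma jR_linear : linear jR.
Proof.
move=> a u v; apply: subsp_inj; rewrite /= rl_scaleE -linearP; congr (k _).
by congr pair; rewrite /= ?scaler0 ?scale0r ?subr0 ?addr0.
Qed.

Lemma jR_subsystem : subsystem (mk_linear jR_linear : {linear S -> Ropsys}).
Proof.
have [_ [ki k1 ks kc] _] := je; split.
- by move=> u v /(congr1 (@subsp_val _ _ _ _)) /ki [].
- by apply: subsp_inj; exact: k1.
- by move=> v; apply: subsp_inj; rewrite /= -ks /= /cplx_star /= (star0 cjR) oppr0.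
move=> n A; rewrite -(cplx_real_cone A Sop) kc -map_mx_comp.
have -> : mo_cone Ropsys n (map_mx (mk_linear jR_linear) A) =
  mo_cone JR n (map_mx (fun s => k (s, 0)) A) by rewrite /= -map_mx_comp.
by [].
Qed.

(** A ucp [psi] fixing [S] is composed with [re] and made complex-linear by [rhoC]. The result fixes
    the range of [k], so it is the identity by rigidity of [J]; on real elements it is [psi], since
    [re] kills their multiples by i. *)
Lemma Ropsys_envelope :
  injective_envelope (mk_linear jR_linear : {linear S -> Ropsys}).
Proof.
have [_ [_ k1 _ _] Jrig] := je.
split; [exact: Ropsys_injective | exact: jR_subsystem |].
move=> psi [pcp p1] pj.
have rl : linear (fun u : JR => incl (psi (re u))).
  by move=> a u v; rewrite re_linear !linearP.
pose rho := mk_linear rl.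
have rcp : cp rho by move=> n A /re_cp /pcp; rewrite -map_mx_comp [X in X -> _]/= -map_mx_comp.
have reI u : is_real u -> re (i *: u : J) = 0.
  move=> hu; apply: subsp_inj; rewrite /= /re_val thi hu.
  by rewrite subrr scaler0.
have reK u (hu : is_real u) : re u = mk_subsp is_real_submod hu.
  by apply: subsp_inj; exact: re_valK.
have kE x y : k (x, y) = (k (x, 0) : J) + i *: (k (y, 0) : J).
  rewrite -linearZ -linearD; congr (k _).
  by congr pair; rewrite /= ?scaler0 ?scale0r ?scale1r ?subr0 ?addr0 ?add0r.
have rhoI u : is_real u -> rho (i *: u : J) = 0.
  by move=> hu; rewrite /= reI // !linear0.
pose Psi : {linear J -> J} := mk_linear (rhoC_linear rho).
have PsiR u (hu : is_real u) : Psi u = incl (psi (mk_subsp is_real_submod hu)).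
  by rewrite /= /rhoC rhoI // scaler0 subr0 /= reK.
have Psik z : Psi (k z) = k z.
  have kx x : Psi (k (x, 0)) = k (x, 0).
    by rewrite (PsiR _ (k_real x)); exact: (congr1 (fun u => incl u) (pj x)).
  by case: z => x y; rewrite kE linearD linearZ_LR !kx.
have Psiid : forall a, Psi a = a.
  apply: Jrig => //; split; first exact: rhoC_cp.
  by rewrite (PsiR _ th1); exact: (congr1 (fun u => incl u) p1).
move=> x; apply: subsp_inj; have := Psiid (incl x).
rewrite (PsiR _ (subspP x)) /= => e; rewrite -[RHS]e; congr (subsp_val (psi _)).
exact: subsp_inj.
Qed.
End RealPart.

Section Arrays.
Variable R : realType.
Local Notation C := R[i].
Let cjC := conj_field_complex R.

Lemma arr_Re m n (g : 'I_m -> 'I_m -> 'I_n -> 'I_n -> C) :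
  arr_psd (@conjc R) g ->
  arr_psd (@idfun R) (fun a b k l => complex.Re (g a b k l)).
Proof.
move=> [h1 h2]; split=> [a b k l|x]; first by rewrite h1; case: (g b a l k).
have /complex_ge0[_] := h2 (fun a k => (x a k)%:C).
congr (0 <= _); do 3![rewrite raddf_sum; apply: eq_bigr => ? _].
rewrite raddf_sum; apply: eq_bigr => l _; rewrite conjc_real /=.
by case: (g _ _ _ _) => u v /=; rewrite !(mul0r, mulr0, subr0).
Qed.

Lemma arr_complex_of_block m n (p q : 'I_m -> 'I_m -> 'I_n -> 'I_n -> R)
    (G : 'I_(m + m) -> 'I_(m + m) -> 'I_n -> 'I_n -> R) :
  (forall i j k l,
     [/\ G (lshift m i) (lshift m j) k l = p i j k l,
         G (lshift m i) (rshift m j) k l = - q i j k l,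
         G (rshift m i) (lshift m j) k l = q i j k l &
         G (rshift m i) (rshift m j) k l = p i j k l]) ->
  arr_psd (@idfun R) G ->
  arr_psd (@conjc R) (fun i j k l => p i j k l +i* q i j k l).
Proof.
move=> GE [h1 h2].
have sym i j k l : p i j k l = p j i l k /\ q i j k l = - q j i l k.
  have [a1 a2 a3 a4] := GE i j k l; have [b1 b2 b3 b4] := GE j i l k.
  by split; [rewrite -a1 h1 /= b1 | rewrite -a3 h1 /= b2].
split=> [i j k l|x]; first by have [-> ->] := sym i j k l.
set Q := \sum_a _.
have Qc : conjc Q = Q.
  have cs := @cj_sum C (@conjc R) cjC.
  have -> : conjc Q = \sum_a \sum_b \sum_k \sum_l
      conjc (conjc (x a k) * (p a b k l +i* q a b k l) * x b l).
    rewrite /Q cs; apply: eq_bigr => a _; rewrite cs; apply: eq_bigr => b _.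
    by rewrite cs; apply: eq_bigr => k _; rewrite cs.
  rewrite exchange_big; apply: eq_bigr => i _; apply: eq_bigr => j _.
  rewrite exchange_big; apply: eq_bigr => k _; apply: eq_bigr => l _.
  have [-> ->] := sym i j k l; case: (x i k) (x j l) => u v [u' v'].
  by apply/eqP; rewrite eq_complex /=; apply/andP; split; apply/eqP; ring.
rewrite lecE (conjc_Im Qc) eqxx /=.
pose y (i : 'I_(m + m)) (k : 'I_n) : R :=
  match fintype.split i with
  | inl i => complex.Re (x i k) | inr i => complex.Im (x i k) end.
have yl i k : y (lshift m i) k = complex.Re (x i k) by rewrite /y (unsplitK (inl i)).
have yr i k : y (rshift m i) k = complex.Im (x i k) by rewrite /y (unsplitK (inr i)).
have := h2 y; congr (0 <= _); rewrite /Q raddf_sum big_split_ord /= -big_split /=.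
apply: eq_bigr => i _; rewrite raddf_sum !big_split_ord /= -!big_split /=.
apply: eq_bigr => j _; rewrite raddf_sum -!big_split /=.
apply: eq_bigr => k _; rewrite raddf_sum -!big_split /=; apply: eq_bigr => l _.
rewrite !yl !yr; have [-> -> -> ->] := GE i j k l.
case: (x i k) (x j l) => u v [u' v'] /=; ring.
Qed.
End Arrays.

Section WepDown.
Variable R : realType.
Local Notation C := R[i].
Variables (S : opsys (@idfun R)).
Let Sop := os_repr S.
Local Notation Sc := (complexification S).

Definition fc_fun (f : opdual S) (z : cplx S) : C :=
  (f : bdual _) z.1 +i* (f : bdual _) z.2.

Lemma fc_lin (f : opdual S) (a : C) (u v : cplx S) :
  fc_fun f (a *: u + v) = a * fc_fun f u + fc_fun f v.
Proof.
case: a u v => a b [x y] [x' y']; rewrite /fc_fun /= !(bdualD, bdualN, bdualZ).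
by apply/eqP; rewrite eq_complex /=; apply/andP; split; apply/eqP; ring.
Qed.

(** The factor 2 comes from bounding the modulus by the sum of the absolute values of the real and
    imaginary parts. *)
Lemma fc_norm (f : opdual S) (r : R) : 
  (forall v s, norm_le (v : S) s -> `|(f : bdual _) v| <= r * s) ->
  forall z c, norm_le (z : Sc) c -> `|fc_fun f z| <= (2 * r)%:C * c.
Proof.
move=> h [x y] c zc; have [/complex_ge0[-> c0] _] := zc.
have [/h hx /h hy] := cplx_norm_le Sop zc.
rewrite -rmorphM; apply: normc_le_sum => /=; lra.
Qed.

Lemma fc_bnd (f : opdual S) : exists M : C, forall z c, norm_le (z : Sc) c ->
  `|fc_fun f z| <= M * c.
Proof. by have [M hM] := bdual_bnd f; exists (2 * M)%:C; exact: fc_norm. Qed.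

Definition fc (f : opdual S) : opdual Sc := mk_bdual (fc_lin f) (fc_bnd f).

Lemma fcE (a : R) (f g : opdual S) : fc (a *: f + g) = a%:C *: fc f + fc g.
Proof.
apply: bdualP => -[x y]; apply/eqP; rewrite eq_complex.
by rewrite /= !(mul0r, subr0, addr0) /=; apply/andP; split; apply/eqP.
Qed.

Lemma fc_cone m (F : 'M[opdual S]_m) :
  mo_cone (opdual S) m F -> mo_cone (opdual Sc) m (map_mx fc F).
Proof.
move=> /opdual_coneP hF; apply/opdual_coneP => p Z [_ _ /hF].
set x := map_mx fst Z; set y := map_mx snd Z.
move=> /(arr_complex_of_block (p := fun i j k l => (F k l : bdual _) (x i j))
  (q := fun i j k l => (F k l : bdual _) (y i j))) h.
have {}h := h _.
suff e : (fun a b k l => (map_mx fc F k l : bdual _) (Z a b)) =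
    (fun i j k l => (F k l : bdual _) (x i j) +i* (F k l : bdual _) (y i j)).
  rewrite e; apply: h => i j k l.
  by rewrite block_mxEul block_mxEur block_mxEdl block_mxEdr !mxE bdualN.
by do 4![apply/funext => ?]; rewrite !mxE.
Qed.

Variables (J : matsys (@conjc R)) (I : matsys (@idfun R)).
Variable inc : {linear I -> realification J}.
Hypothesis inc_cp : cp inc.
Variable phi : {linear J -> bidual Sc}.
Hypothesis pcp : cp phi.

Definition phiR_fun (a : I) (f : opdual S) : R :=
  complex.Re ((phi (inc a) : bdual _) (fc f)).

Lemma phiR_lin a (c : R) f g :
  phiR_fun a (c *: f + g) = c * phiR_fun a f + phiR_fun a g.
Proof. by rewrite /phiR_fun fcE bdual_lin cReD cReM /= mul0r subr0. Qed.

Lemma phiR_bnd a : exists M : R, forall f r, dual_norm_le (f : opdual S) r ->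
  `|phiR_fun a f| <= M * r.
Proof.
have [M hM] := bdual_bnd (phi (inc a)); exists (complex.Re M * 2) => f r [r0 fr].
have /hM : dual_norm_le (fc f) (2 * r)%:C.
  by split; [rewrite lecR mulr_ge0 | exact: fc_norm].
by move=> /bnd_real /normc_Re; rewrite mulrA.
Qed.

Definition phiR (a : I) : bidual S := mk_bdual (phiR_lin a) (phiR_bnd a).

Lemma phiR_linear : linear phiR.
Proof.
move=> a u v; apply: bdualP => f.
rewrite [LHS]/= [RHS]/= /phiR_fun linearP rl_scaleE linearP.
by rewrite [LHS]/= cReD cReM /= mul0r subr0.
Qed.

Lemma phiR_cp : cp phiR.
Proof.
move=> n A /inc_cp /pcp; rewrite -map_mx_comp => /bidual_coneP h.
apply/bidual_coneP => m F /fc_cone /h /arr_Re.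
suff -> : (fun i j k l => (map_mx phiR A k l : bdual _) (F i j)) =
  (fun a b k l => complex.Re ((map_mx (phi \o inc) A k l : bdual _) (map_mx fc F a b))) by [].
by do 4![apply/funext => ?]; rewrite !mxE.
Qed.

Lemma phiR_eval s a : is_eval ((s, 0) : Sc) (phi (inc a)) -> is_eval s (phiR a).
Proof. by move=> h f; rewrite /= /phiR_fun h. Qed.
End WepDown.

Lemma complex_wep_real (R : realType) (S : opsys (@idfun R)) :
  complex_wep (complexification S) -> real_wep S.
Proof.
move=> [J [k [je [phi [pcp p1 pk]]]]].
have [th [thcp th1 thi thk thK]] := exists_conj je.
pose incl := subsys_val (is_real_submod th) (is_real_star thcp) th1.
exists (Ropsys thcp th1), (mk_linear (jR_linear thcp th1 thk)); split.
  by apply: Ropsys_envelope.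
exists (mk_linear (phiR_linear incl phi)); split.
- by apply: phiR_cp => // n A.
- exact: phiR_eval.
- by move=> s; apply: phiR_eval; exact: pk (s, 0).
Qed.

(** * Linear extension theorems *)

Section LinearGraph.
Variables (R : realType) (E F : lmodType R) (G0 : set (E * F)) (Q : E -> F -> Prop).

(** [Q] stands for the constraint on values: nonnegativity on a cone in the theorem of Riesz,
    single-valuedness in the construction of a retraction. *)
Definition linear_graph (G : set (E * F)) : Prop :=
  (forall a x y r s, G (x, r) -> G (y, s) -> G (a *: x + y, a *: r + s)) /\
  (forall x r, G (x, r) -> Q x r).

Hypotheses (G00 : G0 (0, 0)) (G0lin : linear_graph G0).
Hypothesis Quniq : forall r, Q 0 r -> Q 0 (- r) -> r = 0.
Hypothesis extend : forall G y, G0 `<=` G -> linear_graph G ->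
  exists s, forall x r t, G (x, r) -> Q (x + t *: y) (r + t *: s).

(* By Zorn: a maximal linear graph satisfying [Q] is defined everywhere. *)
Lemma linear_graph_extension : exists U : E -> F,
  [/\ forall a x y, U (a *: x + y) = a *: U x + U y,
      forall x r, G0 (x, r) -> U x = r & forall x, Q x (U x)].
Proof.
(* The condition is put on the union of [G0] with [G], so that it also holds for the empty union of
   the empty chain. *)
have [G [hG Gmax]] : exists G, linear_graph (G0 `|` G) /\
    forall G', G `<` G' -> ~ linear_graph (G0 `|` G').
  apply: (@Zorn_bigcup _ (fun G => linear_graph (G0 `|` G))) => FF Fsub Ftot.
  have pick2 p q : (G0 `|` \bigcup_(X in FF) X) p -> (G0 `|` \bigcup_(X in FF) X) q ->
      exists G, [/\ linear_graph (G0 `|` G), (G0 `|` G) p, (G0 `|` G) q &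
         G0 `|` G `<=` G0 `|` \bigcup_(X in FF) X].
    have Fg X : FF X -> linear_graph (G0 `|` X) by move=> FX; exact: Fsub.
    have sub X : FF X -> G0 `|` X `<=` G0 `|` \bigcup_(X in FF) X.
      by move=> FX z [?|?]; [left|right; exists X].
    move=> [hp|[X FX Xp]] [hq|[Y FY Yq]].
    - by exists set0; rewrite setU0; split.
    - by exists Y; split; [exact: Fg|left|right|exact: sub].
    - by exists X; split; [exact: Fg|right|left|exact: sub].
    have [XY|YX] := Ftot _ _ FX FY.
      by exists Y; split; [exact: Fg|right; exact: XY|right|exact: sub].
    by exists X; split; [exact: Fg|right|right; exact: YX|exact: sub].
  split=> [a x y r s h1 h2|x r h1].
    have [G [[g _] g1 g2 sg]] := pick2 _ _ h1 h2; apply: sg; exact: g.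
  by have [G [[_ g] g1 _ _]] := pick2 _ _ h1 h1; exact: g.
set H := G0 `|` G in hG; have [Hlin HQ] := hG.
have H0 : H (0, 0) by left.
have Htot y : exists r, H (y, r).
  have [s hs] := extend y (fun z hz => or_introl hz : H z) hG.
  pose G' := [set p | exists x r t, [/\ H (x, r), p.1 = x + t *: y & p.2 = r + t *: s]].
  have HG' : H `<=` G'.
    by move=> [x r] h; exists x, r, 0; rewrite !scale0r !addr0.
  have gG' : linear_graph (G0 `|` G').
    have -> : G0 `|` G' = G'.
      apply/seteqP; split; last by move=> z; right.
      by move=> z [hz|//]; apply: HG'; left.
    split.
      move=> a _ _ _ _ [x1 [r1 [t1 [h1 /= -> ->]]]] [x2 [r2 [t2 [h2 /= -> ->]]]].
      exists (a *: x1 + x2), (a *: r1 + r2), (a * t1 + t2); split; first exact: Hlin.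
        by rewrite /= scalerDr scalerDl scalerA addrACA.
      by rewrite /= scalerDr scalerDl scalerA addrACA.
    by move=> _ _ [x [r [t [h /= -> ->]]]]; exact: hs.
  exists s; have : G' (y, s).
    by exists 0, 0, 1; rewrite !scale1r !add0r.
  have [GG'|GG'] := pselect (G' `<=` G); first by move=> /GG'; right.
  have /Gmax /(_ gG') // : G `<` G'.
  by split=> // z Gz; apply: HG'; right.
have Huniq x r s : H (x, r) -> H (x, s) -> r = s.
  move=> h1 h2; apply/eqP; rewrite -subr_eq0; apply/eqP/Quniq.
    by have := Hlin (-1) _ _ _ _ h2 h1; rewrite !scaleN1r addNr [_ + r]addrC => /HQ.
  rewrite opprB; have := Hlin (-1) _ _ _ _ h1 h2.
  by rewrite !scaleN1r addNr [_ + s]addrC => /HQ.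
have [U HU] := choice Htot; exists U; split.
- by move=> a x y; apply: (Huniq _ _ _ (HU _)); apply: Hlin.
- by move=> x r xr; apply: (Huniq _ _ _ (HU _)); left.
- by move=> x; exact: HQ.
Qed.
End LinearGraph.

Section Riesz.
Variables (R : realType) (E : lmodType R) (C L : E -> Prop) (u : E -> R).
Hypotheses (C0 : C 0) (CD : forall x y, C x -> C y -> C (x + y))
  (CZ : forall a x, 0 <= a -> C x -> C (a *: x)).
Hypotheses (L0 : L 0) (Llin : forall a x y, L x -> L y -> L (a *: x + y)).
Hypothesis ulin : forall a x y, L x -> L y -> u (a *: x + y) = a * u x + u y.
Hypothesis upos : forall x, L x -> C x -> 0 <= u x.
Hypothesis cofinal : forall y, exists2 l, L l & C (l - y).

Lemma riesz_extension : exists U : E -> R,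
  [/\ forall a x y, U (a *: x + y) = a * U x + U y,
      forall x, L x -> U x = u x & forall x, C x -> 0 <= U x].
Proof.
have u0 : u 0 = 0.
  have := ulin 1 L0 L0; rewrite scale1r addr0 mul1r => /eqP.
  by rewrite -subr_eq subrr eq_sym => /eqP.
pose gu : set (E * R^o) := [set p | L p.1 /\ p.2 = u p.1].
have [||||U [Ul Uu UC]] := @linear_graph_extension R E R^o gu
    (fun x r => C x -> (0 : R) <= r).
- by split.
- split=> [a x y r s [/= hx ->] [/= hy ->]|x r [/= hx ->]]; last exact: upos.
  by split; [exact: Llin | rewrite ulin].
- move=> r /(_ C0) r0 /(_ C0); rewrite oppr_ge0 => r1.
  by apply/eqP; rewrite eq_le r0 r1.
- move=> H y guH [Hlin Hpos].
  have H0 : H (0, 0) by apply: guH; split.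
  have Hscale a x r : H (x, r) -> H (a *: x, a *: r).
    by move=> h; have := Hlin a _ _ _ _ h H0; rewrite !addr0.
  have Hsub x z r s : H (x, r) -> H (z, s) -> H (x - z, r - s).
    move=> hx hz; have := Hlin (-1) _ _ _ _ hz hx.
    by rewrite !scaleN1r addrC [X in (_, X)]addrC.
  (* The values of the graph at elements below [y]. [cofinal] at [y] bounds this set, [cofinal] at
     [- y] makes it inhabited, and its supremum is an admissible value at [y]. *)
  pose A : set R := [set a | exists2 l, H (l, a) & C (y - l)].
  have Aup l (b : R) : H (l, b) -> C (l - y) -> ubound A b.
    move=> hb Cl a [l' ha Cl']; rewrite -subr_ge0; apply: (Hpos (l - l')).
      exact: Hsub.
    by have := CD Cl Cl'; rewrite addrA subrK.
  have [lu Llu Clu] := cofinal y; have [ll Lll Cll] := cofinal (- y).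
  have Hlu : H (lu, u lu) by apply: guH.
  have Hll : H (ll, u ll) by apply: guH.
  have supA : has_sup A.
    split; last by exists (u lu); exact: Aup Clu.
    exists (- u ll), (- ll); last by move: Cll; rewrite !opprK addrC.
    by have := Hscale (-1) _ _ Hll; rewrite !scaleN1r.
  exists (sup A) => x r t h Cx; rewrite /GRing.scale /=; set s := sup A.
  have [t0|t0|t0] := ltgtP t 0.
  - have h' : ubound A ((- t)^-1 * r).
      apply: (Aup ((- t)^-1 *: x)); first exact: Hscale.
      have t0' : 0 <= (- t)^-1 by rewrite invr_ge0 oppr_ge0 ltW.
      have := CZ t0' Cx; rewrite scalerDr scalerA invrN mulNr mulVf ?lt_eqF //.
      by rewrite scaleN1r.
    have : s <= (- t)^-1 * r by apply: ge_sup => //; case: supA.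
    rewrite ler_pdivlMl ?oppr_gt0 // mulNr.
    by rewrite -subr_ge0 opprK.
  - have : - (t^-1 * r) <= s.
      apply: sup_upper_bound => //.
      exists (- (t^-1 *: x)); last first.
        have t0' : 0 <= t^-1 by rewrite invr_ge0 ltW.
        have := CZ t0' Cx; rewrite scalerDr scalerA mulVf ?gt_eqF // scale1r.
        by rewrite opprK addrC.
      by have := Hscale (- t^-1) _ _ h; rewrite !scaleNr.
    rewrite lerNl -(ler_pM2l t0) mulrA mulfV ?gt_eqF // mul1r mulrN.
    by rewrite -subr_ge0 opprK.
  - by move: Cx; rewrite t0 scale0r mul0r !addr0; exact: Hpos.
by exists U; split=> // x Lx; apply: Uu; split.
Qed.
End Riesz.

(** The inverse of [j] on its range, extended linearly. It provides bilinear forms and functionals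
    on larger spaces from those on smaller ones. *)
Lemma linear_retraction (R : realType) (V W : lmodType R) (j : {linear V -> W}) :
  injective j -> exists r : {linear W -> V}, forall v, r (j v) = v.
Proof.
move=> ji.
have [||||U [Ul Uj _]] := @linear_graph_extension R W V
   [set p | p.1 = j p.2] (fun x r => x = 0 -> r = 0).
- by rewrite /= linear0.
- split=> [a x y r s /= -> ->|x r /= ->]; first by rewrite linearP.
  by rewrite -(linear0 j) => /ji.
- by move=> r h _; exact: h.
- move=> H y guH [Hlin Huniq].
  have H0 : H (0, 0) by apply: guH; rewrite /= linear0.
  have [[s hs]|ns] := pselect (exists s, H (y, s)).
    exists s => x r t h; apply: Huniq.
    by rewrite addrC [r + _]addrC; exact: Hlin.
  (* A vector outside the domain may get any value: a relation [x + t *: y = 0] with [t] nonzero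
     would put [y] in the domain. *)
  exists 0 => x r t h e; rewrite scaler0 addr0.
  have [t0|t0] := eqVneq t 0.
    by move: e; rewrite t0 scale0r addr0; exact: Huniq.
  exfalso; apply: ns; exists (- t^-1 *: r).
  have -> : y = - t^-1 *: x.
    have -> : x = - (t *: y) by apply/eqP; rewrite -addr_eq0 e.
    by rewrite scaleNr scalerN opprK scalerA mulVf // scale1r.
  by have := Hlin (- t^-1) _ _ _ _ h H0; rewrite !addr0.
have rl : linear U by [].
by exists (mk_linear rl) => v; apply: Uj.
Qed.

(** * The maximal tensor product *)

Section TensorBasics.
Variables (K : numFieldType) (V W : lmodType K).

Lemma tensorP (t u : tensor V W) : (forall b, t b = u b) -> t = u.
Proof. by move=> h; apply: val_inj; apply/funext. Qed.
Lemma tensor_addE (t u : tensor V W) b : (t + u) b = t b + u b.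
Proof. by []. Qed.
Lemma tensor_scaleE a (t : tensor V W) b : (a *: t) b = a * t b.
Proof. by []. Qed.
Lemma tensor_linear a (t u : tensor V W) b : (a *: t + u) b = a * t b + u b.
Proof. by []. Qed.
Lemma tensor_sumE I (r : seq I) (P : pred I) (F : I -> tensor V W) b :
  (\sum_(i <- r | P i) F i) b = \sum_(i <- r | P i) F i b.
Proof. exact: (big_morph (fun t : tensor V W => t b : K)). Qed.

Lemma pureDl v v' w : pure (v + v') w = pure v w + pure v' w :> tensor V W.
Proof. by apply: tensorP => b; rewrite tensor_addE /= linearDl. Qed.
Lemma pureDr v w w' : pure v (w + w') = pure v w + pure v w' :> tensor V W.
Proof. by apply: tensorP => b; rewrite tensor_addE /= linearDr. Qed.
Lemma pureZl a v w : pure (a *: v) w = a *: pure v w :> tensor V W.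
Proof. by apply: tensorP => b; rewrite tensor_scaleE /= linearZl_LR. Qed.
Lemma pureZr a v w : pure v (a *: w) = a *: pure v w :> tensor V W.
Proof. by apply: tensorP => b; rewrite tensor_scaleE /= linearZr_LR. Qed.

Lemma tensor_span_pure (t : tensor V W) :
  exists s : seq (V * W), t = \sum_(p <- s) pure p.1 p.2.
Proof.
case: t => t tP; have /asboolP[s ts] := tP; exists s.
by apply: tensorP => b; rewrite tensor_sumE /= ts.
Qed.

Definition mk_bilinear (f : V -> W -> K)
  (hl : forall w a v v', f (a *: v + v') w = a * f v w + f v' w)
  (hr : forall v a w w', f v (a *: w + w') = a * f v w + f v w') :
  {bilinear V -> W -> K^o} :=
  HB.pack (f : V -> W -> K^o)
    (bilinear_isBilinear.Build K V W K^o *:%R *:%R (f : V -> W -> K^o) (hl, hr)).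
End TensorBasics.

Section TmapLinear.
Variables (K : numFieldType) (V V' W W' : lmodType K).
Variables (j : {linear V -> V'}) (k : {linear W -> W'}).
Lemma tmap_linear : linear (tmap j k).
Proof. by move=> a t u; apply: tensorP. Qed.
Lemma tmapD t u : tmap j k (t + u) = tmap j k t + tmap j k u.
Proof. by apply: tensorP. Qed.
Lemma tmapZ a t : tmap j k (a *: t) = a *: tmap j k t.
Proof. by apply: tensorP. Qed.
Lemma tmap0 : tmap j k 0 = 0.
Proof. by apply: tensorP. Qed.
Lemma tmap_sum I (r : seq I) (P : pred I) (F : I -> tensor V W) :
  tmap j k (\sum_(i <- r | P i) F i) = \sum_(i <- r | P i) tmap j k (F i).
Proof. exact: (big_morph _ tmapD tmap0). Qed.
End TmapLinear.

(** Tensors are functions on bilinear forms, and retractions of [j] and [k] exhibit every form on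
    [V] and [W] as the pullback of one on [V'] and [W']. *)
Lemma tmap_inj (R : realType) (V V' W W' : lmodType R) (j : {linear V -> V'})
    (k : {linear W -> W'}) : injective j -> injective k -> injective (tmap j k).
Proof.
move=> /linear_retraction[r rj] /linear_retraction[q qk] t u tu.
apply: tensorP => b.
have bl w a v v' : b (r (a *: v + v')) (q w) = a * b (r v) (q w) + b (r v') (q w).
  by rewrite linearP linearPl.
have br v a w w' : b (r v) (q (a *: w + w')) = a * b (r v) (q w) + b (r v) (q w').
  by rewrite linearP linearPr.
pose b' : {bilinear V' -> W' -> R^o} := mk_bilinear bl br.
have tE (z : tensor V W) : (tmap j k z) b' = z b.
  have [s ->] := tensor_span_pure z.
  rewrite tmap_sum !tensor_sumE; apply: eq_bigr => p _.
  by rewrite tmap_pure /= rj qk.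
by rewrite -!tE tu.
Qed.

Section OrdSum.
Variables (k : nat) (N : 'I_k -> nat).

Lemma sum_ordsum (U : nmodType) (F : 'I_(\sum_i N i) -> U) :
  \sum_I F I = \sum_i \sum_(s < N i) F (tagnat.Rank i s).
Proof.
rewrite sig_big_dep (reindex _ tagnat.sig_bij_on) /=.
by apply: eq_bigr => I _; rewrite -/(tagnat.sig1 _) -/(tagnat.sig2 _) tagnat.sig2K.
Qed.

Lemma mxdiag_Rank (U : nmodType) (X : forall i, 'M[U]_(N i)) i s t :
  (\mxdiag_i X i) (tagnat.Rank i s) (tagnat.Rank i t) = X i s t.
Proof. by have /matrixP/(_ s t) := submxblock_diag X i; rewrite !mxE. Qed.

Lemma mxdiag_Rank0 (U : nmodType) (X : forall i, 'M[U]_(N i)) i j s t :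
  i != j -> (\mxdiag_i X i) (tagnat.Rank i s) (tagnat.Rank j t) = 0.
Proof.
move=> /negPf ij.
have /matrixP/(_ s t) := mxblockK (fun i j : 'I_k =>
  if i == j then conform_mx 0 (X i) else 0 : 'M[U]_(N i, N j)) i j.
by rewrite ij !mxE.
Qed.
End OrdSum.

Section Compress.
Variables (R : realType) (U : lmodType R).

Lemma compress_mxdiag k (N : 'I_k -> nat) n (al : 'M[R]_(\sum_i N i, n))
    (X : forall i, 'M[U]_(N i)) :
  compress al (\mxdiag_i X i) = \sum_i compress (submxcol al i) (X i).
Proof.
apply/matrixP => r s; rewrite summxE mxE sum_ordsum; apply: eq_bigr => i _.
rewrite mxE; apply: eq_bigr => a _; rewrite sum_ordsum (bigD1 i) //=.
rewrite [X in _ + X]big1 ?addr0 => [|j ji].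
  by apply: eq_bigr => b _; rewrite mxdiag_Rank !mxE.
by apply: big1 => b _; rewrite mxdiag_Rank0 ?scaler0 // eq_sym.
Qed.
End Compress.

Section Gen.
Variable R : realType.
Local Notation msR := (matsys (@idfun R)).

Section Def.
Variables (V W : msR) (n : nat).

(* The cone whose Archimedean closure is the maximal cone. *)
Inductive gen : 'M[tensor V W]_n -> Prop :=
| gen0 : gen 0
| genS p q (A : 'M[V]_p) (B : 'M[W]_q) (al : 'M[R]_(p * q, n)) x :
    mo_cone V p A -> mo_cone W q B -> gen x ->
    gen (compress al (kron A B) + x).

Lemma gen_add x y : gen x -> gen y -> gen (x + y).
Proof.
move=> gx gy; elim: gx => [|p q A B al x' hA hB _ IH]; first by rewrite add0r.
by rewrite -addrA; apply: genS.
Qed.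

Lemma gen1 p q (A : 'M[V]_p) (B : 'M[W]_q) (al : 'M[R]_(p * q, n)) :
  mo_cone V p A -> mo_cone W q B -> gen (compress al (kron A B)).
Proof. by move=> hA hB; rewrite -[compress _ _]addr0; apply: genS => //; exact: gen0. Qed.

Lemma gen_sum I (r : seq I) (P : pred I) (F : I -> 'M[tensor V W]_n) :
  (forall i, P i -> gen (F i)) -> gen (\sum_(i <- r | P i) F i).
Proof. by move=> h; apply: big_ind => //; [exact: gen0|exact: gen_add]. Qed.

Record item := Item {
  ip : nat; iq : nat; iA : 'M[V]_ip; iB : 'M[W]_iq; ial : 'M[R]_(ip * iq, n);
  _ : mo_cone V ip iA; _ : mo_cone W iq iB }.

Lemma gen_items x : gen x -> exists s : seq item,
  x = \sum_(t <- s) compress (ial t) (kron (iA t) (iB t)).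
Proof.
elim=> [|p q A B al x' hA hB _ [s ->]]; first by exists [::]; rewrite big_nil.
by exists (Item al hA hB :: s); rewrite big_cons.
Qed.

(** The inductive presentation replaces the block diagonal matrix of dependent sizes by a sum of
    compressions, on which one can argue by induction. *)
Lemma genP x : gen x <->
  exists (k : nat) (p q : 'I_k -> nat)
         (A : forall i, 'M[V]_(p i)) (B : forall i, 'M[W]_(q i))
         (alpha : 'M[R]_(\sum_i (p i * q i)%N, n)),
    [/\ forall i, mo_cone V (p i) (A i), forall i, mo_cone W (q i) (B i)
      & x = compress alpha (\mxdiag_i kron (A i) (B i))].
Proof.
split=> [/gen_items[s ->]|[k [p [q [A [B [al [hA hB ->]]]]]]]]; last first.
  by rewrite compress_mxdiag; apply: gen_sum => i _; apply: gen1.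
exists (size s), (fun i => ip (tnth (in_tuple s) i)),
  (fun i => iq (tnth (in_tuple s) i)),
  (fun i => iA (tnth (in_tuple s) i)), (fun i => iB (tnth (in_tuple s) i)),
  (\mxcol_i ial (tnth (in_tuple s) i)); split.
- by move=> i; case: (tnth _ i).
- by move=> i; case: (tnth _ i).
rewrite compress_mxdiag big_tnth; apply: eq_bigr => i _.
by rewrite mxcolK.
Qed.

Lemma max_coneP (x : 'M[tensor V W]_n) : max_cone x <->
  tensor_mxstar x = x /\ forall e : R, 0 < e ->
    gen (x + diag_const n (e *: pure (ms_unit V) (ms_unit W))).
Proof. by split=> -[h1 h2]; split=> // e /h2 /genP. Qed.
End Def.

Section CompressFacts.
Variables (U : lmodType R) (N n : nat).
Lemma compressD (al : 'M[R]_(N, n)) (X Y : 'M[U]_N) :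
  compress al (X + Y) = compress al X + compress al Y.
Proof.
apply/matrixP => r s; rewrite !mxE -big_split; apply: eq_bigr => i _.
rewrite -big_split; apply: eq_bigr => j _; by rewrite !mxE scalerDr.
Qed.
Lemma compress0 (al : 'M[R]_(N, n)) : compress al (0 : 'M[U]_N) = 0.
Proof.
apply/matrixP => r s; rewrite !mxE big1 // => i _; rewrite big1 // => j _.
by rewrite mxE scaler0.
Qed.
Lemma compress_compress m (al : 'M[R]_(N, n)) (be : 'M[R]_(n, m)) (X : 'M[U]_N) :
  compress be (compress al X) = compress (al *m be) X.
Proof.
apply/matrixP => r s; rewrite !mxE.
transitivity (\sum_(a < n) \sum_(b < n) \sum_i \sum_j
    (be a r * be b s * (al i a * al j b)) *: X i j).
  apply: eq_bigr => a _; apply: eq_bigr => b _; rewrite mxE scaler_sumr.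
  by apply: eq_bigr => i _; rewrite scaler_sumr; apply: eq_bigr => j _; rewrite scalerA.
transitivity (\sum_i \sum_j \sum_(a < n) \sum_(b < n)
    (be a r * be b s * (al i a * al j b)) *: X i j).
  under eq_bigr do rewrite exchange_big /=.
  rewrite exchange_big; apply: eq_bigr => i _ /=.
  under eq_bigr do rewrite exchange_big /=.
  by rewrite exchange_big.
apply: eq_bigr => i _; apply: eq_bigr => j _.
rewrite !mxE mulr_suml scaler_suml; apply: eq_bigr => a _.
rewrite mulr_sumr scaler_suml; apply: eq_bigr => b _; congr (_ *: _); ring.
Qed.
Lemma map_compress (U' : lmodType R) (f : U -> U') (fl : linear f)
    (al : 'M[R]_(N, n)) (X : 'M[U]_N) :
  map_mx f (compress al X) = compress al (map_mx f X).
Proof.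
pose g := mk_linear fl; apply/matrixP => r s; rewrite !mxE.
rewrite [f _](linear_sum g); apply: eq_bigr => i _; rewrite [g _](linear_sum g).
by apply: eq_bigr => j _; rewrite mxE [g _](linearZ_LR g).
Qed.
End CompressFacts.

Lemma gen_compress (V W : msR) n m (be : 'M[R]_(n, m)) (x : 'M[tensor V W]_n) :
  gen x -> gen (compress be x).
Proof.
elim=> [|p q A B al x' hA hB _ IH]; first by rewrite compress0; exact: gen0.
by rewrite compressD compress_compress; apply: genS.
Qed.

Lemma map_kron (V V' W W' : lmodType R) (j : {linear V -> V'}) (k : {linear W -> W'})
    p q (A : 'M[V]_p) (B : 'M[W]_q) :
  map_mx (tmap j k) (kron A B) = kron (map_mx j A) (map_mx k B).
Proof. by apply/matrixP => a b; rewrite !mxE tmap_pure. Qed.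

Lemma map_diag_const (U U' : lmodType R) (f : U -> U') n u :
  f 0 = 0 -> map_mx f (diag_const n u) = diag_const n (f u).
Proof. by move=> f0; apply/matrixP => a b; rewrite !mxE; case: eqP. Qed.

Lemma gen_map (V V' W W' : msR) (j : {linear V -> V'}) (k : {linear W -> W'}) n
    (x : 'M[tensor V W]_n) :
  cp j -> cp k -> gen x -> gen (map_mx (tmap j k) x : 'M[tensor V' W']_n).
Proof.
move=> jcp kcp; elim=> [|p q A B al x' hA hB _ IH].
  rewrite (_ : map_mx _ _ = 0); first exact: gen0.
  by apply/matrixP => a b; rewrite !mxE tmap0.
rewrite (_ : map_mx _ _ = compress al (kron (map_mx j A) (map_mx k B)) +
   map_mx (tmap j k) x').
  by apply: genS => //; [exact: jcp | exact: kcp].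
rewrite -map_kron -map_compress ?map_mxD //; last exact: tmap_linear.
by apply/matrixP => a b; rewrite !mxE tmapD.
Qed.

Lemma tmap_comp (V V' V'' W W' W'' : lmodType R) (j : {linear V -> V'})
    (k : {linear W -> W'}) (j' : {linear V' -> V''}) (k' : {linear W' -> W''})
    (j2 : {linear V -> V''}) (k2 : {linear W -> W''}) t :
  (forall v, j' (j v) = j2 v) -> (forall w, k' (k w) = k2 w) ->
  tmap j' k' (tmap j k t) = tmap j2 k2 t.
Proof.
move=> hj hk; have [s ->] := tensor_span_pure t.
rewrite !tmap_sum; apply: eq_bigr => p _; rewrite !tmap_pure.
by rewrite hj hk.
Qed.

Lemma tensor_mxstar_map (V V' W W' : msR) (j : {linear V -> V'})
    (k : {linear W -> W'}) n (x : 'M[tensor V W]_n) :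
  (forall v, j (ms_star v) = ms_star (j v)) ->
  (forall w, k (ms_star w) = ms_star (k w)) ->
  tensor_mxstar (map_mx (tmap j k) x : 'M[tensor V' W']_n) =
  map_mx (tmap j k) (tensor_mxstar x).
Proof.
move=> hj hk; apply/matrixP => a b; rewrite !mxE.
have [s ->] := tensor_span_pure (x b a).
rewrite !tmap_sum; apply: eq_bigr => p _; rewrite !tmap_pure.
by rewrite /= hj hk.
Qed.

Lemma max_cone_map (V V' W W' : msR) (j : {linear V -> V'})
    (k : {linear W -> W'}) n (x : 'M[tensor V W]_n) :
  (forall v, j (ms_star v) = ms_star (j v)) ->
  (forall w, k (ms_star w) = ms_star (k w)) -> cp j -> cp k ->
  j (ms_unit V) = ms_unit V' -> k (ms_unit W) = ms_unit W' ->
  max_cone x -> max_cone (map_mx (tmap j k) x : 'M[tensor V' W']_n).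
Proof.
move=> js ks jcp kcp j1 k1 /max_coneP[xs hx]; apply/max_coneP; split.
  by rewrite tensor_mxstar_map // xs.
move=> e /hx /(gen_map jcp kcp).
rewrite (_ : map_mx _ _ = map_mx (tmap j k) x +
  diag_const n (e *: pure (ms_unit V') (ms_unit W'))) //.
rewrite -j1 -k1 -tmap_pure -tmapZ -(map_diag_const n (e *: pure (ms_unit V) (ms_unit W)) (tmap0 j k)).
by apply/matrixP => a b; rewrite !mxE tmapD.
Qed.
End Gen.

(** * Separation from a cone with order unit *)

Section OrderUnit.
Variables (R : realType) (E : lmodType R) (C : E -> Prop) (e : E).
Hypotheses (C0 : C 0) (CD : forall x y, C x -> C y -> C (x + y))
  (CZ : forall a x, 0 <= a -> C x -> C (a *: x)) (Ce : C e)
  (Cu : forall y, exists r, C (r *: e - y)).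

Lemma order_unit_separation x0 : ~ C x0 -> exists U : E -> R,
  [/\ forall a x y, U (a *: x + y) = a * U x + U y,
      forall x, C x -> 0 <= U x, U e = 1 & U x0 <= 0].
Proof.
move=> nC.
(* The cone generated by [C] and [- x0]. It does not contain [- e], for otherwise [x0] would lie in
   [C]; so the functional [a *: e |-> a] is nonnegative on it and extends. *)
pose C1 y := exists2 t, 0 <= t & C (y + t *: x0).
have C1sub y : C y -> C1 y by exists 0 => //; rewrite scale0r addr0.
have nC1 : ~ C1 (- e).
  move=> [t t0 h]; apply: nC.
  have [t00|tn0] := eqVneq t 0.
    move: h; rewrite t00 scale0r addr0 => h.
    have [r hr] := Cu (- x0).
    have {}hr : C (Num.max r 0 *: e + x0).
      have -> : Num.max r 0 *: e + x0 = (Num.max r 0 - r) *: e + (r *: e - - x0).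
        by rewrite opprK addrA -scalerDl subrK.
      by apply: CD => //; apply: CZ => //; rewrite subr_ge0 le_max lexx.
    have h' : C (Num.max r 0 *: - e) by apply: CZ => //; rewrite le_max lexx orbT.
    by have := CD hr h'; rewrite scalerN addrAC subrr add0r.
  have := CD h Ce; rewrite addrAC addNr add0r => h1.
  have t1 : 0 <= t^-1 by rewrite invr_ge0.
  by have := CZ t1 h1; rewrite scalerA mulVf // scale1r.
have e0 : e != 0.
  by apply/eqP => e0; apply: nC1; rewrite e0 oppr0; exact: C1sub.
pose u y := xget 0 [set a | y = a *: e].
have uE a : u (a *: e) = a.
  rewrite /u; case: xgetP => [b _ /= /eqP|/= h]; last by case: (h a).
  by rewrite -subr_eq0 -scalerBl scaler_eq0 (negPf e0) orbF subr_eq0 => /eqP.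
have [||||||||U [Ul Ue UC]] := @riesz_extension R E C1 (fun y => exists a, y = a *: e) u.
- exact: C1sub.
- move=> x y [t t0 hx] [s s0 hy]; exists (t + s); first exact: addr_ge0.
  by rewrite scalerDl addrACA; apply: CD.
- move=> c x c0; case=> t t0 hx; exists (c * t); first exact: mulr_ge0.
  by rewrite -scalerA -scalerDr; apply: CZ.
- by exists 0; rewrite scale0r.
- by move=> k _ _ [b ->] [c ->]; exists (k * b + c); rewrite scalerDl scalerA.
- by move=> k _ _ [b ->] [c ->]; rewrite scalerA -scalerDl !uE.
- move=> _ [k ->]; rewrite uE => -[t t0 h]; rewrite leNgt; apply/negP => k0.
  apply: nC1; exists ((- k)^-1 * t).
    by rewrite mulr_ge0 // invr_ge0 oppr_ge0 ltW.
  have a1 : 0 <= (- k)^-1 by rewrite invr_ge0 oppr_ge0 ltW.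
  have := CZ a1 h; rewrite scalerDr !scalerA invrN mulNr mulVf ?lt_eqF //.
  by rewrite scaleN1r.
- move=> y; have [r hr] := Cu y; exists (r *: e); first by exists r.
  exact: C1sub.
exists U; split=> //.
- by move=> x /C1sub /UC.
- by rewrite Ue; [rewrite -[e in LHS]scale1r uE | exists 1; rewrite scale1r].
have : 0 <= U (- x0).
  by apply: UC; exists 1 => //; rewrite scale1r addNr.
have U0 : U 0 = 0.
  by have := Ul 1 0 0; rewrite scale1r addr0 mul1r => /eqP; rewrite -subr_eq subrr eq_sym => /eqP.
by have := Ul (-1) x0 0; rewrite scaleN1r addr0 U0 addr0 mulN1r => ->; rewrite oppr_ge0.
Qed.
End OrderUnit.

Section MxLmod.
Variables (R : realType) (U : lmodType R) (n : nat).
(** Matrices over a module as a module over [R], the form in which the separation theorem is applied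
    to them. *)
Definition mxl : Type := 'M[U]_n.
HB.instance Definition _ := GRing.Zmodule.on mxl.
Definition mxl_scale (a : R) (A : mxl) : mxl := map_mx (fun v => a *: v) (A : 'M[U]_n).
Fact mxl_scaleA a b v : mxl_scale a (mxl_scale b v) = mxl_scale (a * b) v.
Proof. by apply/matrixP => i j; rewrite !mxE scalerA. Qed.
Fact mxl_scale1 : left_id 1 mxl_scale.
Proof. by move=> v; apply/matrixP => i j; rewrite !mxE scale1r. Qed.
Fact mxl_scaleDr : right_distributive mxl_scale +%R.
Proof. by move=> a u v; apply/matrixP => i j; rewrite !mxE scalerDr. Qed.
Fact mxl_scaleDl v : {morph mxl_scale^~ v : a b / a + b}.
Proof. by move=> a b; apply/matrixP => i j; rewrite !mxE scalerDl. Qed.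
HB.instance Definition _ := GRing.Zmodule_isLmodule.Build R mxl
  mxl_scaleA mxl_scale1 mxl_scaleDr mxl_scaleDl.

Lemma mxl_scaleE (a : R) (A : mxl) i j : (a *: A) i j = a *: A i j.
Proof. by rewrite [LHS]mxE. Qed.

Definition unit_mx (i j : 'I_n) (u : U) : 'M[U]_n :=
  \matrix_(r, s) (if (r == i) && (s == j) then u else 0).

Lemma unit_mx_linear i j : linear (unit_mx i j : U -> mxl).
Proof.
move=> a u v; apply/matrixP => r s; rewrite !mxE.
by case: ifP => _; rewrite ?scaler0 ?addr0.
Qed.

Lemma sum_unit_mx (X : 'M[U]_n) : X = \sum_i \sum_j unit_mx i j (X i j).
Proof.
apply/matrixP => r s; rewrite summxE (bigD1 r) //= summxE (bigD1 s) //= mxE !eqxx.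
rewrite big1 => [|j /negPf js]; last by rewrite mxE eq_sym js andbF.
rewrite addr0 big1 ?addr0 // => i /negPf ir; rewrite summxE big1 // => j _.
by rewrite mxE eq_sym ir.
Qed.

Lemma unit_mx_diag_const (u : U) : diag_const n u = \sum_i unit_mx i i u.
Proof.
rewrite [LHS]sum_unit_mx; apply: eq_bigr => i _; rewrite (bigD1 i) //= mxE eqxx.
rewrite big1 ?addr0 // => j /negPf ji; apply/matrixP => r s.
by rewrite !mxE [i == j]eq_sym ji; case: ifP.
Qed.
End MxLmod.

Lemma unit_mxE (R : realType) (U : lmodType R) n (i j r s : 'I_n) (u : U) :
  (if (r == i) && (s == j) then u else 0) = ((r == i)%:R * (s == j)%:R) *: u.
Proof.
by case: (r == i); case: (s == j); rewrite ?mul0r ?mulr0 ?mul1r ?scale0r ?scale1r.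
Qed.

Section GenBound.
Variable R : realType.
Local Notation msR := (matsys (@idfun R)).
Let cjR := conj_field_real R.

Section Two.
Variables (V W : msR) (n : nat).

Lemma kron_pick (a v v' a2 : V) (b w w' b2 : W) :
  mxsub (fun i : 'I_(1 + 1) => mxtens_index (i, i))
        (fun i : 'I_(1 + 1) => mxtens_index (i, i))
        (kron (blk2 a v v' a2) (blk2 b w w' b2)) =
  blk2 (pure a b) (pure v w) (pure v' w') (pure a2 b2).
Proof.
by apply: matrix2P; rewrite mxE [kron _ _ _ _]mxE !mxtens_indexK /blk2 /=
  !(block_mxEul, block_mxEur, block_mxEdl, block_mxEdr) !mxE.
Qed.

Lemma compress_blk2 (U : lmodType R) (x y z w : U) (be : 'M[R]_(1 + 1, n)) r s :
  compress be (blk2 x y z w) r s =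
  (be (lshift 1 0) r * be (lshift 1 0) s) *: x
  + (be (lshift 1 0) r * be (rshift 1 0) s) *: y
  + ((be (rshift 1 0) r * be (lshift 1 0) s) *: z
  + (be (rshift 1 0) r * be (rshift 1 0) s) *: w).
Proof.
rewrite mxE big_split_ord /= !big_ord1 !big_split_ord /= !big_ord1.
by rewrite !(block_mxEul, block_mxEur, block_mxEdl, block_mxEdr) !mxE.
Qed.

(** The Kronecker product of the two 2x2 matrices contains the entrywise product
    [[[a (x) b, v (x) w], [v' (x) w', a2 (x) b2]]] as a compression. A further compression with rows
    at [i] and, with a minus sign, at [j] bounds the off-diagonal tensors by the diagonal ones. *)
Lemma gen_bound (a v v' a2 : V) (b w w' b2 : W) (i j : 'I_n) :
  mo_cone V (1 + 1) (blk2 a v v' a2) -> mo_cone W (1 + 1) (blk2 b w w' b2) ->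
  gen (unit_mx i i (pure a b) + unit_mx j j (pure a2 b2)
       - (unit_mx i j (pure v w) + unit_mx j i (pure v' w'))).
Proof.
move=> hA hB.
pose P : 'M[R]_((1 + 1) * (1 + 1), 1 + 1) :=
  \matrix_(I, r) (I == mxtens_index (r, r))%:R.
pose be : 'M[R]_(1 + 1, n) :=
  \matrix_(r, s) (if r == lshift 1 0 then (s == i)%:R else - (s == j)%:R).
have := gen_compress be (gen1 P hA hB).
have -> : compress P (kron (blk2 a v v' a2) (blk2 b w w' b2)) =
    mxsub (fun i : 'I_(1 + 1) => mxtens_index (i, i))
        (fun i : 'I_(1 + 1) => mxtens_index (i, i))
        (kron (blk2 a v v' a2) (blk2 b w w' b2)).
  exact: (ccompress_mxsub cjR).
rewrite kron_pick; congr gen; apply/matrixP => r s; rewrite compress_blk2.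
rewrite !mxE /= !unit_mxE !(mulrN, mulNr) opprK !scaleNr.
by rewrite [X in _ + X]addrC addrACA -opprD.
Qed.
End Two.

Section Star.
Variables (V W : msR) (n : nat).
Local Notation st := (tmap (@ms_star R _ V) (@ms_star R _ W)).

Lemma tensor_mxstarD (x y : 'M[tensor V W]_n) :
  tensor_mxstar (x + y) = tensor_mxstar x + tensor_mxstar y.
Proof. by apply/matrixP => i j; rewrite !mxE tmapD. Qed.
Lemma tensor_mxstarZ (a : R) (x : mxl (tensor V W) n) :
  tensor_mxstar (a *: x) = a *: (tensor_mxstar x : mxl _ _).
Proof. by apply/matrixP => i j; rewrite !mxE tmapZ. Qed.
Lemma tensor_mxstar0 : tensor_mxstar (0 : 'M[tensor V W]_n) = 0.
Proof. by apply/matrixP => i j; rewrite !mxE tmap0. Qed.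
Lemma tensor_mxstarN (x : 'M[tensor V W]_n) : tensor_mxstar (- x) = - tensor_mxstar x.
Proof.
by apply: (addrI (tensor_mxstar x)); rewrite -tensor_mxstarD !subrr tensor_mxstar0.
Qed.
Lemma tmap_starK (t : tensor V W) : st (st t) = t.
Proof.
have [s ->] := tensor_span_pure t; rewrite !tmap_sum.
by apply: eq_bigr => p _; rewrite !tmap_pure /= !ms_starK.
Qed.
Lemma tensor_mxstarK (x : 'M[tensor V W]_n) : tensor_mxstar (tensor_mxstar x) = x.
Proof. by apply/matrixP => i j; rewrite !mxE tmap_starK. Qed.
Lemma tensor_mxstar_unit_mx i j (u : tensor V W) :
  tensor_mxstar (unit_mx i j u : 'M[tensor V W]_n) = unit_mx j i (st u).
Proof.
by apply/matrixP => r s; rewrite !mxE andbC; case: ifP => // _; rewrite tmap0.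
Qed.
Lemma tensor_mxstar_compress N (al : 'M[R]_(N, n)) (X : 'M[tensor V W]_N) :
  tensor_mxstar (compress al X) = compress al (tensor_mxstar X).
Proof.
apply/matrixP => r s; rewrite !mxE tmap_sum.
under [LHS]eq_bigr do rewrite tmap_sum.
rewrite exchange_big; apply: eq_bigr => i _; apply: eq_bigr => j _.
by rewrite tmapZ !mxE mulrC.
Qed.
Lemma tensor_mxstar_kron p q (A : 'M[V]_p) (B : 'M[W]_q) :
  tensor_mxstar (kron A B) = kron (mxstar A) (mxstar B).
Proof. by apply/matrixP => i j; rewrite !mxE tmap_pure. Qed.

Lemma gen_star (x : 'M[tensor V W]_n) :
  (forall p (A : 'M[V]_p), mo_cone V p A -> mxstar A = A) ->
  (forall q (B : 'M[W]_q), mo_cone W q B -> mxstar B = B) ->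
  gen x -> tensor_mxstar x = x.
Proof.
move=> hV hW; elim=> [|p q A B al x' hA hB _ IH]; first exact: tensor_mxstar0.
by rewrite tensor_mxstarD IH tensor_mxstar_compress tensor_mxstar_kron (hV _ _ hA) (hW _ _ hB).
Qed.

Lemma gen_scale (a : R) (x : mxl (tensor V W) n) : 0 <= a -> gen x -> gen (a *: x).
Proof.
move=> a0 /(gen_compress (Num.sqrt a)%:M); congr gen.
apply/matrixP => i j; rewrite mxl_scaleE mxE.
by rewrite (sum_scalar2 cjR) /= -expr2 sqr_sqrtr.
Qed.
End Star.

Section Unit.
Variables (V W : opsys (@idfun R)) (n : nat).
Let Vop := os_repr V.
Let Wop := os_repr W.
Local Notation e := (pure (ms_unit V) (ms_unit W)).

Lemma cone_unit1 (U : opsys (@idfun R)) :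
  mo_cone U 1 (const_mx (ms_unit U)).
Proof.
have [P [d [T rr]]] := opsys_raw_repr cjR (os_repr U).
apply/(rr_cone rr); split.
  by apply/matrixP => i j; rewrite !mxE (star_unit cjR (os_repr U)).
move=> h; rewrite /qform !big_ord1 mxE (rr_unit rr).
exact: d_ge0 (rr_hilb rr) _.
Qed.

Lemma gen_unit_mx (k : 'I_n) (c : R) : 0 <= c -> gen (unit_mx k k (c *: e)).
Proof.
move=> c0.
have := gen_scale c0 (gen1 (n := n) (\matrix_(i, s) (s == k)%:R)
   (cone_unit1 V) (cone_unit1 W)).
congr gen; apply/matrixP => r s; rewrite mxl_scaleE mxE [RHS]mxE unit_mxE.
rewrite (big_ord1 _ _ : \sum_(i < 1 * 1) _ = _).
rewrite (big_ord1 _ _ : \sum_(i < 1 * 1) _ = _) !mxE.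
by rewrite !scalerA mulrC.
Qed.

Lemma gen_unit_rest (k : 'I_n) (c : R) : 0 <= c ->
  gen (diag_const n (c *: e) - unit_mx k k (c *: e)).
Proof.
move=> c0; rewrite unit_mx_diag_const (bigD1 k) //= addrAC subrr add0r.
by apply: gen_sum => i _; exact: gen_unit_mx.
Qed.

Lemma gen_order_unit (y : 'M[tensor V W]_n) : exists2 r : R, 0 <= r &
  gen (diag_const n (r *: e) - (y + tensor_mxstar y)).
Proof.
pose Q (y : 'M[tensor V W]_n) := exists2 r : R, 0 <= r &
  gen (diag_const n (r *: e) - (y + tensor_mxstar y)).
have dcD (a b : R) : diag_const n ((a + b) *: e) = diag_const n (a *: e) + diag_const n (b *: e).
  by apply/matrixP => i j; rewrite !mxE; case: eqP => _; rewrite ?scalerDl ?addr0.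
have Q0 : Q 0.
  exists 0 => //; rewrite tensor_mxstar0 addr0 subr0 scale0r.
  rewrite (_ : diag_const n 0 = 0); first exact: gen0.
  by apply/matrixP => i j; rewrite !mxE; case: eqP.
have QD u v : Q u -> Q v -> Q (u + v).
  move=> [r r0 hu] [s s0 hv]; exists (r + s); first exact: addr_ge0.
  rewrite tensor_mxstarD dcD (addrACA u) opprD addrACA; exact: gen_add.
rewrite -/(Q y) (sum_unit_mx y).
apply: (big_ind Q Q0 QD) => i _; apply: (big_ind Q Q0 QD) => j _.
have [s ->] := tensor_span_pure (y i j).
have unitD (u v : tensor V W) : unit_mx i j (u + v) = unit_mx i j u + unit_mx i j v.
  by apply/matrixP => r t; rewrite !mxE; case: ifP; rewrite ?addr0.
elim: s => [|[v w] s IH].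
  rewrite big_nil (_ : unit_mx i j 0 = 0) //.
  by apply/matrixP => r t; rewrite !mxE; case: ifP.
rewrite big_cons unitD; apply: QD; last exact: IH.
rewrite {IH} /fst /snd.
have [a [a0 ha]] := exists_norm_le cjR Vop v.
have [b [b0 hb]] := exists_norm_le cjR Wop w.
have ab0 : 0 <= a * b by exact: mulr_ge0.
(* Two copies of [a * b]: the diagonal terms at [i] and at [j] are completed separately to the whole
   diagonal, which also covers [i = j]. *)
exists (a * b + a * b); first exact: addr_ge0.
have := gen_add (gen_bound i j ha hb)
  (gen_add (gen_unit_rest i ab0) (gen_unit_rest j ab0)).
congr gen; rewrite dcD !pureZl !pureZr !scalerA tensor_mxstar_unit_mx tmap_pure /=.
rewrite addrAC; congr (_ - _).
by rewrite addrACA !subrKC.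
Qed.
End Unit.
End GenBound.

Section LinFun.
Variables (R : realType) (E : lmodType R) (f : E -> R).
Hypothesis fl : forall a x y, f (a *: x + y) = a * f x + f y.
Lemma lfD x y : f (x + y) = f x + f y.
Proof. by have := fl 1 x y; rewrite scale1r mul1r. Qed.
Lemma lf0 : f 0 = 0.
Proof. by apply: (addrI (f 0)); rewrite -lfD !addr0. Qed.
Lemma lfZ a x : f (a *: x) = a * f x.
Proof. by rewrite -[a *: x]addr0 fl lf0 addr0. Qed.
Lemma lfN x : f (- x) = - f x.
Proof. by rewrite -scaleN1r lfZ mulN1r. Qed.
Lemma lf_sum I (r : seq I) (P : pred I) F :
  f (\sum_(i <- r | P i) F i) = \sum_(i <- r | P i) f (F i).
Proof. exact: (big_morph f lfD lf0). Qed.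
End LinFun.

Section Separation.
Variable R : realType.
Let cjR := conj_field_real R.
Variables (V W : opsys (@idfun R)) (n : nat).
Let Vop := os_repr V.
Let Wop := os_repr W.
Local Notation e := (pure (ms_unit V) (ms_unit W)).
Local Notation M := (mxl (tensor V W) n).

Lemma gen_opsys_star (x : 'M[tensor V W]_n) : gen x -> tensor_mxstar x = x.
Proof.
apply: gen_star => p A; first exact: (cone_star cjR Vop).
exact: (cone_star cjR Wop).
Qed.

Lemma diag_constZ (U : lmodType R) (a : R) (u : U) :
  diag_const n (a *: u) = a *: (diag_const n u : mxl U n).
Proof.
apply/matrixP => i j; rewrite mxl_scaleE !mxE.
by case: eqP; rewrite ?scaler0.
Qed.

Lemma star_diag_unit : tensor_mxstar (diag_const n e) = diag_const n e.
Proof.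
apply/matrixP => i j; rewrite !mxE eq_sym; case: eqP => _; rewrite ?tmap0 //.
by rewrite tmap_pure /= (star_unit cjR Vop) (star_unit cjR Wop).
Qed.

Lemma gen_diag_unit : gen (diag_const n e).
Proof.
rewrite unit_mx_diag_const; apply: gen_sum => i _.
by have := gen_unit_mx V W i (ler01 : 0 <= (1 : R)); rewrite scale1r.
Qed.

Lemma max_separation (x : 'M[tensor V W]_n) :
  tensor_mxstar x = x -> ~ max_cone x ->
  exists f : M -> R,
    [/\ forall a u v, f (a *: u + v) = a * f u + f v,
        forall y, gen y -> 0 <= f y, forall y, f (tensor_mxstar y) = f y & f x < 0].
Proof.
move=> xs nx.
have [e0 [e0p ne0]] : exists e0 : R, 0 < e0 /\ ~ gen (x + diag_const n (e0 *: e)).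
  apply: contrapT => h; apply: nx; apply/max_coneP; split=> // c c0.
  by apply: contrapT => hc; apply: h; exists c.
(* The differences [y - y^*] and their negatives lie in this cone, since they symmetrize to 0; hence
   the separating functional is star-invariant. *)
pose C (y : M) := gen (y + tensor_mxstar y : 'M[tensor V W]_n).
have gC y : gen y -> C y.
  by move=> gy; rewrite /C (gen_opsys_star gy); exact: gen_add.
have CD y z : C y -> C z -> C (y + z).
  by rewrite /C tensor_mxstarD addrACA; exact: gen_add.
have CZ a y : 0 <= a -> C y -> C (a *: y).
  by rewrite /C tensor_mxstarZ -scalerDr; exact: gen_scale.
have C0 : C 0 by apply: gC; exact: gen0.
have Ce : C (diag_const n e) by apply: gC; exact: gen_diag_unit.
have Cu (y : M) : exists r, C (r *: (diag_const n e : M) - y).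
  have [r r0 hr] := gen_order_unit y; exists (r / 2).
  rewrite /C tensor_mxstarD tensor_mxstarZ star_diag_unit.
  by rewrite tensor_mxstarN addrACA -scalerDl -splitr -opprD -diag_constZ.
have nC : ~ C (x + diag_const n (e0 *: e)).
  rewrite /C tensor_mxstarD xs diag_constZ tensor_mxstarZ star_diag_unit => h.
  have h2 : 0 <= (2^-1 : R) by rewrite invr_ge0.
  apply: ne0; have := gen_scale h2 h; rewrite diag_constZ; congr gen.
  set u := (x : M) + _; have -> : u + u = (2 : R) *: u by rewrite scaler_nat mulr2n.
  by rewrite scalerA mulVf ?scale1r // pnatr_eq0.
have [f [fl fp f1 fx]] := order_unit_separation C0 CD CZ Ce Cu nC.
have fskew y : 0 <= f (y - tensor_mxstar y : M).
  apply: fp; rewrite /C tensor_mxstarD tensor_mxstarN tensor_mxstarK.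
  by rewrite addrA subrK subrr; exact: gen0.
exists f; split=> //.
- by move=> y /gC /fp.
- move=> y; apply/eqP; rewrite eq_le -subr_ge0 -[X in _ && X]subr_ge0.
  have h1 := fskew y; have h2 := fskew (tensor_mxstar y).
  by move: h1 h2; rewrite tensor_mxstarK !(lfD fl) !(lfN fl) => -> ->.
move: fx; rewrite (lfD fl) diag_constZ (lfZ fl) f1 mulr1 => h.
by apply: le_lt_trans (_ : f x <= - e0) _; rewrite ?oppr_lt0 // -subr_le0 opprK.
Qed.
End Separation.

(** * Weak expectations and positivity in the maximal tensor product *)

Section WepMax.
Variable R : realType.
Let cjR := conj_field_real R.
Variables (S T : opsys (@idfun R)) (n : nat).
Let Sop := os_repr S.
Let Top := os_repr T.
Local Notation e := (pure (ms_unit S) (ms_unit T)).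
Local Notation M := (mxl (tensor S T) n).
Variable f : M -> R.
Hypotheses (fl : forall a u v, f (a *: u + v) = a * f u + f v)
  (fp : forall y, gen y -> 0 <= f y) (fs : forall y, f (tensor_mxstar y) = f y).

Let fu (i k : 'I_n) (u : tensor S T) : R := f (unit_mx i k u).
Let ful i k a u v : fu i k (a *: u + v) = a * fu i k u + fu i k v.
Proof. by rewrite /fu unit_mx_linear fl. Qed.
Let fu_star i k s t :
  fu k i (pure (ms_star s) (ms_star t)) = fu i k (pure s t).
Proof. by rewrite /fu -[RHS]fs tensor_mxstar_unit_mx tmap_pure. Qed.

Lemma functional_sum (X : 'M[tensor S T]_n) : f X = \sum_i \sum_k fu i k (X i k).
Proof.
rewrite [X in LHS]sum_unit_mx (lf_sum fl); apply: eq_bigr => i _.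
by rewrite (lf_sum fl).
Qed.

Lemma beta_lin i k t (a : R) (u v : S) :
  fu i k (pure (a *: u + v) t) = a * fu i k (pure u t) + fu i k (pure v t).
Proof. by rewrite pureDl pureZl ful. Qed.

Lemma beta_bnd i k t : exists c : R, forall (v : S) r, norm_le v r ->
  `|fu i k (pure v t)| <= c * r.
Proof.
have [b [b0 hb]] := exists_norm_le cjR Top t.
(* By star-invariance of [f] the two off-diagonal terms of [gen_bound] have the same value, whence
   the factor 1/2. *)
exists (2^-1 * b * (fu i i e + fu k k e)) => v r vr.
have up w : norm_le w r -> fu i k (pure w t) <= 2^-1 * b * (fu i i e + fu k k e) * r.
  move=> [r0 hr]; have := fp (gen_bound i k hr hb).
  rewrite (lfD fl) (lfN fl) !(lfD fl) -!/(fu _ _ _) fu_star.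
  rewrite !pureZl !pureZr !scalerA !(lfZ (ful _ _)).
  lra.
have h1 := up _ vr; have := up _ (norm_leN cjR Sop vr).
rewrite -scaleN1r pureZl (lfZ (ful _ _)) mulN1r => h2.
by rewrite ler_norml lerNl h1 h2.
Qed.

Definition beta i k t : opdual S := mk_bdual (beta_lin i k t) (beta_bnd i k t).

Lemma beta_linear i k (a : R) t t' : beta i k (a *: t + t') = a *: beta i k t + beta i k t'.
Proof. by apply: bdualP => s; rewrite /= pureDr pureZr ful. Qed.

Section Slice.
Variables (p q : nat) (B : 'M[T]_q) (al : 'M[R]_(p * q, n)).

(* The matrix over the dual that represents the functional
   [A |-> f (al^T (A (x) B) al)] on matrices over [S]. *)
Definition slice : 'M[opdual S]_p := \matrix_(k, l) \sum_i \sum_i' \sum_I \sum_J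
  (((mxtens_unindex I).1 == k)%:R * ((mxtens_unindex J).1 == l)%:R
   * (al I i * al J i')) *: beta i i' (B (mxtens_unindex I).2 (mxtens_unindex J).2).

(** Stated for arbitrary linear [L] because it serves twice: with evaluations at the entries of a
    matrix over [S], and with the elements [phi (A k l)] of the bidual. *)
Lemma slice_sum (L : 'I_p -> 'I_p -> opdual S -> R) :
  (forall k l a u v, L k l (a *: u + v) = a * L k l u + L k l v) ->
  \sum_k \sum_l L k l (slice k l) = \sum_i \sum_i' \sum_I \sum_J
    al I i * al J i' * L (mxtens_unindex I).1 (mxtens_unindex J).1
      (beta i i' (B (mxtens_unindex I).2 (mxtens_unindex J).2)).
Proof.
move=> Ll.
transitivity (\sum_k \sum_l \sum_i \sum_i' \sum_I \sum_J
  (((mxtens_unindex I).1 == k)%:R * ((mxtens_unindex J).1 == l)%:R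
   * (al I i * al J i')) * L k l (beta i i' (B (mxtens_unindex I).2 (mxtens_unindex J).2))).
  apply: eq_bigr => k _; apply: eq_bigr => l _; rewrite mxE.
  do 4![rewrite (lf_sum (Ll k l)); apply: eq_bigr => ? _].
  by rewrite (lfZ (Ll k l)).
under eq_bigr do rewrite exchange_big /=.
rewrite exchange_big; apply: eq_bigr => i _ /=.
under eq_bigr do rewrite exchange_big /=.
rewrite exchange_big; apply: eq_bigr => i' _ /=.
under eq_bigr do rewrite exchange_big /=.
rewrite exchange_big; apply: eq_bigr => I _ /=.
under eq_bigr do rewrite exchange_big /=.
rewrite exchange_big; apply: eq_bigr => J _ /=.
rewrite (bigD1 (mxtens_unindex I).1) //= (bigD1 (mxtens_unindex J).1) //= !eqxx !mul1r.
rewrite [X in _ + X + _]big1 => [|l /negPf h]; last by rewrite eq_sym h mulr0 !mul0r.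
rewrite addr0 [X in _ + X]big1 ?addr0 // => k /negPf h.
by apply: big1 => l _; rewrite eq_sym h !mul0r.
Qed.

Lemma slice_functional (A : 'M[S]_p) :
  \sum_k \sum_l (slice k l : bdual _) (A k l) = f (compress al (kron A B)).
Proof.
rewrite (slice_sum (L := fun k l g => (g : bdual _) (A k l))) //.
rewrite functional_sum; apply: eq_bigr => i _; apply: eq_bigr => i' _.
rewrite mxE (lf_sum (ful i i')); apply: eq_bigr => I _.
rewrite (lf_sum (ful i i')); apply: eq_bigr => J _.
by rewrite (lfZ (ful i i')) mxE.
Qed.

Lemma slice_eval k l s : (slice k l : bdual _) s = \sum_i \sum_i' \sum_I \sum_J
  (((mxtens_unindex I).1 == k)%:R * ((mxtens_unindex J).1 == l)%:R
   * (al I i * al J i')) *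
    fu i i' (pure s (B (mxtens_unindex I).2 (mxtens_unindex J).2)).
Proof.
pose ev (g : opdual S) : R := (g : bdual _) s.
have evl a g h : ev (a *: g + h) = a * ev g + ev h by [].
rewrite -[LHS]/(ev _) mxE; do 4![rewrite (lf_sum evl); apply: eq_bigr => ? _].
exact: (lfZ evl).
Qed.

(** Compressing [A] by the test vector [x] turns the form of [slice] into the value of [f] at a
    generator of the cone. *)
Lemma slice_cone : mo_cone T q B -> mo_cone (opdual S) p slice.
Proof.
move=> hB; apply/opdual_coneP => m A hA; split.
  move=> a b k l; rewrite !slice_eval.
  rewrite exchange_big; apply: eq_bigr => i _; apply: eq_bigr => i' _.
  rewrite exchange_big; apply: eq_bigr => I _; apply: eq_bigr => J _.
  rewrite -(cone_starE cjR Sop a b hA).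
  rewrite -(cone_starE cjR Top (mxtens_unindex J).2 (mxtens_unindex I).2 hB) fu_star.
  by congr (_ * _); congr (_ * _); rewrite mulrC.
move=> x.
have -> : \sum_a \sum_b \sum_k \sum_l idfun (x a k) * (slice k l : bdual _) (A a b) * x b l
  = f (compress al (kron (compress (\matrix_(a, k) x a k) A) B)).
  rewrite -slice_functional.
  transitivity (\sum_k \sum_l \sum_a \sum_b
      x a k * (slice k l : bdual _) (A a b) * x b l).
    under [LHS]eq_bigr do rewrite exchange_big /=.
    rewrite exchange_big; apply: eq_bigr => k _ /=.
    under [LHS]eq_bigr do rewrite exchange_big /=.
    by rewrite exchange_big.
  apply: eq_bigr => k _; apply: eq_bigr => l _.
  rewrite [compress _ _ _ _]mxE (lf_sum (bdual_lin (slice k l))); apply: eq_bigr => a _.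
  rewrite (lf_sum (bdual_lin (slice k l))); apply: eq_bigr => b _.
  by rewrite (lfZ (bdual_lin (slice k l))) !mxE mulrAC.
by apply: fp; apply: gen1 => //; exact: (cone_ccompress cjR Sop).
Qed.
End Slice.

Variables (I : matsys (@idfun R)) (j : {linear S -> I}).
Variable phi : {linear I -> bidual S}.
Hypotheses (pcp : cp phi) (p1 : is_eval (ms_unit S) (phi (ms_unit I)))
  (pj : forall s, is_eval s (phi (j s))).

Let bl i k t a v v' : (phi (a *: v + v') : bdual _) (beta i k t) =
  a * (phi v : bdual _) (beta i k t) + (phi v' : bdual _) (beta i k t).
Proof. by rewrite linearP. Qed.
Let br i k v a t t' : (phi v : bdual _) (beta i k (a *: t + t')) =
  a * (phi v : bdual _) (beta i k t) + (phi v : bdual _) (beta i k t').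
Proof. by rewrite beta_linear bdual_lin. Qed.

Definition bform i k : {bilinear I -> T -> R^o} := mk_bilinear (bl i k) (br i k).

(** The functional [f] carried over to [I (x) T]: [beta] turns an element of [T] into a functional
    on [S], at which the weak expectation is evaluated. *)
Definition extended (X : 'M[tensor I T]_n) : R := \sum_i \sum_k X i k (bform i k).

Lemma extendedD X Y : extended (X + Y) = extended X + extended Y.
Proof.
rewrite /extended -big_split; apply: eq_bigr => i _; rewrite -big_split.
by apply: eq_bigr => k _; rewrite mxE.
Qed.

Lemma extended_compress p q (A : 'M[I]_p) (B : 'M[T]_q) (al : 'M[R]_(p * q, n)) :
  extended (compress al (kron A B)) =
  \sum_k \sum_l (phi (A k l) : bdual _) (slice B al k l).
Proof.
rewrite (slice_sum B al (L := fun k l g => (phi (A k l) : bdual _) g)); last first.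
  by move=> k l a u v; rewrite bdual_lin.
apply: eq_bigr => i _; apply: eq_bigr => i' _.
rewrite mxE tensor_sumE; apply: eq_bigr => J _.
rewrite tensor_sumE; apply: eq_bigr => L _.
by rewrite tensor_scaleE mxE.
Qed.

Lemma extended_ge0 X : gen X -> 0 <= extended X.
Proof.
elim=> [|p q A B al x hA hB _ IH].
  by apply: sumr_ge0 => i _; apply: sumr_ge0 => k _; rewrite mxE.
rewrite extendedD addr_ge0 // extended_compress.
have [_] := (bidual_coneP _).1 (pcp hA) _ _ (slice_cone al hB).
(* At the vector given by the identity matrix the form is the sum of the values of [phi (A k l)] at
   [slice k l]. *)
move=> /(_ (fun a b => (a == b)%:R)); congr (0 <= _).
transitivity (\sum_k \sum_l \sum_a \sum_b
   ((a == k)%:R * (b == l)%:R) * (phi (A k l) : bdual _) (slice B al a b)).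
  under [LHS]eq_bigr do rewrite exchange_big /=.
  rewrite exchange_big; apply: eq_bigr => k _ /=.
  under [LHS]eq_bigr do rewrite exchange_big /=.
  rewrite exchange_big; apply: eq_bigr => l _ /=.
  by apply: eq_bigr => a _; apply: eq_bigr => b _; rewrite mxE mulrAC.
apply: eq_bigr => k _; apply: eq_bigr => l _.
rewrite (bigD1 k) //= (bigD1 l) //= !eqxx !mul1r.
rewrite [X in _ + X + _]big1 => [|b /negPf ->]; last by rewrite mulr0 mul0r.
rewrite addr0 [X in _ + X]big1 ?addr0 // => a /negPf ->.
by apply: big1 => b _; rewrite !mul0r.
Qed.

Lemma extended_map (x : 'M[tensor S T]_n) :
  extended (map_mx (tmap j (@idfun T)) x) = f x.
Proof.
rewrite functional_sum; apply: eq_bigr => i _; apply: eq_bigr => k _; rewrite mxE.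
have [s ->] := tensor_span_pure (x i k).
rewrite tmap_sum tensor_sumE (lf_sum (ful i k)); apply: eq_bigr => p _.
by rewrite tmap_pure /= pj.
Qed.

Lemma extended_unit (c : R) :
  extended (diag_const n (c *: pure (ms_unit I) (ms_unit T))) =
  c * f (diag_const n (pure (ms_unit S) (ms_unit T))).
Proof.
rewrite functional_sum mulr_sumr; apply: eq_bigr => i _.
rewrite mulr_sumr; apply: eq_bigr => k _; rewrite !mxE; case: eqP => _.
  by rewrite tensor_scaleE /= p1.
by rewrite (lf0 (ful i k)) mulr0.
Qed.

Lemma functional_ge0 x :
  max_cone (map_mx (tmap j (@idfun T)) x : 'M[tensor I T]_n) -> 0 <= f x.
Proof.
move=> /max_coneP[_ h]; apply: (@ge0_of_eps _ _ (f (diag_const n e))).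
  by apply: fp; exact: gen_diag_unit.
move=> c /h /extended_ge0; by rewrite extendedD extended_map extended_unit.
Qed.
End WepMax.

Lemma wep_max (R : realType) (S T : opsys (@idfun R)) (I : opsys (@idfun R))
    (j : {linear S -> I}) n (x : 'M[tensor S T]_n) :
  subsystem j ->
  (exists phi : {linear I -> bidual S},
      [/\ cp phi, is_eval (ms_unit S) (phi (ms_unit I))
        & forall s, is_eval s (phi (j s))]) ->
  max_cone (map_mx (tmap j (@idfun T)) x : 'M[tensor I T]_n) -> max_cone x.
Proof.
move=> [ji _ js _] [phi [pcp p1 pj]] hx.
have xs : tensor_mxstar x = x.
  have inj : injective (tmap j (@idfun T)) by apply: tmap_inj.
  have [+ _] := hx; rewrite tensor_mxstar_map //; exact: map_mx_inj_.
apply: contrapT => /(max_separation xs)[f [fl fp fs]].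
apply/negP; rewrite -leNgt.
by apply: (functional_ge0 fl fp fs pcp p1 pj).
Qed.

Lemma subsystem_ucp (K : numFieldType) (conj : K -> K) (V W : matsys conj)
  (j : {linear V -> W}) : subsystem j -> ucp j.
Proof. by move=> [_ j1 _ jc]; split=> // n A /jc. Qed.

Lemma cp_id (K : numFieldType) (V : matord K) : cp (@idfun V).
Proof. by move=> n A; rewrite map_mx_id. Qed.

Lemma real_wep_el_eq_max (R : realType) (S T : opsys (@idfun R)) :
  real_wep S -> el_eq_max S T.
Proof.
have cjR := conj_field_real R.
move=> [I [j [je wphi]]] n x; have [Iinj js _] := je.
have [_ j1 jst _] := js; have [jcp _] := subsystem_ucp js.
split=> [[I' [j' [[_ js' _] hx]]]|hx].
  (* The envelope [I'] witnessing [el_cone] may differ from the envelope [I] that carries the weak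
     expectation; injectivity of [I] transports positivity from one to the other. *)
  have [psi [[psicp psi1] psij]] := Iinj S I' j' j js' (subsystem_ucp js).
  apply: (wep_max js wphi).
  have psis := cp_star cjR (os_repr I') (os_repr I) psicp.
  have := max_cone_map (k := @idfun T) psis (fun=> erefl) psicp (@cp_id _ T) psi1 erefl hx.
  congr max_cone; rewrite -map_mx_comp; apply: eq_map_mx => t.
  exact: tmap_comp.
exists I, j; split=> //.
exact: (max_cone_map (k := @idfun T) jst (fun=> erefl) jcp (@cp_id _ T) j1 erefl hx).
Qed.

(** * Operator systems in the dual *)

Section UnorderedSum.
Variables (R : realType) (B : choiceType).
Implicit Types (f g : B -> R) (s : seq B).

(** Unordered summation, because the Hilbert sum built from it is indexed by a possibly uncountable
    family of positive matrices over [S]. *)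
Definition has_usum f (v : R) := forall e, 0 < e -> exists s0 : seq B,
  forall s, uniq s -> {subset s0 <= s} -> `|\sum_(b <- s) f b - v| < e.

Definition usum f : R := xget 0 [set v | has_usum f v].

Lemma has_usum_uniq f v w : has_usum f v -> has_usum f w -> v = w.
Proof.
move=> hv hw; apply/eqP; rewrite -subr_eq0 -normr_le0.
apply/ler_addgt0Pr => e e0; rewrite add0r.
have e2 : 0 < e / 2 by rewrite divr_gt0.
have [s1 h1] := hv _ e2; have [s2 h2] := hw _ e2.
pose s := undup (s1 ++ s2).
have us : uniq s by exact: undup_uniq.
have {}h1 := h1 s us _; have {}h2 := h2 s us _.
have /h1 k1 : {subset s1 <= s} by move=> b h; rewrite mem_undup mem_cat h.
have /h2 k2 : {subset s2 <= s} by move=> b h; rewrite mem_undup mem_cat h orbT.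
have -> : v - w = (\sum_(b <- s) f b - w) - (\sum_(b <- s) f b - v) by ring.
apply: le_trans (ler_normB _ _) _; rewrite [e]splitr ltW // ltrD //.
Qed.

Lemma usumP f v : has_usum f v -> usum f = v.
Proof.
move=> h; rewrite /usum; case: xgetP => [w _ /= hw|/(_ v)//].
exact: has_usum_uniq hw h.
Qed.

Lemma has_usum_lin a f g v w : has_usum f v -> has_usum g w ->
  has_usum (fun b => a * f b + g b) (a * v + w).
Proof.
move=> hf hg e e0.
have a1 : 0 < `|a| + 1 by rewrite ltr_wpDl.
have e1 : 0 < e / 2 / (`|a| + 1) by rewrite !divr_gt0.
have e2 : 0 < e / 2 by rewrite divr_gt0.
have [s1 h1] := hf _ e1; have [s2 h2] := hg _ e2.
exists (s1 ++ s2) => s us ss.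
have /(h1 s us) k1 : {subset s1 <= s} by move=> b h; apply: ss; rewrite mem_cat h.
have /(h2 s us) k2 : {subset s2 <= s}.
  by move=> b h; apply: ss; rewrite mem_cat h orbT.
rewrite big_split -mulr_sumr /=.
have -> : a * (\sum_(b <- s) f b) + \sum_(b <- s) g b - (a * v + w) =
  a * (\sum_(b <- s) f b - v) + (\sum_(b <- s) g b - w) by ring.
apply: le_lt_trans (ler_normD _ _) _; rewrite [e]splitr; apply: ler_ltD => //.
rewrite normrM; apply: le_trans (_ : (`|a| + 1) * `|\sum_(b <- s) f b - v| <= _).
  by rewrite ler_wpM2r // lerDl.
by rewrite mulrC -ler_pdivlMr // ltW.
Qed.

Lemma sum_subseq_le f s t : (forall b, 0 <= f b) -> uniq s -> uniq t ->
  {subset s <= t} -> \sum_(b <- s) f b <= \sum_(b <- t) f b.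
Proof.
move=> f0 us ut st; rewrite [leRHS](bigID (mem s)) /=.
have -> : \sum_(b <- t | b \in s) f b = \sum_(b <- s) f b.
  rewrite -big_filter; apply: perm_big; apply: uniq_perm => //.
    exact: filter_uniq.
  by move=> b; rewrite mem_filter; case: (boolP (b \in s)) => //= /st ->.
by rewrite lerDl sumr_ge0.
Qed.

Lemma has_usum_sum (I : finType) (f : I -> B -> R) (v : I -> R) :
  (forall i, has_usum (f i) (v i)) -> has_usum (fun b => \sum_i f i b) (\sum_i v i).
Proof.
move=> h; elim: (index_enum I) => [|i r IH].
  move=> e e0; exists [::] => s _ _; rewrite big1 ?big_nil ?subrr ?normr0 // => b _.
  by rewrite big_nil.
have := has_usum_lin 1 (h i) IH; rewrite mul1r big_cons; congr has_usum.
by apply/funext => b; rewrite mul1r big_cons.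
Qed.

Lemma has_usum_ge0 f M : (forall b, 0 <= f b) ->
  (forall s, uniq s -> \sum_(b <- s) f b <= M) -> exists v, has_usum f v.
Proof.
move=> f0 fM; pose A := [set x | exists2 s, uniq s & x = \sum_(b <- s) f b].
have As : has_sup A.
  split; first by exists 0, [::]; rewrite ?big_nil.
  by exists M => _ [s us ->]; exact: fM.
exists (sup A) => e e0; have [_ [s us ->] hs] := sup_adherent e0 As.
exists s => t ut st.
have ht : \sum_(b <- t) f b <= sup A by apply: sup_upper_bound => //; exists t.
have hst := sum_subseq_le f0 us ut st.
by rewrite ler0_norm ?subr_le0 // opprB ltrBlDl -ltrBlDr (lt_le_trans hs).
Qed.

Lemma usum_le f v M : has_usum f v ->
  (forall s, uniq s -> \sum_(b <- s) f b <= M) -> v <= M.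
Proof.
move=> hf fM; apply/ler_addgt0Pr => e /hf[s0 hs].
have /(_ _) := hs (undup s0) (undup_uniq s0).
move=> /(_ (fun b h => _)); have /hs h : uniq (undup s0) by exact: undup_uniq.
have {}h : `|\sum_(b <- undup s0) f b - v| < e by apply: h => b; rewrite mem_undup.
move=> _; have := fM _ (undup_uniq s0).
move: h; rewrite ltr_norml => /andP[h _] h2; lra.
Qed.

Lemma le_usum f v s : (forall b, 0 <= f b) -> has_usum f v -> uniq s ->
  \sum_(b <- s) f b <= v.
Proof.
move=> f0 hf us; apply/ler_addgt0Pr => e /hf[s0 hs].
pose t := undup (s ++ s0).
have h : `|\sum_(b <- t) f b - v| < e.
  apply: hs; first exact: undup_uniq.
  by move=> b h; rewrite mem_undup mem_cat h orbT.
have : \sum_(b <- s) f b <= \sum_(b <- t) f b.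
  apply: sum_subseq_le => //; first exact: undup_uniq.
  by move=> b h'; rewrite mem_undup mem_cat h'.
move: h; rewrite ltr_norml => /andP[_ h] h2; lra.
Qed.

Lemma has_usum_single f c : (forall b, b != c -> f b = 0) -> has_usum f (f c).
Proof.
move=> fc e e0; exists [:: c] => s us ss.
have cs : c \in s by apply: ss; rewrite mem_head.
by rewrite (bigD1_seq c) //= big1 ?addr0 ?subrr ?normr0.
Qed.
End UnorderedSum.

(** * Hilbert sums of finite-dimensional inner product spaces *)

Section L2Sum.
Variables (R : realType) (B : choiceType) (n : B -> nat).
Variable D : forall b, 'M[R]_(n b).
Hypothesis Dsym : forall b, (D b)^T = D b.
Hypothesis Dpos : forall b (x : 'cV[R]_(n b)), x != 0 -> 0 < (x^T *m D b *m x) 0 0.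
Let cjR := conj_field_real R.

Definition blkform b (x y : 'cV[R]_(n b)) : R := (x^T *m D b *m y) 0 0.

Lemma blkform_lin b a (x x' y : 'cV[R]_(n b)) :
  blkform (a *: x + x') y = a * blkform x y + blkform x' y.
Proof.
by rewrite /blkform linearD linearZ /= !mulmxDl -!scalemxAl !mxE.
Qed.

Lemma blkform_sym b (x y : 'cV[R]_(n b)) : blkform x y = blkform y x.
Proof.
rewrite /blkform; have -> : y^T *m D b *m x = (x^T *m D b *m y)^T.
  by rewrite !trmx_mul trmxK Dsym mulmxA.
by rewrite [RHS]mxE.
Qed.

Lemma blkform_inner b : is_inner idfun (@blkform b).
Proof.
split; [exact: blkform_lin | exact: blkform_sym | exact: Dpos].
Qed.
Let qI b := blkform_inner b.

Lemma blkform_unit b : D b \in unitmx.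
Proof.
rewrite -row_free_unit -kermx_eq0; apply/rowV0P => u /sub_kermxP h.
apply/eqP/contraT => u0; have /Dpos : u^T != 0 by rewrite trmx_eq0.
by rewrite trmxK h mul0mx mxE ltxx.
Qed.

Lemma blkform_coord b (i : 'I_(n b)) : exists2 c, 0 <= c &
  forall x : 'cV[R]_(n b), x i 0 ^+ 2 <= c * blkform x x.
Proof.
(* The vector representing the coordinate [i], that is [blkform y x = x i 0]; Cauchy-Schwarz then
   gives the bound with [c = blkform y y]. *)
pose y : 'cV[R]_(n b) := invmx (D b) *m delta_mx i 0.
exists (blkform y y) => [|x]; first exact: d_ge0 (qI b) _.
have := d_cauchy_schwarz cjR (qI b) y x.
rewrite -normrX ger0_norm ?sqr_ge0 //.
suff -> : blkform y x = x i 0 by [].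
rewrite blkform_sym /blkform /y -mulmxA mulKVmx ?blkform_unit // !mxE.
rewrite (bigD1 i) //= big1 ?addr0 => [|j /negPf ji]; last by rewrite !mxE ji mulr0.
by rewrite !mxE !eqxx mulr1.
Qed.

(** A vector of the sum is a single function on the disjoint union of the coordinate sets, and [blk]
    reads off its component at [b]. *)
Definition l2idx := {b : B & 'I_(n b)}.
Definition blk (f : l2idx -> R^o) b : 'cV[R]_(n b) :=
  \col_i f (Tagged (fun b => 'I_(n b)) i).

Lemma blk_lin b a f g : blk (a *: f + g) b = a *: blk f b + blk g b.
Proof. by apply/matrixP => i j; rewrite !mxE. Qed.
Lemma blkB b f g : blk (f - g) b = blk f b - blk g b.
Proof. by apply/matrixP => i j; rewrite !mxE. Qed.
Lemma blkD b f g : blk (f + g) b = blk f b + blk g b.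
Proof. by apply/matrixP => i j; rewrite !mxE. Qed.

Definition blksq f b := blkform (blk f b) (blk f b).
Definition is_l2 (f : l2idx -> R^o) := exists M, forall s : seq B,
  uniq s -> \sum_(b <- s) blksq f b <= M.

Lemma blksq_ge0 f b : 0 <= blksq f b.
Proof. exact: d_ge0 (qI b) _. Qed.

Lemma blksqD f g b : blksq (f + g) b <= 2 * blksq f b + 2 * blksq g b.
Proof.
have := blksq_ge0 (f - g) b; rewrite /blksq blkB blkD.
rewrite !(d_Dl (qI b)) !(d_Dr cjR (qI b)) !(d_Nl (qI b)) !(d_Nr cjR (qI b)).
rewrite (blkform_sym (blk g b)) => h; lra.
Qed.

Lemma blksqZ a f b : blksq (a *: f) b = a ^+ 2 * blksq f b.
Proof.
have e : blk (a *: f) b = a *: blk f b.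
  by apply/matrixP => i j; rewrite !mxE.
by rewrite /blksq e (d_Zl (qI b)) (d_Zr cjR (qI b)) mulrA.
Qed.

Lemma blksqN f b : blksq (- f) b = blksq f b.
Proof. by rewrite -scaleN1r blksqZ sqrrN expr1n mul1r. Qed.

Lemma is_l2_submod : submod_closed (fun f => `[< is_l2 f >]).
Proof.
split=> [|a f g /asboolP[M hM] /asboolP[N hN]]; apply/asboolP.
  exists 0 => s _; rewrite big1 // => b _; rewrite /blksq.
  have -> : blk 0 b = 0 by apply/matrixP => i j; rewrite !mxE.
  exact: d_0l (qI b) _.
exists (2 * (a ^+ 2 * M) + 2 * N) => s us.
apply: le_trans (_ : \sum_(b <- s) (2 * (a ^+ 2 * blksq f b) + 2 * blksq g b) <= _).
  by apply: ler_sum => b _; rewrite -blksqZ; exact: blksqD.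
rewrite big_split -!mulr_sumr /= lerD // ler_wpM2l //; [|exact: hN].
by rewrite ler_wpM2l ?sqr_ge0 //; exact: hM.
Qed.

Definition l2 : lmodType R := subsp is_l2_submod.
Definition l2val (f : l2) : l2idx -> R^o := subsp_val f.

Lemma l2valP (f : l2) : is_l2 (l2val f). Proof. exact: subspP. Qed.
Lemma l2val_lin a (f g : l2) : l2val (a *: f + g) = a *: l2val f + l2val g.
Proof. by []. Qed.

Definition l2dot (f g : l2) : R :=
  usum (fun b => blkform (blk (l2val f) b) (blk (l2val g) b)).

Lemma l2sq_has (f : l2) : exists v, has_usum (blksq (l2val f)) v.
Proof.
by have [M hM] := l2valP f; apply: has_usum_ge0 hM => b; exact: blksq_ge0.
Qed.

Lemma l2dot_has (f g : l2) :
  has_usum (fun b => blkform (blk (l2val f) b) (blk (l2val g) b)) (l2dot f g).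
Proof.
suff [v hv] : exists v, has_usum (fun b => blkform (blk (l2val f) b) (blk (l2val g) b)) v.
  by rewrite /l2dot (usumP hv).
have [v hv] := l2sq_has (f + g); have [w hw] := l2sq_has (f - g).
(* Polarization: a quarter of the difference of the squares of [f + g] and [f - g]. The last summand
   is zero and only completes the shape required by [has_usum_lin]. *)
have := has_usum_lin (4^-1) (has_usum_lin (-1) hw hv) (has_usum_lin (-1) hv hv).
move=> hu; eexists; move: hu; congr has_usum.
apply/funext => b; rewrite !mulN1r addNr addr0.
have vD : l2val (f + g) = l2val f + l2val g by [].
have vB : l2val (f - g) = l2val f - l2val g by [].
rewrite /blksq vD vB blkB blkD.
rewrite !(d_Dl (qI b)) !(d_Dr cjR (qI b)) !(d_Nl (qI b)) !(d_Nr cjR (qI b)).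
rewrite (blkform_sym (blk (l2val g) b)); by field.
Qed.

Lemma l2dot_sq (f : l2) : has_usum (blksq (l2val f)) (l2dot f f).
Proof. exact: l2dot_has. Qed.

Lemma l2dot_lin a (u v w : l2) : l2dot (a *: u + v) w = a * l2dot u w + l2dot v w.
Proof.
apply: usumP.
have := has_usum_lin a (l2dot_has u w) (l2dot_has v w).
congr has_usum; apply/funext => b.
by rewrite l2val_lin blk_lin blkform_lin.
Qed.

Lemma l2dot_inner : is_inner idfun l2dot.
Proof.
split; first exact: l2dot_lin.
- move=> u v; apply: usumP; have := l2dot_has v u; congr has_usum.
  by apply/funext => b; rewrite blkform_sym.
move=> u u0.
have [[b i] bi] : exists x, l2val u x != 0.
  apply: contrapT => /forallNP h; move/eqP : u0; apply; apply: subsp_inj.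
  by apply/funext => x; have /negP := h x; rewrite negbK => /eqP.
apply: lt_le_trans (_ : blksq (l2val u) b <= _).
  apply: Dpos; apply/eqP => /matrixP/(_ i 0); rewrite !mxE => /eqP.
  exact/negP.
have := le_usum (blksq_ge0 (l2val u)) (l2dot_sq u) (isT : uniq [:: b]).
by rewrite big_seq1.
Qed.

Lemma l2dot_ge (f : l2) s : uniq s -> \sum_(b <- s) blksq (l2val f) b <= l2dot f f.
Proof. exact: le_usum (blksq_ge0 _) (l2dot_sq f). Qed.

Lemma l2dot_le (f : l2) M : (forall s, uniq s ->
  \sum_(b <- s) blksq (l2val f) b <= M) -> l2dot f f <= M.
Proof. exact: usum_le (l2dot_sq f). Qed.

Lemma blkform_small b e : 0 < e -> exists2 eta, 0 < eta &
  forall x : 'cV[R]_(n b), (forall i, `|x i 0| < eta) -> blkform x x < e.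
Proof.
move=> e0; pose c := \sum_i \sum_j `|D b i j|.
have c0 : 0 <= c by apply: sumr_ge0 => i _; apply: sumr_ge0.
have c1 : 0 < c + 1 by rewrite ltr_wpDl.
have ec : 0 < e / (c + 1) by rewrite divr_gt0.
exists (Num.min 1 (e / (c + 1))); first by rewrite lt_min ltr01 ec.
set eta := Num.min _ _ => x hx.
have eta0 : 0 < eta by rewrite lt_min ltr01 ec.
have le1 : eta * eta <= eta by rewrite ger_pMl // ge_min lexx.
have le2 : eta <= e / (c + 1) by rewrite ge_min lexx orbT.
apply: le_lt_trans (_ : eta * eta * c < _); last first.
  apply: le_lt_trans (_ : e / (c + 1) * c < _).
    by rewrite ler_wpM2r // (le_trans le1).
  by rewrite mulrAC ltr_pdivrMr // ltr_pM2l // ltrDl.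
rewrite /blkform mxE /c mulr_sumr.
have -> : \sum_j (x^T *m D b) 0 j * x j 0 = \sum_j \sum_i x i 0 * D b i j * x j 0.
  apply: eq_bigr => j _; rewrite mxE mulr_suml; apply: eq_bigr => i _.
  by rewrite mxE.
rewrite [leRHS](_ : _ = \sum_j \sum_i eta * eta * `|D b i j|); last first.
  by rewrite exchange_big; apply: eq_bigr => i _; rewrite mulr_sumr.
apply: ler_sum => j _; apply: ler_sum => i _.
apply: le_trans (ler_norm _) _; rewrite !normrM mulrAC ler_wpM2r //.
by apply: ler_pM => //; exact: ltW.
Qed.

Lemma l2_hilbert : is_hilbert idfun l2dot.
Proof.
split=> [|F FF Fc]; first exact: l2dot_inner.
have [l hl] : exists l : l2idx -> R^o, forall x e, 0 < e ->
    F [set f | `|l x - l2val f x| < e].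
  suff /choice[l hl] : forall x, exists lx : R, forall e, 0 < e ->
      F [set f | `|lx - l2val f x| < e] by exists l.
  move=> [b i]; set x := existT _ b i.
  have [c c0 hc] := blkform_coord i.
  have c1 : 0 < c + 1 by rewrite ltr_wpDl.
  have FG : ProperFilter ((fun f => l2val f x : R^o) @ F) by exact: fmap_proper_filter.
  have /cauchy_cvg/cvg_ex[lx /cvgrPdist_lt Fl] : cauchy ((fun f => l2val f x : R^o) @ F).
    apply/cauchyP => e e0.
    have [g hg] := Fc _ (divr_gt0 (exprn_gt0 2 e0) c1).
    exists (l2val g x); rewrite /fmap /=; apply: filterS hg => f /= hf.
    rewrite -ball_normE /= -(ltr_pXn2r (n := 2)) ?nnegrE ?(ltW e0) //.
    rewrite -normrX ger0_norm ?sqr_ge0 //.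
    have := hc (blk (l2val (g - f)) b); rewrite !mxE => h.
    apply: le_lt_trans h _.
    have hs : blksq (l2val (g - f)) b <= l2dot (g - f) (g - f).
      by have := l2dot_ge (g - f) (isT : uniq [:: b]); rewrite big_seq1.
    apply: le_lt_trans (_ : (c + 1) * l2dot (g - f) (g - f) < _).
      apply: ler_pM => //; [exact: blksq_ge0 | by rewrite lerDl].
    by rewrite mulrC -ltr_pdivlMr.
  by exists lx => e e0; exact: Fl.
have near_blk b e : 0 < e -> F [set f | blksq (l - l2val f) b < e].
  move=> e0; have [eta eta0 heta] := blkform_small b e0.
  have : F [set f | forall i : 'I_(n b), `|l (existT _ b i) - l2val f (existT _ b i)| < eta].
    by apply: filter_forall => i; exact: hl.
  by apply: filterS => f /= h; apply: heta => i; rewrite mxE; exact: h.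
have near_sum (s : seq B) e : 0 < e -> F [set f | \sum_(b <- s) blksq (l - l2val f) b <= e].
  elim: s e => [|b s IH] e e0.
    by apply: filterS (@filterT _ F _) => f _; rewrite /= big_nil ltW.
  have e2 : 0 < e / 2 by rewrite divr_gt0.
  apply: filterS (filterI (near_blk b _ e2) (IH _ e2)) => f [/= h1 h2].
  by rewrite big_cons [e]splitr lerD // ltW.
(* The bound is tested on finitely many blocks, where some [f] of the filter is both close to the
   coordinatewise limit [l] and within [e] of [g]; [blksqD] gives [2 * e + 2 * e]. *)
have key g e : 0 < e -> F [set f | l2dot (g - f) (g - f) < e] ->
    forall s, uniq s -> \sum_(b <- s) blksq (l - l2val g) b <= 4 * e.
  move=> e0 hg s us.
  have [f [/= f1 f2]] := filter_ex (filterI (near_sum s _ e0) hg).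
  apply: le_trans (_ : \sum_(b <- s) (2 * blksq (l - l2val f) b
      + 2 * blksq (l2val (g - f)) b) <= _).
    apply: ler_sum => b _.
    have -> : l - l2val g = (l - l2val f) + - l2val (g - f).
      have -> : l2val (g - f) = l2val g - l2val f by [].
      by rewrite opprB addrA subrK.
    by apply: le_trans (blksqD _ _ _) _; rewrite blksqN.
  rewrite big_split -!mulr_sumr /=.
  have := l2dot_ge (g - f) us; lra.
have [g0 hg0] := Fc 1 ltr01.
have ll2 : is_l2 l.
  have /asboolP h : (fun f => `[< is_l2 f >]) (1 *: (l - l2val g0) + l2val g0).
    apply: is_l2_submod.2; last by apply/asboolP; exact: l2valP.
    by apply/asboolP; exists (4 * 1); exact: key.
  by move: h; rewrite scale1r subrK.
pose L : l2 := mk_subsp is_l2_submod ll2.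
exists L => e e0.
(* The final estimate is [2 * 4 * (e / 20) + 2 * (e / 20)], which is [e / 2]. *)
have e2 : 0 < e / 20 by rewrite divr_gt0.
have [g hg] := Fc _ e2; apply: filterS (hg) => f /= hf.
have hL : l2dot (L - g) (L - g) <= 4 * (e / 20).
  by apply: l2dot_le; exact: key hg.
apply: le_lt_trans (_ : 2 * l2dot (L - g) (L - g) + 2 * l2dot (g - f) (g - f) < _).
  apply: l2dot_le => s us.
  apply: le_trans (_ : \sum_(b <- s) (2 * blksq (l2val (L - g)) b
      + 2 * blksq (l2val (g - f)) b) <= _).
    apply: ler_sum => b _.
    have -> : l2val (L - f) = l2val (L - g) + l2val (g - f).
      have -> : L - f = (L - g) + (g - f) by rewrite addrA subrK.
      by [].
    exact: blksqD.
  rewrite big_split -!mulr_sumr /=.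
  have h1 := l2dot_ge (L - g) us; have h2 := l2dot_ge (g - f) us.
  by apply: lerD; rewrite ler_pM2l.
lra.
Qed.
End L2Sum.

Lemma mulmx_linr (R : realType) m n (M : 'M[R]_(m, n)) a (x y : 'cV[R]_n) i :
  (M *m (a *: x + y)) i 0 = a * (M *m x) i 0 + (M *m y) i 0.
Proof.
rewrite !mxE mulr_sumr -big_split; apply: eq_bigr => j _ /=.
by rewrite !mxE mulrDr mulrCA.
Qed.

(** * Representing subspaces of the dual *)

Section DualSystem.
Variable R : realType.
Let cjR := conj_field_real R.
Variable S : opsys (@idfun R).
Let Sop := os_repr S.

Lemma norm_le_star (v : S) r : norm_le v r -> norm_le (ms_star v) r.
Proof.
move=> [r0 h]; split=> //; have := cone_pick cjR Sop (rshift 1 ord0) (lshift 1 ord0) h.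
by rewrite !(block_mxEul, block_mxEur, block_mxEdl, block_mxEdr) !mxE ms_starK.
Qed.

Lemma dstar_lin (g : opdual S) (a : R) (u v : S) :
  (g : bdual _) (ms_star (a *: u + v)) =
  a * (g : bdual _) (ms_star u) + (g : bdual _) (ms_star v).
Proof. by rewrite ms_star_lin bdual_lin. Qed.
Lemma dstar_bnd (g : opdual S) : exists M : R, forall (v : S) r, norm_le v r ->
  `|(g : bdual _) (ms_star v)| <= M * r.
Proof. by have [M hM] := bdual_bnd g; exists M => v r /norm_le_star /hM. Qed.

Definition dstar (g : opdual S) : opdual S := mk_bdual (dstar_lin g) (dstar_bnd g).

Fact dstarK : involutive dstar.
Proof. by move=> g; apply: bdualP => v; rewrite /= ms_starK. Qed.
Fact dstar_linear (a : R) (g h : opdual S) :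
  dstar (a *: g + h) = idfun a *: dstar g + dstar h.
Proof. by apply: bdualP => v. Qed.

(** The unit is a parameter because a dual has in general no order unit; subspaces become operator
    systems once all their elements are dominated by [de]. *)
Definition dualsys (de : opdual S) : matsys (@idfun R) :=
  @MatSys R idfun (opdual S) dstar de dstarK dstar_linear.

Definition ev n (g : opdual S) (A : 'M[S]_n) : 'M[R]_n :=
  \matrix_(i, j) (g : bdual _) (A i j).

Definition evform n (g : opdual S) (A : 'M[S]_n) (x y : 'cV[R]_n) : R :=
  (x^T *m ev g A *m y) 0 0.

Lemma evformE n g (A : 'M[S]_n) x y :
  evform g A x y = \sum_a \sum_b x a 0 * (g : bdual _) (A a b) * y b 0.
Proof.
rewrite /evform mxE exchange_big; apply: eq_bigr => b _ /=.
by rewrite mxE mulr_suml; apply: eq_bigr => a _; rewrite !mxE.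
Qed.

Lemma evform_dstar n g (A : 'M[S]_n) x y : mo_cone S n A ->
  evform (dstar g) A x y = evform g A y x.
Proof.
move=> hA; rewrite !evformE exchange_big; apply: eq_bigr => a _; apply: eq_bigr => b _ /=.
by rewrite (cone_starE cjR Sop a b hA) mulrC mulrA mulrAC mulrC mulrA.
Qed.

Lemma evform_lin n (A : 'M[S]_n) x y a (g h : opdual S) :
  evform (a *: g + h) A x y = a * evform g A x y + evform h A x y.
Proof.
rewrite !evformE mulr_sumr -big_split; apply: eq_bigr => i _.
rewrite mulr_sumr -big_split; apply: eq_bigr => j _ /=.
rewrite [X in _ * X * _](_ : _ = a * (g : bdual _) (A i j) + (h : bdual _) (A i j)) //.
ring.
Qed.

Lemma arr_evform m (F : 'M[opdual S]_m) n (A : 'M[S]_n) (x : 'I_n -> 'I_m -> R) :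
  \sum_a \sum_b \sum_k \sum_l x a k * (F k l : bdual _) (A a b) * x b l =
  \sum_k \sum_l evform (F k l) A (\col_a x a k) (\col_a x a l).
Proof.
under [LHS]eq_bigr do rewrite exchange_big /=.
rewrite exchange_big; apply: eq_bigr => k _ /=.
under [LHS]eq_bigr do rewrite exchange_big /=.
rewrite exchange_big; apply: eq_bigr => l _ /=.
by rewrite evformE; apply: eq_bigr => i _; apply: eq_bigr => j _; rewrite !mxE.
Qed.

Lemma cone_evform m (F : 'M[opdual S]_m) n (A : 'M[S]_n) (x : 'I_m -> 'cV[R]_n) :
  mo_cone (opdual S) m F -> mo_cone S n A ->
  0 <= \sum_k \sum_l evform (F k l) A (x k) (x l).
Proof.
move=> /opdual_coneP hF /hF [_ /(_ (fun a k => x k a 0))]; rewrite arr_evform.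
congr (0 <= _); apply: eq_bigr => k _; apply: eq_bigr => l _; congr evform;
by apply/matrixP => i j; rewrite mxE (ord1 j).
Qed.

Lemma opdual_cone_star m (F : 'M[opdual S]_m) k l :
  mo_cone (opdual S) m F -> dstar (F l k) = F k l.
Proof.
move=> /opdual_coneP hF; apply: bdualP => v /=.
have [r [_ /hF [+ _]]] := exists_norm_le cjR Sop v.
move=> /(_ (lshift 1 ord0) (rshift 1 ord0) k l).
by rewrite block_mxEur block_mxEdl !mxE.
Qed.

Definition dominated (de g : opdual S) (c : R) :=
  mo_cone (opdual S) (1 + 1) (blk2 (c *: de) g (dstar g) (c *: de)).

(** The inequality that [dominated] gives at a pair of vectors. It passes to linear combinations of
    functionals, and it bounds the operators of the representation below. *)
Definition form_dominated (de g : opdual S) (c : R) :=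
  forall n (A : 'M[S]_n) x y, mo_cone S n A ->
  0 <= c * evform de A x x + 2 * evform g A x y + c * evform de A y y.

Lemma dominated_form de g c : dominated de g c -> form_dominated de g c.
Proof.
move=> hd n A x y hA; have := cone_evform (fun k : 'I_(1 + 1) => if k == lshift 1 ord0 then x else y) hd hA.
rewrite !big_split_ord /= !big_ord1 !big_split_ord /= !big_ord1.
rewrite !(block_mxEul, block_mxEur, block_mxEdl, block_mxEdr) !mxE.
rewrite evform_dstar //.
have bZ z : evform (c *: de) A z z = c * evform de A z z.
  have := evform_lin A z z c de 0; rewrite !addr0 => ->.
  rewrite [X in _ + X]evformE [X in _ + X]big1 ?addr0 // => i _.
  by rewrite big1 // => j _; rewrite (_ : ((0 : opdual S) : bdual _) (A i j) = 0) // mulr0 mul0r.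
rewrite !bZ; congr (0 <= _); ring.
Qed.

Lemma evform_addm g n (A B : 'M[S]_n) x y :
  evform g (A + B) x y = evform g A x y + evform g B x y.
Proof.
have e : ev g (A + B) = ev g A + ev g B.
  by apply/matrixP => i j; rewrite !mxE bdualD.
by rewrite /evform e mulmxDr mulmxDl [LHS]mxE.
Qed.

Lemma evform_dconst g n a x y :
  evform g (dconst n (a *: ms_unit S)) x y = a * (g : bdual _) (ms_unit S) * (x^T *m y) 0 0.
Proof.
rewrite /evform (_ : ev g _ = (a * (g : bdual _) (ms_unit S))%:M).
  rewrite mul_mx_scalar [LHS]mxE [in RHS]mxE mulr_sumr; apply: eq_bigr => i _.
  by rewrite !mxE mulrA.
apply/matrixP => i j; rewrite !mxE; case: eqP => _; last by rewrite bdual0 mulr0n.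
by rewrite bdualZ mulr1n.
Qed.

Lemma evformZ g n (A : 'M[S]_n) a b x y :
  evform g A (a *: x) (b *: y) = a * b * evform g A x y.
Proof.
rewrite !evformE mulr_sumr; apply: eq_bigr => i _.
by rewrite mulr_sumr; apply: eq_bigr => j _; rewrite !mxE; ring.
Qed.

Lemma cone_unit_eps n e : 0 <= e -> mo_cone S n (dconst n (e *: ms_unit S)).
Proof.
have [Pr [d [T rr]]] := opsys_raw_repr cjR Sop; have dH := rr_hilb rr.
move=> e0; apply/(rr_cone rr); split.
  rewrite (mxstar_dconst cjR) (starZ cjR) (star_unit cjR Sop) //.
move=> h; rewrite (qform_dconst rr); apply: sumr_ge0 => i _.
by rewrite (T_Zv rr) (rr_unit rr) (d_Zl dH) mulr_ge0 // (d_ge0 dH).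
Qed.

Lemma evform_delta g n (A : 'M[S]_n) i j :
  evform g A (delta_mx i 0) (delta_mx j 0) = (g : bdual _) (A i j).
Proof.
rewrite evformE (bigD1 i) //= [X in _ + X]big1 => [|k /negPf ki].
  rewrite addr0 (bigD1 j) //= [X in _ + X]big1 => [|k /negPf kj].
    by rewrite !mxE !eqxx mulr1 mul1r addr0.
  by rewrite [delta_mx j _ _ _]mxE kj mulr0.
by rewrite big1 // => l _; rewrite [delta_mx i _ _ _]mxE ki !mul0r.
Qed.

Section Represent.
Variable de : opdual S.
Hypothesis depos : mo_cone (opdual S) 1 (const_mx de).
Variables (P : dualsys de -> Prop) (Pc : submod_closed (fun v => `[< P v >])).
Hypothesis Pstar : forall g : dualsys de, P g -> P (ms_star g).
Hypothesis Pde : P de.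
Hypothesis Pdom : forall g : dualsys de, P g -> exists2 c, 0 <= c & form_dominated de g c.
Let X := subsys Pc Pstar Pde.
Let vX (g : X) : opdual S := subsp_val g.

(** Definiteness makes the form of [de] an inner product on the summand. If [de] is positive at the
    unit, any positive matrix becomes definite after adding a small multiple of the unit
    ([good_eps]), so all positive matrices are reached in the limit. *)
Definition good (b : {n : nat & 'M[S]_n}) : Prop :=
  mo_cone S (tag b) (tagged b) /\
  forall x, x != 0 -> 0 < evform de (tagged b) x x.
Let B : choiceType := {b : {n : nat & 'M[S]_n} | `[< good b >]}.
Let nB (b : B) : nat := tag (val b).
Let aB (b : B) : 'M[S]_(nB b) := tagged (val b).
Let mkB b (h : good b) : B := exist _ b (asboolT h).
Let gB (b : B) : good (val b). Proof. by case: b => b h; exact/asboolP. Qed.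
Let D (b : B) : 'M[R]_(nB b) := ev de (aB b).

Lemma dstar_de : dstar de = de.
Proof. by have := opdual_cone_star 0 0 depos; rewrite !mxE. Qed.

Let Dsym b : (D b)^T = D b.
Proof.
apply/matrixP => i j; rewrite !mxE -{1}dstar_de /=.
by rewrite (cone_starE cjR Sop i j (gB b).1).
Qed.
Let Dpos b (x : 'cV[R]_(nB b)) : x != 0 -> 0 < (x^T *m D b *m x) 0 0.
Proof. exact: (gB b).2. Qed.

Lemma evform_de_ge0 n (A : 'M[S]_n) x : mo_cone S n A -> 0 <= evform de A x x.
Proof.
by move=> hA; have := cone_evform (fun _ => x) depos hA; rewrite !big_ord1 mxE.
Qed.

Let L2 : lmodType R := l2 Dsym Dpos.
Let lv (h : L2) (b : B) : 'cV[R]_(nB b) := blk (l2val h) b.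
Let dot (h k : L2) : R := l2dot h k.

(* [g] acts on the summand of [b] by the operator whose form, for the inner
   product of [de] at the matrix of [b], is the form of [g] at that matrix. *)
Definition dual_act (g : opdual S) (h : L2) (x : l2idx nB) : R^o :=
  (invmx (D (tag x)) *m ev g (aB (tag x)) *m lv h (tag x)) (tagged x) 0.

Lemma blk_dual_act g h b : blk (dual_act g h) b = invmx (D b) *m ev g (aB b) *m lv h b.
Proof. by apply/matrixP => i j; rewrite !mxE /dual_act !mxE (ord1 j). Qed.

Lemma blkform_dual_act g h b y :
  blkform D (blk (dual_act g h) b) y = evform g (aB b) y (lv h b).
Proof.
rewrite (blkform_sym Dsym) blk_dual_act /blkform -!mulmxA mulKVmx.
  by rewrite mulmxA.
exact: (blkform_unit Dpos).
Qed.

Lemma dual_act_le g c h b : 0 <= c -> form_dominated de g c ->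
  blksq D (dual_act g h) b <= (c + 1) ^+ 2 * blksq D (l2val h) b.
Proof.
move=> c0 gc; set t := blk (dual_act g h) b.
(* At these vectors domination reads [c q - 2 (c + 1) q + c (c + 1)^2 p >= 0], where [q] and [p] are
   the squares of [t] and of the component of [h]. The factor [c + 1] in place of [c] keeps the
   argument valid for [c = 0]. *)
have := gc _ _ (- t) ((c + 1) *: lv h b) (gB b).1.
rewrite -scaleN1r !evformZ -blkform_dual_act -/t.
rewrite -[evform de _ t t]/(blkform D t t).
rewrite -[evform de _ (lv h b) _]/(blksq D (l2val h) b).
have t0 : 0 <= blkform D t t by exact: (blksq_ge0 Dsym Dpos (dual_act g h) b).
have h0 := blksq_ge0 Dsym Dpos (l2val h) b.
rewrite /blksq -/t; set q := blkform D t t; set p := blkform D _ _ => H.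
suff : (c + 2) * (q - (c + 1) ^+ 2 * p) <= 0.
  by rewrite pmulr_rle0 ?subr_le0 // ltr_wpDl.
have : 0 <= (c + 1) ^+ 2 * p by rewrite mulr_ge0 ?sqr_ge0.
move: H; rewrite expr2; nra.
Qed.

Lemma dual_act_l2 (g : X) h : is_l2 D (dual_act (vX g) h).
Proof.
have [c c0 gc] := Pdom (subspP g).
exists ((c + 1) ^+ 2 * l2dot h h) => s us.
apply: le_trans (_ : \sum_(b <- s) (c + 1) ^+ 2 * blksq D (l2val h) b <= _).
  by apply: ler_sum => b _; exact: dual_act_le.
by rewrite -mulr_sumr ler_wpM2l ?sqr_ge0 // l2dot_ge.
Qed.

Let T (g : X) (h : L2) : L2 := mk_subsp (is_l2_submod Dsym Dpos) (dual_act_l2 g h).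
Let TE g h b y : blkform D (lv (T g h) b) y = evform (vX g) (aB b) y (lv h b).
Proof. exact: blkform_dual_act. Qed.

Lemma dual_act_bnd g : exists M, 0 <= M /\ forall h, dot (T g h) (T g h) <= M * dot h h.
Proof.
have [c c0 gc] := Pdom (subspP g).
exists ((c + 1) ^+ 2); split; first exact: sqr_ge0.
move=> h; apply: l2dot_le => s us.
apply: le_trans (_ : \sum_(b <- s) (c + 1) ^+ 2 * blksq D (l2val h) b <= _).
  by apply: ler_sum => b _; exact: dual_act_le.
by rewrite -mulr_sumr ler_wpM2l ?sqr_ge0 // l2dot_ge.
Qed.

Let one n : 'M[S]_n := dconst n (ms_unit S).
Lemma cone_one n : mo_cone S n (one n).
Proof. by have := cone_unit_eps n ler01; rewrite scale1r. Qed.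

Lemma de_unit_ge0 : 0 <= (de : bdual _) (ms_unit S).
Proof.
have := evform_de_ge0 (const_mx 1) (cone_one 1).
rewrite evformE !big_ord1 !mxE /= mulr1 mul1r //.
Qed.

Lemma evform_unit g n x y :
  evform g (one n) x y = (g : bdual _) (ms_unit S) * (x^T *m y) 0 0.
Proof. by rewrite /one -[ms_unit S]scale1r evform_dconst mul1r scale1r. Qed.

Lemma good_eps n (A : 'M[S]_n) e : mo_cone S n A -> 0 < e ->
  0 < (de : bdual _) (ms_unit S) ->
  good (existT (fun n => 'M[S]_n) n (A + dconst n (e *: ms_unit S))).
Proof.
move=> hA e0 d0; split=> /=.
  exact: (coneD cjR Sop hA (cone_unit_eps n (ltW e0))).
move=> x x0; rewrite evform_addm evform_dconst.
apply: ltr_wpDl; first exact: evform_de_ge0.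
have nn k : 0 <= x^T 0 k * x k 0 by rewrite mxE -expr2 sqr_ge0.
rewrite !mulr_gt0 // mxE lt_def sumr_ge0 // andbT.
apply: contra x0 => /eqP h; apply/eqP/matrixP => i j; rewrite (ord1 j) mxE.
apply/eqP; rewrite -sqrf_eq0 expr2.
by have /psumr_eq0P -/(_ (fun k _ => nn k) i isT) := h; rewrite mxE => ->.
Qed.

(** On a positive matrix with scalar diagonal and [w] in the corner, the terms in [de] vanish and
    domination leaves [2 * g w >= 0]; the same holds at [- w]. *)
Lemma dominated_unit0 (g : X) : (de : bdual _) (ms_unit S) = 0 -> g = 0.
Proof.
move=> d0; apply: subsp_inj; apply: bdualP => v.
have [c c0 gc] := Pdom (subspP g).
suff h w : 0 <= (vX g : bdual _) w.
  apply/eqP; rewrite eq_le; apply/andP; split; last exact: h.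
  by have := h (- v); rewrite bdualN oppr_ge0.
have [r [_ hw]] := exists_norm_le cjR Sop w.
have := gc _ _ (delta_mx (lshift 1 ord0) 0) (delta_mx (rshift 1 ord0) 0) hw.
rewrite !evform_delta !(block_mxEul, block_mxEur, block_mxEdl, block_mxEdr) !mxE.
rewrite bdualZ d0 !mulr0 addr0 add0r => h.
by rewrite -(pmulr_rge0 _ (ltr0Sn R 1)).
Qed.

Let single (b : B) (x : 'cV[R]_(nB b)) (y : l2idx nB) : R^o :=
  @untag B (fun b => 'I_(nB b)) R 0 b (fun i => x i 0) y.

Lemma blk_single b x : blk (@single b x) b = x.
Proof.
apply/matrixP => i j; rewrite mxE (ord1 j) /single.
by rewrite (untagE _ _ (erefl b : tag (Tagged (fun b => 'I_(nB b)) i) = b)).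
Qed.
Lemma blk_single_neq b b' x : b' != b -> blk (@single b x) b' = 0.
Proof.
move=> bb; apply/matrixP => i j; rewrite !mxE /single.
by rewrite untag_dflt.
Qed.

Let vec (b : B) (x : 'cV[R]_(nB b)) : exists h : L2,
  lv h b = x /\ forall b', b' != b -> lv h b' = 0.
Proof.
have sq0 b' : b' != b -> blksq D (single x) b' = 0.
  move=> /(@blk_single_neq b b' x) e; rewrite /blksq e.
  exact: (d_0l (blkform_inner Dsym Dpos b')).
have h : is_l2 D (single x).
  exists (blksq D (single x) b) => s us.
  have := has_usum_single (f := blksq D (single x)) sq0.
  by move/le_usum; apply=> // b'; exact: blksq_ge0.
exists (mk_subsp (is_l2_submod Dsym Dpos) h); split; first exact: blk_single.
by move=> b' /blk_single_neq e; exact: e.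
Qed.

Lemma dual_act_faithful (g : X) : (forall h, T g h = 0) -> g = 0.
Proof.
move=> Tg; have [d0|] := eqVneq ((de : bdual _) (ms_unit S)) 0.
  exact: dominated_unit0.
rewrite neq_lt ltNge de_unit_ge0 /= => d0.
have good0 (b : B) x y : evform (vX g) (aB b) x y = 0.
  have [h [<- _]] := vec y; rewrite -TE Tg.
  have -> : lv 0 b = 0 by apply/matrixP => i j; rewrite !mxE.
  exact: (d_0l (blkform_inner Dsym Dpos b)).
have goodA n (A : 'M[S]_n) x y : mo_cone S n A -> 
    evform (vX g) (A + dconst n (1 *: ms_unit S)) x y = 0.
  by move=> hA; exact: (good0 (mkB (good_eps hA ltr01 d0)) x y).
(* The shift by the unit is removed by subtracting the case [A = 0]. *)
have cone0' n (A : 'M[S]_n) x y : mo_cone S n A -> evform (vX g) A x y = 0.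
  move=> /goodA h; have := h x y; have := goodA n 0 x y (cone0 cjR Sop n).
  rewrite add0r evform_addm => ->; by rewrite addr0.
apply: subsp_inj; apply: bdualP => v.
have [r [_ hv]] := exists_norm_le cjR Sop v.
have := cone0' _ _ (delta_mx (lshift 1 ord0) 0) (delta_mx (rshift 1 ord0) 0) hv.
by rewrite evform_delta block_mxEur mxE.
Qed.

Let has_qform n (F : 'M[X]_n) (h : 'I_n -> L2) : has_usum (fun b : B =>
  \sum_i \sum_j evform (vX (F i j)) (aB b) (lv (h i) b) (lv (h j) b))
  (qform dot T F h).
Proof.
apply: has_usum_sum => i; apply: has_usum_sum => j.
have := l2dot_has (T (F i j) (h j)) (h i); congr has_usum.
by apply/funext => b; exact: TE.
Qed.

(** The form on the sum is the sum of the forms at the definite matrices. Vectors supported in one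
    block isolate each of them, and a shift by [e] times the unit, with [e] tending to 0, reaches
    the remaining positive matrices. *)
Lemma dual_act_cone n (F : 'M[X]_n) : mo_cone X n F <->
  mxstar F = F /\ forall h, 0 <= qform dot T F h.
Proof.
split=> [hF|[sF qF]].
  split=> [|h].
    apply/matrixP => i j; rewrite mxE; apply: subsp_inj => /=.
    by have := opdual_cone_star i j hF; rewrite !mxE.
  have := has_qform F h; move/le_usum => /(_ [::]); rewrite big_nil; apply=> // b.
  have := cone_evform (fun k => lv (h k) b) hF (gB b).1; congr (0 <= _).
  by apply: eq_bigr => k _; apply: eq_bigr => l _; rewrite mxE.
have pos (b : B) x : 0 <= \sum_k \sum_l evform (vX (F k l)) (aB b) (x k) (x l).
  have /choice[h hh] := fun k => vec (x k).
  suff <- : qform dot T F h = \sum_k \sum_l evform (vX (F k l)) (aB b) (x k) (x l).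
    exact: qF.
  apply: has_usum_uniq (has_qform F h) _.
  have -> : \sum_k \sum_l evform (vX (F k l)) (aB b) (x k) (x l) =
    \sum_k \sum_l evform (vX (F k l)) (aB b) (lv (h k) b) (lv (h l) b).
    by apply: eq_bigr => k _; apply: eq_bigr => l _; rewrite !(hh _).1.
  apply: has_usum_single => b' bb; rewrite big1 // => k _; rewrite big1 // => l _.
  by rewrite evformE big1 // => a _; rewrite big1 // => a' _;
    rewrite [lv (h k) _](hh k).2 // mxE !mul0r.
apply/opdual_coneP => p A hA; split=> [a b k l|x].
  rewrite !mxE /= -[in LHS]sF mxE /=.
  by rewrite (cone_starE cjR Sop b a hA).
rewrite arr_evform.
pose y k : 'cV[R]_p := \col_a x a k.
rewrite (eq_bigr (fun k => \sum_l evform (vX (F k l)) A (y k) (y l))); last first.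
  by move=> k _; apply: eq_bigr => l _; rewrite mxE.
have [d0|] := eqVneq ((de : bdual _) (ms_unit S)) 0.
  rewrite big1 // => k _; rewrite big1 // => l _; rewrite (dominated_unit0 (F k l) d0).
  rewrite evformE big1 // => i _; rewrite big1 // => j _.
  by rewrite (_ : (vX 0 : bdual _) (A i j) = 0) // mulr0 mul0r.
rewrite neq_lt ltNge de_unit_ge0 /= => d0.
have goodA e : 0 < e -> forall A', mo_cone S p A' ->
    0 <= \sum_k \sum_l evform (vX (F k l)) A' (y k) (y l) + 
      e * \sum_k \sum_l evform (vX (F k l)) (one p) (y k) (y l).
  move=> e0 A' hA'; have := pos (mkB (good_eps hA' e0 d0)) y; congr (0 <= _).
  rewrite mulr_sumr -big_split; apply: eq_bigr => k _.
  rewrite mulr_sumr -big_split; apply: eq_bigr => l _ /=.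
  rewrite [LHS]evform_addm evform_dconst evform_unit; ring.
apply: (@ge0_of_eps _ _ (\sum_k \sum_l evform (vX (F k l)) (one p) (y k) (y l))).
  have := goodA 1 ltr01 0 (cone0 cjR Sop p); rewrite mul1r big1 ?add0r // => k _.
  rewrite big1 // => l _; rewrite evformE big1 // => i _; rewrite big1 // => j _.
  have -> : (0 : 'M[S]_p) i j = 0 by rewrite mxE.
  by rewrite bdual0 mulr0 mul0r.
by move=> e e0; exact: goodA.
Qed.

Lemma dualsys_opsys : is_opsys X.
Proof.
apply: (raw_repr_opsys cjR (d := dot) (T := T)); split.
- exact: l2_hilbert.
- move=> g a h k; apply: subsp_inj; apply/funext => x.
  rewrite /= /dual_act (_ : lv (a *: h + k) (tag x) = a *: lv h (tag x) + lv k (tag x)).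
    exact: mulmx_linr.
  by rewrite /lv -blk_lin.
- move=> a f g h; apply: subsp_inj; apply/funext => x.
  rewrite /= /dual_act -!mulmxA.
  rewrite (_ : ev _ _ *m _ = a *: (ev (vX f) (aB (tag x)) *m lv h (tag x))
    + ev (vX g) (aB (tag x)) *m lv h (tag x)).
    by rewrite mulmx_linr !mulmxA.
  apply/matrixP => i j; rewrite !mxE mulr_sumr -big_split; apply: eq_bigr => l _ /=.
  by rewrite !mxE mulrA -mulrDl.
- exact: dual_act_bnd.
- exact: dual_act_faithful.
- move=> g h k; rewrite /dot /l2dot; congr usum; apply/funext => b.
  rewrite TE [RHS](blkform_sym Dsym) TE.
  by rewrite -[in RHS](evform_dstar _ _ _ (gB b).1) dstarK.
- move=> h; apply: subsp_inj; apply/funext => -[b i].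
  by rewrite /= /dual_act mulVmx ?blkform_unit // mul1mx mxE.
- exact: dual_act_cone.
Qed.
End Represent.
End DualSystem.

(** * Dominating a functional by a positive one *)

Section Domination.
Variable R : realType.
Let cjR := conj_field_real R.
Variable S : opsys (@idfun R).
Let Sop := os_repr S.
Local Notation one := (ms_unit S).
Local Notation i0 := (lshift 1 (ord0 : 'I_1) : 'I_(1 + 1)).
Local Notation i1 := (rshift 1 (ord0 : 'I_1) : 'I_(1 + 1)).

Lemma cone_blk2_diag (a b : S) : mo_cone S 1 (const_mx a) -> mo_cone S 1 (const_mx b) ->
  mo_cone S (1 + 1) (blk2 a 0 0 b).
Proof.
move=> ha hb; rewrite /blk2.
have -> : const_mx 0 = 0 :> 'M[S]_1 by apply/matrixP => i j; rewrite !mxE.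
exact: cone_diag.
Qed.

Lemma cone_eps1 e : 0 <= e -> mo_cone S 1 (const_mx (e *: one)).
Proof.
move=> e0; have := cone_unit_eps S 1 e0; congr mo_cone.
by apply/matrixP => i j; rewrite !mxE !ord1 eqxx.
Qed.

Lemma norm_le_re (v : S) r : norm_le v r ->
  mo_cone S 1 (const_mx ((r + r) *: one - (v + ms_star v))).
Proof.
move=> [_ h]; have := cone_ccompress cjR Sop (col_mx 1%:M (- 1%:M) : 'M[R]_(1 + 1, 1)) h.
congr mo_cone; apply/matrixP => i j; rewrite !ord1 [LHS]mxE [RHS]mxE.
rewrite !big_split_ord /= !big_ord1 !big_split_ord /= !big_ord1.
rewrite !(block_mxEul, block_mxEur, block_mxEdl, block_mxEdr).
rewrite !(col_mxEu, col_mxEd) !mxE /= !(mulrN, mulNr) !mulr1 opprK !scaleN1r !scale1r.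
by rewrite scalerDl opprD [X in _ + X = _]addrC [RHS]addrACA.
Qed.

Lemma cone_scaleE (l : R) : one != 0 -> mo_cone S 1 (const_mx (l *: one)) -> 0 <= l.
Proof.
have [P [d [T rr]]] := opsys_raw_repr cjR Sop; have dH := rr_hilb rr.
move=> o0 /(rr_cone rr)[_ h].
have [k k0] : exists k : P, k <> 0.
  apply: contrapT => /forallNP hk; move/eqP: o0; apply; apply: (rr_faith rr) => k.
  by rewrite (rr_unit rr); apply: contrapT; exact: hk.
have := h (fun _ => k); rewrite /qform !big_ord1 mxE (T_Zv rr) (rr_unit rr) (d_Zl dH).
by rewrite pmulr_lge0 // (hs_pos dH) //; exact/eqP.
Qed.

(** Congruence by [diag (p, q)] makes the two diagonal entries equal. *)
Lemma blk2_norm_le (z : S) (p q : R) : 0 <= p -> 0 <= q ->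
  mo_cone S (1 + 1) (blk2 ((q * q) *: one) z (ms_star z) ((p * p) *: one)) ->
  norm_le ((p * q) *: z) ((p * q) * (p * q)).
Proof.
move=> p0 q0 h; split; first by rewrite !mulr_ge0.
have := cone_ccompress cjR Sop (block_mx p%:M 0 0 q%:M : 'M[R]_(1 + 1)) h.
congr mo_cone; apply: matrix2P;
rewrite [LHS]mxE !big_split_ord /= !big_ord1 !big_split_ord /= !big_ord1;
rewrite !(block_mxEul, block_mxEur, block_mxEdl, block_mxEdr) !mxE /=;
rewrite !(mulr0, mul0r) ?mulr1n !scale0r ?addr0 ?add0r ?scalerA //.
- by congr (_ *: _); ring.
- by rewrite (starZ cjR) mulrC.
- by congr (_ *: _); ring.
Qed.

Section Functional.
Variables (g : opdual S) (r : R).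
Hypotheses (hg : dual_norm_le g r) (one0 : one != 0).
(* The point [((l, m), ((a, b), (c, d)))] stands for the matrix
   [[a, b], [c, d]] + diag (l 1, m 1) / 2; keeping [l] and [m] as separate
   coordinates makes the functional [u] below well defined on all of [E]. *)
Local Notation E := ((R^o * R^o) * ((S * S) * (S * S)))%type.
Let sym (y : E) : 'M[S]_(1 + 1) :=
  let: (l, m, (a, b, (c, d))) := y in
  blk2 (a + ms_star a + l *: one) (b + ms_star c) (c + ms_star b) (d + ms_star d + m *: one).

Let symD x y : sym (x + y) = sym x + sym y.
Proof.
case: x => [[l m] [[a b] [c d]]]; case: y => [[l' m'] [[a' b'] [c' d']]].
apply/esym/matrix2P; rewrite mxE !(block_mxEul, block_mxEur, block_mxEdl, block_mxEdr) !mxE /=.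
- by rewrite (starD cjR) scalerDl addrACA [X in X + _]addrACA.
- by rewrite (starD cjR) addrACA.
- by rewrite (starD cjR) addrACA.
- by rewrite (starD cjR) scalerDl addrACA [X in X + _]addrACA.
Qed.
Let symZ t y : sym (t *: y) = zmx t (sym y).
Proof.
case: y => [[l m] [[a b] [c d]]].
apply/esym/matrix2P; rewrite mxE !(block_mxEul, block_mxEur, block_mxEdl, block_mxEdr) !mxE /=;
by rewrite !(starZ cjR) ?scalerDr ?scalerA.
Qed.

Let C (y : E) := mo_cone S (1 + 1) (sym y).
Let L (y : E) := y.2.1.1 = 0 /\ y.2.2.2 = 0.
(** On matrices with scalar diagonal this is [r] times the trace, plus [g] at the upper corner and
    at the adjoint of the lower corner. *)
Let u (y : E) : R := r * ((y.1.1 + y.1.2) / 2) + (g : bdual _) y.2.1.2 + (g : bdual _) (ms_star y.2.2.1).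

Let sym0 : sym 0 = 0.
Proof.
have := symZ 0 0; rewrite scale0r => ->; apply/matrixP => i j.
by rewrite !mxE scale0r.
Qed.

Let ulin a x y : u (a *: x + y) = a * u x + u y.
Proof.
rewrite /u /= ms_star_lin !bdual_lin /=.
have -> (s t : R^o) : a *: s + t = a * s + t by [].
have -> (s t : R^o) : a *: s + t = a * s + t by [].
by field.
Qed.

Let star1 : ms_star one = one. Proof. exact: (star_unit cjR Sop). Qed.

(** Positivity of [[[l, z], [z^*, m]]] bounds the norm of [z] by the square root of [l m], which the
    inequality of the means bounds by [(l + m) / 2]. Adding [e] to the diagonal makes the scaling
    factors [p] and [q] positive. *)
Let upos y : L y -> C y -> 0 <= u y.
Proof.
case: y => [[l m] [[a b] [c d]]] [/= -> ->]; rewrite /C /u /= (star0 cjR) !addr0 !add0r => h.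
apply: (@ge0_of_eps _ _ r) => [|e e0]; first by case: hg.
have l0 : 0 <= l by apply: (cone_scaleE one0); exact: (cone_ul cjR Sop h).
have m0 : 0 <= m.
  apply: (cone_scaleE one0).
  have := cone_mxsub cjR Sop (fun _ : 'I_1 => i1) h; congr mo_cone.
  by apply/matrixP => i j; rewrite !ord1 mxE block_mxEdr !mxE.
pose p := Num.sqrt (m + e); pose q := Num.sqrt (l + e).
have p2 : p * p = m + e by rewrite -expr2 sqr_sqrtr // addr_ge0 // ltW.
have q2 : q * q = l + e by rewrite -expr2 sqr_sqrtr // addr_ge0 // ltW.
have p0 : 0 < p by rewrite sqrtr_gt0 ltr_wpDl.
have q0 : 0 < q by rewrite sqrtr_gt0 ltr_wpDl.
pose z := b + ms_star c.
have hz : mo_cone S (1 + 1) (blk2 ((q * q) *: one) z (ms_star z) ((p * p) *: one)).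
  have /(coneD cjR Sop h) := cone_blk2_diag (cone_eps1 (ltW e0)) (cone_eps1 (ltW e0)).
  congr mo_cone; apply: matrix2P;
  rewrite mxE !(block_mxEul, block_mxEur, block_mxEdl, block_mxEdr) !mxE ?addr0 //.
  - by rewrite q2 scalerDl.
  - by rewrite /z (starD cjR) ms_starK addrC.
  - by rewrite p2 scalerDl.
have [_ /(_ _ _ (blk2_norm_le (ltW p0) (ltW q0) hz))] := hg.
rewrite bdualZ normrM gtr0_norm ?mulr_gt0 // mulrCA ler_pM2l ?mulr_gt0 // => hz2.
have : - (r * (p * q)) <= (g : bdual _) z by move: hz2; rewrite ler_norml => /andP[].
rewrite bdualD => hz3.
have r0 : 0 <= r by case: hg.
have pq : p * q <= (l + m) / 2 + e.
  have := sqr_ge0 (p - q); rewrite sqrrB; move: p2 q2; rewrite !expr2; lra.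
have := ler_wpM2l r0 pq; lra.
Qed.

Let pairE (a : R) (x y : E) : a *: x + y =
  ((a * x.1.1 + y.1.1, a * x.1.2 + y.1.2),
   ((a *: x.2.1.1 + y.2.1.1, a *: x.2.1.2 + y.2.1.2),
    (a *: x.2.2.1 + y.2.2.1, a *: x.2.2.2 + y.2.2.2))).
Proof. by []. Qed.

Let cofinal y : exists2 x, L x & C (x - y).
Proof.
case: y => [[l m] [[a b] [c d]]].
have [s hs] := exists_norm_le cjR Sop a; have [t ht] := exists_norm_le cjR Sop d.
exists ((l + (s + s), m + (t + t)), ((0, b), (c, 0))); first by [].
have -> : ((l + (s + s), m + (t + t)), ((0, b), (c, 0))) - ((l, m), ((a, b), (c, d)))
    = ((s + s, t + t), ((- a, 0), (0, - d))) :> E.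
  by congr ((_, _), ((_, _), (_, _))) => /=; rewrite ?subrr ?sub0r // addrAC subrr add0r.
rewrite /C /= !(star0 cjR) !addr0 !(starN cjR) -!opprD.
by apply: cone_blk2_diag; rewrite addrC; exact: norm_le_re.
Qed.

(** [u] is a positive functional on the Paulsen system, the 2x2 matrices with scalar diagonal, and
    extends to a positive [U] on all 2x2 matrices. Setting [de v] to the value of [U] at
    [diag (v, v)] makes one functional serve both corners. *)
Lemma dominating_aux : exists de : opdual S,
  [/\ dstar de = de, (de : bdual _) one = 2 * r
    & forall Y, mo_cone S (1 + 1) Y -> 0 <= (de : bdual _) (Y i0 i0) +
        (g : bdual _) (Y i0 i1) + (dstar g : bdual _) (Y i1 i0) + (de : bdual _) (Y i1 i1)].
Proof.
have [||||||||U [Ulin Uu Upos]] := @riesz_extension R E C L u.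
- by rewrite /C sym0; exact: (cone0 cjR Sop).
- by move=> x y hx hy; rewrite /C symD; exact: (coneD cjR Sop hx hy).
- by move=> t x t0 hx; rewrite /C symZ; exact: (cone_zmx cjR Sop t0 hx).
- by [].
- move=> a x y [h1 h2] [h3 h4]; split=> /=; first by rewrite h1 h3 scaler0 addr0.
  by rewrite h2 h4 scaler0 addr0.
- by move=> a x y _ _; exact: ulin.
- exact: upos.
- exact: cofinal.
pose dd (v : S) : E := ((0, 0), ((v, 0), (0, v))).
have Uscal s : U ((s, s), ((0, 0), (0, 0))) = r * s.
  rewrite Uu //= /u /= (star0 cjR) !bdual0 !addr0; by field.
have del a v w : U (dd (a *: v + w)) = a * U (dd v) + U (dd w).
  rewrite -Ulin; congr U; rewrite pairE /dd /= !(scaler0, addr0, mulr0) //.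
have ddC v s : norm_le v s -> U (dd v) <= 2 * r * s.
  move=> hv; have : C ((s + s, s + s), ((- v, 0), (0, - v))).
    rewrite /C /= (star0 cjR) !addr0 (starN cjR) -!opprD.
    by apply: cone_blk2_diag; rewrite addrC; exact: norm_le_re.
  move=> /Upos.
  rewrite (_ : (_, _) = (-1) *: dd v + ((s + s, s + s), ((0, 0), (0, 0)))); last first.
    by rewrite pairE /dd /= !(scaler0, addr0, mulr0, add0r, scaleN1r).
  by rewrite Ulin Uscal; lra.
have deb v s : norm_le v s -> `|U (dd v)| <= 2 * r * s.
  move=> hv; rewrite ler_norml ddC // andbT lerNl.
  have := ddC _ _ (norm_leN cjR Sop hv).
  rewrite (_ : dd (- v) = dd ((-1) *: v + 0)) ?del ?scaleN1r ?addr0 //.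
  have := del (-1) v 0; have U0 : U (dd 0) = 0.
    have := del 1 0 0; rewrite scale1r addr0 mul1r => /eqP.
    by rewrite -subr_eq subrr eq_sym => /eqP.
  by rewrite U0 => _; rewrite addr0 mulN1r.
(* [C] contains the kernel of [sym], hence both signs of its elements, so [U] depends only on the
   symmetrized matrix. *)
have U0 y : sym y = 0 -> U y = 0.
  move=> y0; apply/eqP; rewrite eq_le; apply/andP; split; last first.
    by apply: Upos; rewrite /C y0; exact: (cone0 cjR Sop).
  have : 0 <= U ((-1) *: y + 0).
    apply: Upos; rewrite addr0 /C symZ y0.
    rewrite (_ : zmx _ _ = 0); first exact: (cone0 cjR Sop).
    by apply/matrixP => i j; rewrite !mxE scaler0.
  rewrite Ulin (_ : U 0 = 0); first by rewrite mulN1r addr0 oppr_ge0.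
  by have := Uscal 0; rewrite mulr0.
pose de : opdual S := mk_bdual del (ex_intro _ (2 * r) deb).
exists de; split.
- apply: bdualP => v; rewrite /=; apply/eqP; rewrite -subr_eq0.
  have -> : U (dd (ms_star v)) - U (dd v) = U ((-1) *: dd v + dd (ms_star v)).
    by rewrite Ulin mulN1r addrC.
  apply/eqP/U0; rewrite pairE /= !(scaler0, addr0, mulr0).
  rewrite !scaleN1r (starD cjR) (starN cjR) ms_starK (star0 cjR) scale0r !addr0.
  by rewrite !addrA !addrK !addNr; apply/esym/matrix2P; rewrite !mxE.
(* The identity matrix symmetrizes to twice the unit on the diagonal, as do the scalars [l = m = 2];
   hence the value [2 * r]. *)
- rewrite /=; have : U ((-2, -2), ((one, 0), (0, one))) = 0.
    apply: U0 => /=; rewrite star1 (star0 cjR) !addr0 scaleNr scaler_nat -mulr2n addrN.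
    by apply/esym/matrix2P; rewrite !mxE.
  rewrite (_ : (_, _) = 1 *: dd one + ((-2, -2), ((0, 0), (0, 0)))); last first.
    by rewrite pairE /dd /= !(scaler0, addr0, mulr0, add0r, scale1r).
  rewrite Ulin Uscal; lra.
move=> Y hY.
pose y1 : E := ((0, 0), ((Y i0 i0, Y i0 i1), (Y i1 i0, Y i1 i1))).
have st i j : ms_star (Y i j) = Y j i by rewrite (cone_starE cjR Sop j i hY).
have h1 : 0 <= U y1.
  apply: Upos; have := coneD cjR Sop hY hY; congr mo_cone.
  by rewrite /sym /= !st !scale0r !addr0; apply: matrix2P; rewrite mxE.
(* Since [de] adds up both corners, the claimed sum exceeds [U y1] by the value of [U] at the
   diagonal of [Y] in reversed order. *)
have h2 : 0 <= U ((0, 0), ((Y i1 i1, 0), (0, Y i0 i0))).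
  apply: Upos; rewrite /C /= !st !(star0 cjR) !scale0r !addr0.
  have pk i : mo_cone S 1 (const_mx (Y i i + Y i i)).
    have := cone_mxsub cjR Sop (fun _ : 'I_1 => i) (coneD cjR Sop hY hY); congr mo_cone.
    by apply/matrixP => k l; rewrite !mxE.
  exact: cone_blk2_diag.
suff e : (de : bdual _) (Y i0 i0) + (g : bdual _) (Y i0 i1) + (dstar g : bdual _) (Y i1 i0)
   + (de : bdual _) (Y i1 i1) = U y1 + U ((0, 0), ((Y i1 i1, 0), (0, Y i0 i0))).
  by rewrite e addr_ge0.
have -> : U y1 + U ((0, 0), ((Y i1 i1, 0), (0, Y i0 i0))) =
    U (1 *: dd (Y i0 i0) + (1 *: dd (Y i1 i1) + ((0, 0), ((0, Y i0 i1), (Y i1 i0, 0))))).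
  rewrite -[U y1]mul1r -Ulin; congr U; rewrite !pairE /= !(scaler0, addr0, mulr0, add0r, scale1r).
  by rewrite ![Y i1 i1 + _]addrC.
rewrite !Ulin !mul1r (Uu (_, ((0, Y i0 i1), (Y i1 i0, 0)))) // /u /=.
rewrite !addr0 mul0r mulr0 add0r; ring.
Qed.
End Functional.

Lemma evform_ccompress (g : opdual S) p (A : 'M[S]_p) m (al : 'M[R]_(p, m)) k l :
  evform g A (col k al) (col l al) = (g : bdual _) (ccompress idfun al A k l).
Proof.
rewrite evformE mxE (lf_sum (bdual_lin g)); apply: eq_bigr => a _.
rewrite (lf_sum (bdual_lin g)); apply: eq_bigr => b _.
by rewrite bdualZ !mxE mulrAC.
Qed.

(** Compressing [A] by the test vector reduces positivity at every matrix size to the 2x2 inequality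
    of [dominating_aux]. The bound at the unit later gives the boundedness of the weak
    expectation. *)
Lemma exists_dominating (g : opdual S) r : dual_norm_le g r -> exists de : opdual S,
  [/\ dominated de g 1, mo_cone (opdual S) 1 (const_mx de) & (de : bdual _) one <= 2 * r].
Proof.
move=> hg; have [de [sde d1 dpos]] : exists de : opdual S,
  [/\ dstar de = de, (de : bdual _) one <= 2 * r
    & forall Y, mo_cone S (1 + 1) Y -> 0 <= (de : bdual _) (Y i0 i0) +
        (g : bdual _) (Y i0 i1) + (dstar g : bdual _) (Y i1 i0) + (de : bdual _) (Y i1 i1)].
  (* [dominating_aux] reads the signs of [l] and [m] off multiples of the unit, so the unit must be
     nonzero; otherwise [S] is the zero space. *)
  have [u0|u0] := eqVneq one 0; last first.
    by have [de [h1 h2 h3]] := dominating_aux hg u0; exists de; rewrite h2.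
  have Sz (v : S) : v = 0.
    apply: (norm_le_eq0 cjR Sop) => e e0; have [t [t0 ht]] := exists_norm_le cjR Sop v.
    by split; [exact: ltW | move: ht; rewrite u0 !scaler0].
  exists 0; split; first exact: bdualP.
    by rewrite mulr_ge0 //; case: hg.
  by move=> Y _; rewrite !(Sz (Y _ _)) !bdual0 !addr0.
have Fstar k l : dstar (blk2 (1 *: de) g (dstar g) (1 *: de) l k) =
     blk2 (1 *: de) g (dstar g) (1 *: de) k l.
  rewrite -(@splitK 1 1 k) -(@splitK 1 1 l) scale1r.
  case: (fintype.split k) => k'; case: (fintype.split l) => l' /=;
  by rewrite !(block_mxEul, block_mxEur, block_mxEdl, block_mxEdr) !mxE ?dstarK.
exists de; split=> //.
  apply/opdual_coneP => p A hA; split=> [a b k l|x].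
    by rewrite -[in LHS]Fstar /= (cone_starE cjR Sop b a hA).
  rewrite arr_evform.
  pose al : 'M[R]_(p, 1 + 1) := \matrix_(a, k) x a k.
  have := dpos _ (cone_ccompress cjR Sop al hA).
  rewrite -!evform_ccompress scale1r.
  have colE k : \col_a x a k = col k al by apply/matrixP => i j; rewrite !mxE.
  rewrite !big_split_ord /= !big_ord1 !big_split_ord /= !big_ord1 !colE.
  rewrite !(block_mxEul, block_mxEur, block_mxEdl, block_mxEdr) !mxE.
  by rewrite !addrA.
apply/opdual_coneP => p A hA; split=> [a b k l|x].
  by rewrite !mxE -[in LHS]sde /= (cone_starE cjR Sop b a hA).
rewrite arr_evform !big_ord1 mxE.
pose al : 'M[R]_(p, 1 + 1) := \matrix_(a, k) (if k == i0 then x a 0 else 0).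
have := dpos _ (cone_ccompress cjR Sop al hA); rewrite -!evform_ccompress.
have -> : col i1 al = 0 by apply/matrixP => i j; rewrite !mxE.
have -> : col i0 al = \col_a x a 0 by apply/matrixP => i j; rewrite !mxE.
have ev0l h y : evform h A 0 y = 0.
  by rewrite evformE big1 // => i _; rewrite big1 // => j _; rewrite mxE !mul0r.
have ev0r h y : evform h A y 0 = 0.
  by rewrite evformE big1 // => i _; rewrite big1 // => j _; rewrite mxE mulr0.
by rewrite !(ev0l, ev0r) !addr0.
Qed.
End Domination.

(** * From finite-dimensional test systems to the weak expectation property *)

Section Span.
Variables (R : realType) (V : lmodType R) (B : seq V).

Definition in_span (v : V) : Prop :=
  exists c : 'I_(size B) -> R, v = \sum_i c i *: B`_i.

Lemma in_span_submod : submod_closed (fun v => `[< in_span v >]).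
Proof.
split=> [|a u v /asboolP[c ->] /asboolP[d ->]]; apply/asboolP.
  by exists (fun=> 0); rewrite big1 // => i _; rewrite scale0r.
exists (fun i => a * c i + d i); rewrite scaler_sumr -big_split.
by apply: eq_bigr => i _; rewrite /= scalerA scalerDl.
Qed.

Lemma in_span_mem v : v \in B -> in_span v.
Proof.
move=> vB; have h : (index v B < size B)%N by rewrite index_mem.
exists (fun i => (i == Ordinal h)%:R); rewrite (bigD1 (Ordinal h)) //= eqxx scale1r.
rewrite big1 ?addr0 ?nth_index // => i /negPf ->; by rewrite scale0r.
Qed.

Lemma in_span_ind (Q : V -> Prop) : Q 0 ->
  (forall a u v, Q u -> Q v -> Q (a *: u + v)) -> (forall v, v \in B -> Q v) ->
  forall v, in_span v -> Q v.
Proof.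
move=> Q0 Ql QB v [c ->]; elim: (index_enum _) => [|i r IH]; first by rewrite big_nil.
by rewrite big_cons; apply: Ql => //; apply: QB; exact: mem_nth.
Qed.

Lemma in_span_fd : finite_dimensional (subsp in_span_submod).
Proof.
pose b (i : 'I_(size B)) := mk_subsp in_span_submod (in_span_mem (mem_nth 0 (ltn_ord i))).
exists (size B), b => v; have [c hc] := subspP v; exists c; apply: subsp_inj.
rewrite hc; apply/esym.
by apply: (big_morph (fun w : subsp in_span_submod => (w : V))).
Qed.
End Span.

Section FdSystem.
Variable R : realType.
Variable S : opsys (@idfun R).

Lemma opdual_cone0 n : mo_cone (opdual S) n 0.
Proof.
apply/opdual_coneP => p A _; split=> [a b k l|x]; first by rewrite !mxE.
rewrite big1 // => a _; rewrite big1 // => b _; rewrite big1 // => k _.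
by rewrite big1 // => l _; rewrite mxE mulr0 mul0r.
Qed.

Lemma opdual_coneD n (F G : 'M[opdual S]_n) :
  mo_cone (opdual S) n F -> mo_cone (opdual S) n G -> mo_cone (opdual S) n (F + G).
Proof.
move=> /opdual_coneP hF /opdual_coneP hG; apply/opdual_coneP => p A hA.
have [f1 f2] := hF p A hA; have [g1 g2] := hG p A hA; split=> [a b k l|x].
  by rewrite !mxE opdual_addE [RHS]opdual_addE f1 g1.
have := addr_ge0 (f2 x) (g2 x); congr (0 <= _).
do 4![rewrite -big_split; apply: eq_bigr => ? _ /=].
by rewrite mxE opdual_addE mulrDr mulrDl.
Qed.

Definition pos_functional (de : opdual S) := mo_cone (opdual S) 1 (const_mx de).

Lemma pos_functional_form de n (A : 'M[S]_n) x : pos_functional de ->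
  mo_cone S n A -> 0 <= evform de A x x.
Proof.
by move=> hd hA; have := cone_evform (fun _ => x) hd hA; rewrite !big_ord1 mxE.
Qed.

Lemma evformD de de' n (A : 'M[S]_n) x y :
  evform (de + de') A x y = evform de A x y + evform de' A x y.
Proof. by have := evform_lin A x y 1 de de'; rewrite scale1r mul1r. Qed.

Lemma evform_sqD g n (A : 'M[S]_n) x y : evform g A (x + y) (x + y) =
  evform g A x x + evform g A x y + evform g A y x + evform g A y y.
Proof.
rewrite !evformE -!big_split; apply: eq_bigr => i _ /=.
rewrite -!big_split; apply: eq_bigr => j _ /=; rewrite !mxE; ring.
Qed.

Lemma evform0 n (A : 'M[S]_n) x y : evform (0 : opdual S) A x y = 0.
Proof.
rewrite evformE big1 // => i _; rewrite big1 // => j _.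
by rewrite (_ : ((0 : opdual S) : bdual _) (A i j) = 0) // mulr0 mul0r.
Qed.

Lemma exists_dual_norm_le (g : opdual S) : exists r, dual_norm_le g r.
Proof.
have [M hM] := bdual_bnd g; exists (Num.max M 0); split; first by rewrite le_max lexx orbT.
move=> v s vs; apply: le_trans (hM v s vs) _.
by rewrite ler_wpM2r //; [case: vs | rewrite le_max lexx].
Qed.

Lemma exists_dominating_seq (G : seq (opdual S)) : exists de : opdual S,
  pos_functional de /\ forall g, g \in G -> form_dominated de g 1.
Proof.
elim: G => [|g G [de [hde IH]]].
  by exists 0; split=> //; have := opdual_cone0 1; congr mo_cone; apply/matrixP => i j; rewrite !mxE.
have [r hr] := exists_dual_norm_le g.
have [dg [/dominated_form hg pg _]] := exists_dominating hr.
exists (dg + de); split.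
  have := opdual_coneD pg hde; congr mo_cone.
  by apply/matrixP => i j; rewrite !mxE.
move=> h; rewrite inE => /predU1P[->|/IH hh] n A x y hA.
  have := hg n A x y hA; have := pos_functional_form x hde hA.
  have := pos_functional_form y hde hA; rewrite !evformD; lra.
have := hh n A x y hA; have := pos_functional_form x pg hA.
have := pos_functional_form y pg hA; rewrite !evformD; lra.
Qed.

(** The system is the span of [G], the adjoints, and one functional dominating all of [G];
    domination passes to adjoints and to linear combinations. *)
Lemma fd_dual_system (G : seq (opdual S)) : exists (X : opsys (@idfun R))
  (v : {linear X -> opdual S}),
  [/\ finite_dimensional X, injective v, forall x, v (ms_star x) = dstar (v x),
      forall n (A : 'M[X]_n), mo_cone X n A <-> mo_cone (opdual S) n (map_mx v A)
    & forall g, g \in G -> exists x, v x = g].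
Proof.
have [de [hde hG]] := exists_dominating_seq G.
pose B := de :: G ++ map (@dstar R S) G.
pose P := in_span (B : seq (dualsys de)).
pose Pc := in_span_submod (B : seq (dualsys de)).
have Pde : P de by apply: in_span_mem; rewrite mem_head.
have sde := dstar_de hde.
have Pstar : forall g : dualsys de, P g -> P (ms_star g).
  apply: (@in_span_ind _ _ _ (fun g => P (ms_star g))) => [|a u v hu hv|u].
  - rewrite (_ : ms_star 0 = 0); last exact: bdualP.
    by case: Pc => /asboolP.
  - rewrite ms_star_lin; case: Pc => _ h.
    by apply/asboolP/h; apply/asboolP.
  rewrite inE => /predU1P[->|]; first by rewrite /= sde.
  rewrite mem_cat => /orP[uG|/mapP[w wG ->]].
    by apply: in_span_mem; rewrite inE mem_cat map_f ?orbT.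
  by rewrite /= dstarK; apply: in_span_mem; rewrite inE mem_cat wG orbT.
have Pdom : forall g : dualsys de, P g -> exists2 c, 0 <= c & form_dominated de g c.
  apply: (@in_span_ind _ _ _ (fun g => exists2 c, 0 <= c & form_dominated de g c)) => [|a u v [c c0 hu] [d d0 hv]|u].
  - by exists 0 => // n A x y hA; rewrite (evform0 A x y) !mul0r !mulr0 !addr0.
  - exists (`|a| * c + d); first by rewrite addr_ge0 // mulr_ge0.
    move=> n A x y hA; rewrite evform_lin; have h1 := hv n A x y hA.
    suff h2 : 0 <= `|a| * (c * evform de A x x + c * evform de A y y) + 2 * (a * evform u A x y).
      by move: h1 h2; lra.
    case: (ger0P a) => a0.
      by have := mulr_ge0 a0 (hu n A x y hA); lra.
    (* A negative coefficient is absorbed by using the hypothesis at [- x]. *)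
    have na0 : 0 <= - a by rewrite oppr_ge0 ltW.
    have := mulr_ge0 na0 (hu n A (- x) y hA).
    have := evformZ de A (-1) (-1) x x; have := evformZ u A (-1) 1 x y.
    rewrite !scaleN1r scale1r => -> ->; lra.
  rewrite inE => /predU1P[->|].
    exists 1 => // n A x y hA.
    have := pos_functional_form (x + y) hde hA; rewrite evform_sqD.
    have := evform_dstar de x y hA; rewrite sde => ->; lra.
  rewrite mem_cat => /orP[uG|/mapP[w wG ->]]; exists 1 => //; first exact: hG.
  move=> n A x y hA; rewrite evform_dstar //.
  have := hG w wG n A y x hA; lra.
have Xop := dualsys_opsys hde Pc Pstar Pde Pdom.
exists (OpSys Xop), (subsys_val Pc Pstar Pde); split.
- exact: in_span_fd.
- exact: subsp_inj.
- by [].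
- by [].
move=> g gG; have hg : P g by apply: in_span_mem; rewrite inE mem_cat gG orbT.
by exists (mk_subsp Pc hg).
Qed.
End FdSystem.

Lemma sum_mxtens (U : nmodType) p q (F : 'I_(p * q) -> U) :
  \sum_I F I = \sum_(a < p) \sum_(k < q) F (mxtens_index (a, k)).
Proof.
rewrite (reindex (@mxtens_index p q)) /=; last first.
  exists (@mxtens_unindex p q) => I _; [exact: mxtens_indexK | exact: mxtens_unindexK].
rewrite (pair_bigA _ (fun a k => F (mxtens_index (a, k)))) /=.
by apply: eq_bigr => -[].
Qed.

Lemma compress_kron (R : realType) (V W : lmodType R) p q n (A : 'M[V]_p) (B : 'M[W]_q)
    (al : 'M[R]_(p * q, n)) r s :
  compress al (kron A B) r s = \sum_a \sum_b \sum_k \sum_l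
    (al (mxtens_index (a, k)) r * al (mxtens_index (b, l)) s) *: pure (A a b) (B k l).
Proof.
rewrite mxE sum_mxtens; apply: eq_bigr => a _.
rewrite [RHS]exchange_big; apply: eq_bigr => k _ /=.
rewrite sum_mxtens; apply: eq_bigr => b _; apply: eq_bigr => l _.
by rewrite mxE !mxtens_indexK.
Qed.

(** * Extending the evaluation pairing of a system with its dual *)

Section FdWep.
Variable R : realType.
Let cjR := conj_field_real R.
Variable S : opsys (@idfun R).
(** The unit 0 is a placeholder: [gen] is built from the cones alone. *)
Let Dm : matsys (@idfun R) := dualsys (0 : opdual S).

Let pairl (g : Dm) a (s s' : S) : (g : bdual _) (a *: s + s') = a * (g : bdual _) s + (g : bdual _) s'.
Proof. exact: bdual_lin. Qed.
Let pairr (s : S) a (g h : Dm) :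
  ((a *: g + h : Dm) : bdual _) s = a * (g : bdual _) s + (h : bdual _) s.
Proof. by []. Qed.
Definition pairing (t : tensor S Dm) : R := (t : _ -> R^o) (mk_bilinear pairl pairr).

Lemma pairing_lin a t u : pairing (a *: t + u) = a * pairing t + pairing u.
Proof. exact: tensor_linear. Qed.
Lemma pairing_pure s g : pairing (pure s g) = (g : bdual _) s.
Proof. by []. Qed.

Lemma pairing_star t : pairing (tmap (@ms_star R _ S) (@ms_star R _ Dm) t) = pairing t.
Proof.
have [s ->] := tensor_span_pure t; rewrite tmap_sum !(lf_sum pairing_lin).
by apply: eq_bigr => p _; rewrite tmap_pure !pairing_pure /= ms_starK.
Qed.

Lemma pairing_gen (w : 'M[tensor S Dm]_1) : gen w -> 0 <= pairing (w 0 0).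
Proof.
elim=> [|p q A B al x hA hB _ IH]; first by rewrite mxE (lf0 pairing_lin).
rewrite mxE (lfD pairing_lin) addr_ge0 // compress_kron.
have /opdual_coneP /(_ _ _ hA)[_ /(_ (fun a k => al (mxtens_index (a, k)) 0))] := hB.
congr (0 <= _); do 4![rewrite (lf_sum pairing_lin); apply: eq_bigr => ? _].
by rewrite (lfZ pairing_lin) pairing_pure mulrAC.
Qed.

Lemma lift_tensor (V : lmodType R) (t : tensor V Dm) : exists G : seq (opdual S),
  forall (X : lmodType R) (v : {linear X -> Dm}), (forall g, g \in G -> exists x, v x = g) ->
  exists t' : tensor V X, t = tmap idfun v t'.
Proof.
have [s ->] := tensor_span_pure t; elim: s => [|[a g] s [G IH]].
  by exists [::] => X v _; exists 0; rewrite big_nil tmap0.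
exists (g :: G) => X v hG; have [x vx] := hG g (mem_head _ _).
have [|t' ht] := IH X v; first by move=> h hh; apply: hG; rewrite inE hh orbT.
by exists (pure a x + t'); rewrite big_cons ht tmapD tmap_pure /= vx.
Qed.

(** The entries of the matrices over the dual that occur in [y] form a finite list, and the same
    expression can be written over any system containing them with the induced cones. The list is
    fixed before [X], so that one [X] can serve several elements. *)
Lemma lift_gen (V : matsys (@idfun R)) n (y : 'M[tensor V Dm]_n) : gen y ->
  exists G : seq (opdual S), forall (X : matsys (@idfun R)) (v : {linear X -> Dm}),
  (forall m (A : 'M[X]_m), mo_cone X m A <-> mo_cone Dm m (map_mx v A)) ->
  (forall g, g \in G -> exists x, v x = g) ->
  exists2 y' : 'M[tensor V X]_n, gen y' & y = map_mx (tmap idfun v) y'.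
Proof.
elim=> [|p q A B al x hA hB _ [G IH]].
  exists [::] => X v _ _; exists 0; first exact: gen0.
  by apply/matrixP => i j; rewrite !mxE tmap0.
exists (codom (fun ij : 'I_q * 'I_q => B ij.1 ij.2) ++ G) => X v vc hG.
have [|y' gy ->] := IH X v vc; first by move=> g hg; apply: hG; rewrite mem_cat hg orbT.
have /choice[b hb] : forall ij : 'I_q * 'I_q, exists x, v x = B ij.1 ij.2.
  move=> ij; apply: hG; rewrite mem_cat; apply/orP; left.
  exact: (codom_f (fun ij : 'I_q * 'I_q => B ij.1 ij.2)).
pose B' : 'M[X]_q := \matrix_(i, j) b (i, j).
have vB : map_mx v B' = B by apply/matrixP => i j; rewrite !mxE hb.
exists (compress al (kron A B') + y'); first by apply: genS => //; apply/vc; rewrite vB.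
have -> : compress al (kron A B) = map_mx (tmap idfun v) (compress al (kron A B')).
  by rewrite (map_compress (tmap_linear _ _)) map_kron vB map_mx_id.
by apply/matrixP => i j; rewrite !mxE tmapD.
Qed.

Section Envelope.
Hypothesis hfd : forall T : opsys (@idfun R), finite_dimensional T -> el_eq_max S T.
Variables (I : opsys (@idfun R)) (j : {linear S -> I}).
Hypothesis je : injective_envelope j.
Let Iop := os_repr I.

Lemma gen_pairing_ge0 (w : 'M[tensor S Dm]_1) :
  gen (map_mx (tmap j idfun) w : 'M[tensor I Dm]_1) -> 0 <= pairing (w 0 0).
Proof.
move=> hw; have [G1 hG1] := lift_gen hw; have [G2 hG2] := lift_tensor (w 0 0).
have [X [v [Xfd vi vs vc vG]]] := fd_dual_system (G1 ++ G2).
have [y' gy' wy'] : exists2 y' : 'M[tensor I X]_1, gen y' &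
    map_mx (tmap j idfun) w = map_mx (tmap idfun (v : {linear X -> Dm})) y'.
  by apply: hG1 => // g hg; apply: vG; rewrite mem_cat hg.
have [t' wt'] : exists t' : tensor S X, w 0 0 = tmap idfun (v : {linear X -> Dm}) t'.
  by apply: hG2 => // g hg; apply: vG; rewrite mem_cat hg orbT.
pose w' : 'M[tensor S X]_1 := const_mx t'.
have ww : w = map_mx (tmap idfun (v : {linear X -> Dm})) w'.
  by apply/matrixP => a b; rewrite !ord1 wt' !mxE.
(* The lift of [w] and the lift of its decomposition agree in [I (x) X] because [v] is injective.
   Hence [w'] is positive in [I (x) X], and the hypothesis on finite-dimensional systems applies. *)
have yw : map_mx (tmap j idfun) w' = y'.
  apply/matrixP => a b; apply: (@tmap_inj _ _ _ _ _ idfun (v : {linear X -> Dm})) => //.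
  move/matrixP/(_ a b): wy'; rewrite ww !mxE => <-.
  by rewrite !(tmap_comp (j2 := j) (k2 := v : {linear X -> Dm})).
have Xop := os_repr X.
have : max_cone w'.
  apply/(hfd Xfd); exists I, j; split=> //; rewrite yw; apply/max_coneP; split.
    exact: gen_opsys_star.
  move=> e e0; apply: gen_add => //; rewrite diag_constZ.
  exact: gen_scale (ltW e0) (gen_diag_unit _ _ _).
move=> /max_coneP[_ hm].
have vcp : cp (v : {linear X -> Dm}) by move=> n A /vc.
have gp (z : 'M[tensor S X]_1) : gen z -> 0 <= pairing (tmap idfun (v : {linear X -> Dm}) (z 0 0)).
  move=> /(gen_map (j := idfun) (@cp_id _ S) vcp) /pairing_gen.
  by rewrite mxE.
pose e := pure (ms_unit S) (ms_unit X).
apply: (@ge0_of_eps _ _ (pairing (tmap idfun (v : {linear X -> Dm}) e))).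
  by have := gp _ (gen_diag_unit S X 1); rewrite mxE eqxx.
move=> a a0; have := gp _ (hm a a0); rewrite mxE tmapD [diag_const _ _ _ _]mxE eqxx tmapZ.
by rewrite (lfD pairing_lin) (lfZ pairing_lin) mxE -wt'.
Qed.

Local Notation E := (tensor I Dm).
Local Notation st := (tmap (@ms_star R _ I) (@ms_star R _ Dm)).
Local Notation tj := (tmap j (@idfun Dm)).
Let C (t : E) := gen (const_mx (t + st t) : 'M[E]_1).
Let const_mxD (t u : E) : const_mx (t + u) = const_mx t + const_mx u :> 'M[E]_1.
Proof. by apply/matrixP => a b; rewrite !mxE. Qed.
Let stK t : st (st t) = t. Proof. exact: tmap_starK. Qed.

Let tj_st t : st (tj t) = tj (tmap (@ms_star R _ S) (@ms_star R _ Dm) t).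
Proof.
have [_ [_ _ js _] _] := je.
have [s ->] := tensor_span_pure t; rewrite !tmap_sum.
by apply: eq_bigr => p _; rewrite !tmap_pure /= js.
Qed.

Let C0 : C 0.
Proof.
rewrite /C tmap0 addr0 (_ : const_mx 0 = 0); first exact: gen0.
by apply/matrixP => a b; rewrite !mxE.
Qed.
Let CD x y : C x -> C y -> C (x + y).
Proof.
by move=> hx hy; rewrite /C tmapD addrACA const_mxD; exact: gen_add.
Qed.
Let CZ a x : 0 <= a -> C x -> C (a *: x).
Proof.
move=> a0 /(gen_scale a0); rewrite /C; congr gen.
by apply/matrixP => i k; rewrite mxl_scaleE !mxE tmapZ scalerDr.
Qed.

(** It serves twice: for the cofinality required by the theorem of Riesz, and for the boundedness of
    the functional on the dual that an element of [I] defines. *)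
Lemma pure_bound (a : I) s (g de : opdual S) : norm_le a s -> dominated de g 1 ->
  C (pure (s *: ms_unit I) (de : Dm) - pure a (g : Dm)).
Proof.
move=> [_ ha] hd.
have sde : dstar de = de.
  by have := opdual_cone_star (lshift 1 ord0) (lshift 1 ord0) hd; rewrite block_mxEul mxE scale1r.
have : mo_cone Dm (1 + 1) (blk2 (de : Dm) (g : Dm) (ms_star (g : Dm)) (de : Dm)).
  by move: hd; rewrite /dominated scale1r.
move=> /(gen_bound (n := 1) 0 0 ha).
set X := pure _ _; set Z := pure a _; set W := pure (ms_star a) _ => h.
have uE (u : E) : unit_mx 0 0 u = const_mx u :> 'M[E]_1.
  by apply/matrixP => i k; rewrite !ord1 !mxE.
have sX : st X = X.
  by rewrite tmap_pure /X /= (starZ cjR) (star_unit cjR Iop) sde.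
have sZ : st Z = W by rewrite tmap_pure.
have cB (t u : E) : const_mx (t - u) = const_mx t - const_mx u :> 'M[E]_1.
  by apply/matrixP => i k; rewrite !mxE.
have e : X - Z + st (X - Z) = X + X - (Z + W).
  by rewrite tmapD -scaleN1r tmapZ sX sZ !scaleN1r addrACA opprD.
by rewrite /C e cB !const_mxD -!uE.
Qed.

Lemma exists_functional : exists U : E -> R,
  [/\ forall a x y, U (a *: x + y) = a * U x + U y,
      forall t, U (tj t) = pairing t & forall x, C x -> 0 <= U x].
Proof.
have [_ [ji j1 _ _] _] := je.
(* The retraction makes the pairing, given on the range of [tj], a function on the whole tensor
   product. *)
have [rr rj] := linear_retraction ji.
pose u (t : E) := pairing (tmap rr idfun t).
have uj t : u (tj t) = pairing t.
  rewrite /u; congr pairing; have [s ->] := tensor_span_pure t; rewrite !tmap_sum.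
  by apply: eq_bigr => p _; rewrite !tmap_pure rj.
have [||||||||U [Ulin Uu Upos]] := @riesz_extension R E C (fun t => exists z, t = tj z) u.
- exact: C0.
- exact: CD.
- exact: CZ.
- by exists 0; rewrite tmap0.
- by move=> a _ _ [x ->] [y ->]; exists (a *: x + y); rewrite tmapD tmapZ.
- by move=> a x y _ _; rewrite /u tmapD tmapZ pairing_lin.
- move=> _ [z ->]; rewrite /C tj_st -tmapD uj => h.
  have := @gen_pairing_ge0 (const_mx (z + tmap (@ms_star R _ S) (@ms_star R _ Dm) z)).
  rewrite map_const_mx => /(_ h); rewrite mxE (lfD pairing_lin) pairing_star.
  by move=> ?; lra.
(* A pure tensor is bounded by a multiple of the unit of [I] tensored with a dominating functional;
   this bound lies in the range of [tj] because [j] is unital. *)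
- move=> y; have [s ->] := tensor_span_pure y; elim: s => [|[a g] s [l [z hz] hl]].
    by exists 0; [exists 0; rewrite tmap0 | rewrite big_nil subr0; exact: C0].
  have [t ht] := exists_norm_le cjR Iop a.
  have [r hr] := exists_dual_norm_le (g : opdual S).
  have [de [hd _ _]] := exists_dominating hr.
  exists (pure (t *: ms_unit I) (de : Dm) + l).
    exists (pure (t *: ms_unit S) (de : Dm) + z).
    by rewrite tmapD tmap_pure linearZ /= j1 hz.
  by rewrite big_cons opprD addrACA; apply: CD => //; exact: pure_bound.
by exists U; split=> // t; rewrite Uu ?uj //; exists t.
Qed.

Lemma fd_el_eq_max_wep : real_wep S.
Proof.
have [Iinj [ji j1 js jc] _] := je.
have [U [Ulin Uj Upos]] := exists_functional.
have gen_pos t : st t = t -> gen (const_mx t : 'M[E]_1) -> 0 <= U t.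
  move=> ts h; apply: Upos; rewrite /C ts const_mxD; exact: gen_add.
have Ust t : U (st t) = U t.
  suff h x : 0 <= U (x - st x).
    have e x : U (x - st x) = U x - U (st x) by rewrite (lfD Ulin) (lfN Ulin).
    have := h t; have := h (st t); rewrite !e stK => h2 h1.
    by apply/eqP; rewrite eq_le; apply/andP; split; lra.
  apply: Upos; rewrite /C (_ : _ + _ = 0).
    by have := C0; rewrite /C tmap0 addr0.
  by rewrite tmapD -[- st x]scaleN1r tmapZ stK !scaleN1r addrA subrK subrr.
have Upure s (g : Dm) : U (pure (j s) g) = (g : bdual _) s.
  by have := Uj (pure s g); rewrite tmap_pure.
pose f (a : I) (g : opdual S) : R := U (pure a (g : Dm)).
have fbnd a : exists M : R, forall g r, dual_norm_le g r -> `|f a g| <= M * r.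
  (* The functional is bounded by [s] times the value of a dominating [de] at the unit, and that
     value is at most [2 * r]. *)
  have [s hs] := exists_norm_le cjR Iop a; exists (s * 2) => g r hr.
  have [de [hd _ d1]] := exists_dominating hr.
  have ub b : norm_le b s -> f b g <= s * 2 * r.
    move=> hb; have := Upos _ (pure_bound hb hd).
    rewrite (lfD Ulin) (lfN Ulin) subr_ge0 => h; apply: le_trans h _.
    have -> : U (pure (s *: ms_unit I) (de : Dm)) = s * (de : bdual _) (ms_unit S).
      by rewrite pureZl (lfZ Ulin) -j1 Upure.
    by rewrite -mulrA ler_wpM2l //; case: hs.
  rewrite ler_norml ub // andbT lerNl.
  have := ub _ (norm_leN cjR Iop hs).
  by rewrite /f -scaleN1r pureZl (lfZ Ulin) mulN1r.
have flin a c g h : f a (c *: g + h) = c * f a g + f a h.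
  by rewrite /f pureDr pureZr Ulin.
pose phi0 (a : I) : bidual S := mk_bdual (flin a) (fbnd a).
have phil : linear phi0.
  by move=> c a b; apply: bdualP => g; rewrite /= /f pureDl pureZl Ulin.
exists I, j; split=> //; exists (mk_linear phil); split.
- move=> n A hA; apply/bidual_coneP => m F hF; split=> [i k a b|x].
    rewrite !mxE /= /f -[LHS]Ust tmap_pure /=.
    by rewrite (cone_starE cjR Iop _ _ hA) (opdual_cone_star _ _ hF).
  (* The test vector, flattened into one column, turns the form into the value of [U] at a generator
     of the cone. *)
  pose al : 'M[R]_(n * m, 1) := \matrix_(K, _) x (mxtens_unindex K).2 (mxtens_unindex K).1.
  have hg : gen (compress al (kron (A : 'M[I]_n) (F : 'M[Dm]_m))) by exact: gen1.
  have hst := gen_star (fun p B => @cone_star _ _ cjR I Iop p B) _ hg.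
  have {}hst : tensor_mxstar (compress al (kron A (F : 'M[Dm]_m))) = compress al (kron A F).
    apply: hst => q B hB; apply/matrixP => i k; rewrite mxE.
    exact: (opdual_cone_star i k hB).
  set T := compress al _ in hg hst.
  have Tc : T = const_mx (T 0 0) by apply/matrixP => i k; rewrite !ord1 [RHS]mxE.
  have : 0 <= U (T 0 0).
    apply: gen_pos; last by rewrite -Tc.
    by move/matrixP/(_ 0 0): hst; rewrite mxE.
  congr (0 <= _); rewrite /T compress_kron.
  under [RHS]eq_bigr do rewrite exchange_big /=.
  rewrite [RHS]exchange_big (lf_sum Ulin); apply: eq_bigr => a _ /=.
  under [RHS]eq_bigr do rewrite exchange_big /=.
  rewrite [RHS]exchange_big (lf_sum Ulin); apply: eq_bigr => b _ /=.
  rewrite (lf_sum Ulin); apply: eq_bigr => k _.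
  rewrite (lf_sum Ulin); apply: eq_bigr => l _.
  by rewrite (lfZ Ulin) !mxE !mxtens_indexK /= mulrAC.
- by move=> g; rewrite /= /f -j1 Upure.
- by move=> s g; exact: Upure.
Qed.
End Envelope.
End FdWep.

Theorem theorem11p3 (R : realType) (S : opsys (@idfun R)) :
  [<-> real_wep S;
       complex_wep (complexification S);
       forall T : opsys (@idfun R), el_eq_max S T;
       forall T : opsys (@idfun R), finite_dimensional T -> el_eq_max S T].
Proof.
tfae; first exact: real_wep_complexification.
- by move=> h T; apply: real_wep_el_eq_max; exact: complex_wep_real.
- by move=> h T _; exact: h.
move=> h.
(* A matrix of size 0 lies in every maximal cone; by hypothesis it lies in the cone of the other
   tensor product too, and this membership supplies an injective envelope of [S]. *)
have [X [_ [Xfd _ _ _ _]]] := fd_dual_system ([::] : seq (opdual S)).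
have empty (u v : 'M[tensor S X]_0) : u = v by apply/matrixP => -[].
have /(h X Xfd)[I [j [je _]]] : max_cone (0 : 'M[tensor S X]_0).
  apply/max_coneP; split=> [|e _]; first exact: empty.
  by rewrite (empty (_ + _) 0); exact: gen0.
exact: (fd_el_eq_max_wep h je).
Qed.
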